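(* Let $(X,\tau,d,\mathfrak m)$ be a forward extended Polish metric measure space satisfying (A1) and (A2), let $p\in(1,\infty)$, $\frac1p+\frac1q=1$, and let $\mathsf{Ch}^+_{w,q}$ be the weak forward $q$-Cheeger energy on the class of $\mathfrak m$-measurable, $\mathfrak m$-a.e. finite functions on $X$. Then $\mathsf{Ch}^+_{w,q}$ is convex, and it is sequentially lower semi-continuous with respect to $\mathfrak m$-a.e. pointwise convergence: if $f_i\to f$ $\mathfrak m$-a.e. (with $f_i,f$ in this class), then $\mathsf{Ch}^+_{w,q}(f)\le\liminf_{i\to\infty}\mathsf{Ch}^+_{w,q}(f_i)$.
   Context: An asymmetric extended metric space $(X,d)$ is a set with $d:X\times X\to[0,\infty]$ such that $d(x,y)=0$ iff $x=y$, and $d(x,z)\le d(x,y)+d(y,z)$ (no symmetry). $B^+_x(r)=\{y:d(x,y)<r\}$. For $A\subset X$, $\lambda_d(A)=\inf\{\lambda\ge1: d(x,y)\le\lambda d(y,x)\ \forall x,y\in A\}$. $X_{[x]}=\{y:d(x,y)<\infty\}$. $(X,d)$ is a forward extended metric space if $X$ is a disjoint union of sets $X_{[x_\alpha]}$ and there are non-decreasing functions $\Theta_\alpha:(0,\infty)\to[1,\infty)$ with $\lambda_d(B^+_{x_\alpha}(r))\le\Theta_\alpha(r)$ for all $r>0$; it carries the topology generated by forward balls, which coincides with that of the symmetrized metric $\hat d(x,y)=\frac12(d(x,y)+d(y,x))$ (the $d$-topology). It is forward complete if every sequence such that for all $\varepsilon>0$ there is $N$ with $d(x_i,x_j)<\varepsilon$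 for $j\ge i\ge N$ converges in the $d$-topology. A forward extended Polish space $(X,\tau,d)$: (1) $(X,d)$ is a forward complete forward extended metric space; (2) $\tau$ is a Polish topology on $X$; (3) $d(x_i,x)\to0$ implies $x_i\to x$ in $\tau$; (4) $d$ is lower semi-continuous on $X\times X$ for $\tau\times\tau$. Unless $d$ is mentioned, topological notions (compact, Borel, continuous) refer to $\tau$. A forward extended Polish metric measure space $(X,\tau,d,\mathfrak m)$ is such a space with a nonnegative Borel $\sigma$-finite measure $\mathfrak m$. (A1) There is a Borel function $V:X\to[0,\infty)$, forward Lipschitz (i.e. $V(y)-V(x)\le C d(x,y)$ for all $x,y$ and some $C>0$), bounded on every $\tau$-compact set, with $\int_X e^{-V^2}\,d\mathfrak m\le1$; such $V$ is fixed. (A2) For every $\tau$-compact $K$ there is $r>0$ such that the $d$-closure of $B^-_K(r)=\{x:\inf_{z\in K}d(x,z)<r\}$ has finite $\mathfrak m$-measure. Curves: $\gamma:I\to X$ is forward (resp. backward) $p$-absolutely continuous if there is $0\le g\in L^p(I)$ with $d(\gamma(s),\gamma(t))\le\int_s^t g$ (resp. $d(\gamma(t),\gamma(s))\le\int_s^tg$) for all $s\le t$ in $I$; $\mathsf{AC}^p(I;X)$ is the set of curves that are both. $|\gamma'_+|(t)=\lim_{h\to0^+}d(\gamma(t),\gamma(t+h))/h$ (exists a.e.). $C_\tau([0,1];X)$ is the space of $\tau$-continuous curves with the compact-open topology; $e_t(\gamma)=\gamma(t)$. A $p$-test plan is a Borel probability measure $\eta$ on $C_\tau([0,1];X)$ concentrated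 on $\mathsf{AC}^p([0,1];X)$ with $(e_t)_\sharp\eta\ll\mathfrak m$ for all $t\in[0,1]$. It has bounded compression on the sublevels of $V$ if for every $M\ge0$ there is $C\in[0,\infty)$ with $((e_t)_\sharp\eta)[\{x\in B:V(x)\le M\}]\le C\mathfrak m[B]$ for all Borel $B$ and $t\in[0,1]$. $\mathfrak T_p$ is the collection of all $p$-test plans with bounded compression on the sublevels of $V$. A property holds for $\mathfrak T_p$-almost every curve if it holds $\eta$-a.e. for every $\eta\in\mathfrak T_p$. An $\mathfrak m$-measurable $G:X\to[0,\infty]$ is a $\mathfrak T_p$-weak forward upper gradient of $f$ if $f(\gamma(1))-f(\gamma(0))\le\int_0^1G(\gamma(s))|\gamma'_+|(s)\,ds<\infty$ for $\mathfrak T_p$-almost every $\gamma$. If $f$ admits one, there is an $\mathfrak m$-a.e. unique minimal one, $|D^+f|_{w,\mathfrak T_p}$ ($\le G$ $\mathfrak m$-a.e. for every $\mathfrak T_p$-weak forward upper gradient $G$). The weak forward $q$-Cheeger energy is $\mathsf{Ch}^+_{w,q}(f)=\frac1q\int_X|D^+f|_{w,\mathfrak T_p}^q\,d\mathfrak m$ if $f$ has a $\mathfrak T_p$-weak forward upper gradient in $L^q(X,\mathfrak m)$, and $\infty$ otherwise. *)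

(* Defs.v *)
From HB Require Import structures.
From mathcomp Require Import all_boot all_order all_algebra.
From mathcomp Require Import all_classical all_reals all_analysis.
From mathcomp Require Import measurable_realfun.

Set Implicit Arguments.
Unset Strict Implicit.
Unset Printing Implicit Defensive.

Import Order.TTheory GRing.Theory Num.Theory.
Import numFieldNormedType.Exports.

Local Open Scope classical_set_scope.
Local Open Scope ring_scope.
Local Open Scope ereal_scope.

Section asymmetric_metric.
Context {R : realType} {X : Type}.
Implicit Types (d : X -> X -> \bar R) (x y : X) (A K : set X) (r : R).

Record asymmetric_extended_metric d : Prop := {
  aem_ge0 : forall x y, 0 <= d x y ;
  aem_eq0 : forall x y, d x y = 0 <-> x = y ;
  aem_triangle : forall x y z, d x z <= d x y + d y z }.

Definition forward_ball d x r : set X := [set y | d x y < r%:E].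

(** [B^-_K(r)] *)
Definition backward_nbhd d K r : set X :=
  [set x | ereal_inf [set d x z | z in K] < r%:E].

(** [lambda_d(A)]; it is [+oo] when no finite constant is admissible. *)
Definition reversibility d A : \bar R :=
  ereal_inf [set l%:E | l in [set l : R | (1 <= l)%R /\
    forall x y, A x -> A y -> d x y <= l%:E * d y x]].

(** [X_[x]] *)
Definition finite_component d x : set X := [set y | d x y < +oo].

Record forward_extended_metric d : Prop := {
  fem_metric : asymmetric_extended_metric d ;
  fem_components : exists (I : Type) (x_ : I -> X) (Theta : I -> R -> R),
    [/\ \bigcup_a finite_component d (x_ a) = [set: X],
        trivIset [set: I] (fun a => finite_component d (x_ a)),
        forall a r, (0 < r)%R -> (1 <= Theta a r)%R,
        forall a r s, (0 < r)%R -> (r <= s)%R -> (Theta a r <= Theta a s)%R &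
        forall a r, (0 < r)%R ->
          reversibility d (forward_ball d (x_ a) r) <= (Theta a r)%:E] }.

Definition forward_cauchy d (u : nat -> X) : Prop :=
  forall e : R, (0 < e)%R -> exists N : nat, forall i j : nat,
    (N <= i)%N -> (i <= j)%N -> d (u i) (u j) < e%:E.

End asymmetric_metric.

(** The carrier [X] with the topology generated by the forward balls of [d]. *)
Definition dspace (R : realType) (X : pointedType) (d : X -> X -> \bar R)
  : Type := X.

HB.instance Definition _ (R : realType) (X : pointedType)
  (d : X -> X -> \bar R) := Pointed.on (dspace d).
HB.instance Definition _ (R : realType) (X : pointedType)
    (d : X -> X -> \bar R) :=
  @isSubBaseTopological.Build (dspace d) (X * R)%type [set: X * R]
    (fun c => forward_ball d c.1 c.2).

Definition forward_complete (R : realType) (X : pointedType)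
    (d : X -> X -> \bar R) : Prop :=
  forall u : nat -> dspace d, forward_cauchy d u ->
    exists x : dspace d, u @ \oo --> x.

Definition dclosure (R : realType) (X : pointedType) (d : X -> X -> \bar R)
    (A : set X) : set X :=
  @closure (dspace d) A.

Record complete_compatible_metric (R : realType) (X : topologicalType)
    (rho : X -> X -> R) : Prop := {
  ccm_ge0 : forall x y, (0 <= rho x y)%R ;
  ccm_eq0 : forall x y, rho x y = 0%R <-> x = y ;
  ccm_sym : forall x y, rho x y = rho y x ;
  ccm_triangle : forall x y z, (rho x z <= rho x y + rho y z)%R ;
  ccm_nbhs : forall x : X,
    nbhs x = filter_from [set e : R | (0 < e)%R]
               (fun e => [set y | (rho x y < e)%R]) ;
  ccm_complete : forall u : nat -> X,
    (forall e : R, (0 < e)%R -> exists N : nat, forall i j : nat,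
       (N <= i)%N -> (N <= j)%N -> (rho (u i) (u j) < e)%R) ->
    exists x : X, u @ \oo --> x }.

Definition polish (R : realType) (X : topologicalType) : Prop :=
  (exists2 S : set X, countable S & dense S) /\
  (exists rho : X -> X -> R, complete_compatible_metric rho).

Notation borel X := (g_sigma_algebraType (@open X)).

Section polish_mms.
Context {R : realType} {X : ptopologicalType}.
Implicit Types (d : X -> X -> \bar R) (m : {measure set (borel X) -> \bar R}).

Record forward_extended_polish d : Prop := {
  fep_metric : forward_extended_metric d ;
  fep_complete : forward_complete d ;
  fep_polish : polish R X ;
  fep_cvg : forall (u : nat -> X) (x : X),
    d (u i) x @[i --> \oo] --> 0 -> u @ \oo --> x ;
  fep_lsc : lower_semicontinuous (fun z : X * X => d z.1 z.2) }.

Record forward_extended_polish_mms d m : Prop := {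
  fepm_polish : forward_extended_polish d ;
  fepm_sigma_finite : sigma_finite [set: borel X] m }.

Record assumption_A1 d m (V : X -> R) : Prop := {
  A1_borel : measurable_fun [set: borel X] (V : borel X -> R) ;
  A1_ge0 : forall x, (0 <= V x)%R ;
  A1_lipschitz : exists2 C : R, (0 < C)%R &
    forall x y, (V y - V x)%:E <= C%:E * d x y ;
  A1_bounded : forall K : set X, compact K ->
    exists M : R, forall x, K x -> (V x <= M)%R ;
  A1_integral : \int[m]_x (expR (- (V x ^+ 2)))%:E <= 1 }.

(** A d-closed set need not be tau-Borel: its [m]-measure is taken to be its
    outer measure, hence finite iff some Borel superset has finite measure. *)
Definition assumption_A2 d m : Prop :=
  forall K : set X, compact K -> exists2 r : R, (0 < r)%R &
    exists B : set (borel X), [/\ measurable B,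
      dclosure d (backward_nbhd d K r) `<=` B & m B < +oo].

(** Measurability with respect to the [m]-completion of the Borel sets. *)
Definition m_measurable m (f : X -> \bar R) : Prop :=
  forall Y : set (\bar R), measurable Y ->
    completed_algebra_gen m (f @^-1` Y : set (borel X)).

Definition measurable_ae_finite m (f : X -> \bar R) : Prop :=
  m_measurable m f /\ {ae m, forall x, f x \is a fin_num}.

End polish_mms.

Notation unit_itv R := (set_type (`[0%R, 1%R]%classic : set R)).

Lemma unit_itv0_subproof (R : realType) : (0%R : R) \in `[0%R, 1%R]%classic.
Proof. by rewrite inE /= in_itv /= lexx ler01. Qed.

Definition unit_itv0 (R : realType) : unit_itv R :=
  exist _ 0%R (unit_itv0_subproof R).

(** [C_tau([0,1]; X)] with the compact-open topology. *)
Definition curve (R : realType) (X : topologicalType) : Type :=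
  continuousType (unit_itv R) X.

HB.instance Definition _ (R : realType) (X : topologicalType) :=
  Choice.on (curve R X).
HB.instance Definition _ (R : realType) (X : topologicalType) :=
  Topological.copy (curve R X)
    (initial_topology
      (fun c : curve R X =>
         (c : unit_itv R -> X) : {compact-open, unit_itv R -> X})).
HB.instance Definition _ (R : realType) (X : ptopologicalType) :=
  isPointed.Build (curve R X)
    (mkcts (@cst_continuous (unit_itv R) X point) : continuousType _ _).

(** The evaluation [e_t]. The value for [t] outside [0,1] is irrelevant. *)
Definition ev (R : realType) (X : topologicalType) (t : R) (c : curve R X) : X :=
  (c : continuousType (unit_itv R) X) (insubd (unit_itv0 R) t).

Section curves.
Context {R : realType} {X : ptopologicalType}.
Implicit Types (d : X -> X -> \bar R) (p : R) (c : curve R X).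
Local Notation mu := (@lebesgue_measure R).

(** [0 <= g] in [L^p([0,1])] *)
Definition nonneg_Lp p (g : R -> R) : Prop :=
  [/\ measurable_fun (`[0%R, 1%R] : set R) g,
      forall s, s \in `[0%R, 1%R] -> (0 <= g s)%R &
      \int[mu]_(s in `[0%R, 1%R]) (g s `^ p)%:E < +oo].

Definition forward_ac p d c : Prop :=
  exists2 g : R -> R, nonneg_Lp p g &
    forall s t : R, (0 <= s)%R -> (s <= t)%R -> (t <= 1)%R ->
      d (ev s c) (ev t c) <= \int[mu]_(r in `[s, t]) (g r)%:E.

Definition backward_ac p d c : Prop :=
  exists2 g : R -> R, nonneg_Lp p g &
    forall s t : R, (0 <= s)%R -> (s <= t)%R -> (t <= 1)%R ->
      d (ev t c) (ev s c) <= \int[mu]_(r in `[s, t]) (g r)%:E.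

(** [AC^p([0,1]; X)] *)
Definition ac p d : set (curve R X) :=
  [set c | forward_ac p d c /\ backward_ac p d c].

(** [|c'_+|(t)]; meaningful only where the limit exists. *)
Definition forward_speed d c (t : R) : \bar R :=
  lim (d (ev t c) (ev (t + h)%R c) * (h^-1)%:E @[h --> 0%R^'+]).

End curves.

Section cheeger.
Context {R : realType} {X : ptopologicalType}.
Implicit Types (d : X -> X -> \bar R) (m : {measure set (borel X) -> \bar R}).
Implicit Types (V : X -> R) (p q : R) (f G : X -> \bar R).
Implicit Type (eta : probability (borel (curve R X)) R).

Definition ev_pushforward eta (t : R) : set (borel X) -> \bar R :=
  pushforward eta (ev t : borel (curve R X) -> borel X).

Record test_plan d m p eta : Prop := {
  tp_ac : {ae eta, forall c, ac p d c} ;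
  tp_dominated : forall t, t \in `[0%R, 1%R] -> ev_pushforward eta t `<< m }.

Definition bounded_compression m V eta : Prop :=
  forall M : R, (0 <= M)%R -> exists2 C : R, (0 <= C)%R &
    forall (B : set (borel X)) (t : R), measurable B -> t \in `[0%R, 1%R] ->
      ev_pushforward eta t (B `&` [set x | (V x <= M)%R]) <= C%:E * m B.

(** [T_p] *)
Definition Tp d m V p : set (probability (borel (curve R X)) R) :=
  [set eta | test_plan d m p eta /\ bounded_compression m V eta].

Definition Tp_ae d m V p (P : curve R X -> Prop) : Prop :=
  forall eta, Tp d m V p eta -> {ae eta, forall c, P c}.

Definition curve_integral d G (c : curve R X) : \bar R :=
  \int[@lebesgue_measure R]_(s in `[0%R, 1%R]) (G (ev s c) * forward_speed d c s).

Record weak_forward_upper_gradient d m V p f G : Prop := {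
  wfug_ge0 : forall x, 0 <= G x ;
  wfug_measurable : m_measurable m G ;
  wfug_ineq : Tp_ae d m V p (fun c =>
    f (ev 1%R c) - f (ev 0%R c) <= curve_integral d G c < +oo) }.

Definition minimal_weak_forward_upper_gradient d m V p f G : Prop :=
  weak_forward_upper_gradient d m V p f G /\
  forall G', weak_forward_upper_gradient d m V p f G' ->
    {ae m, forall x, G x <= G' x}.

(** [|D^+ f|_{w,T_p}], determined up to [m]-a.e. equality; the default value is
    used only when [f] has no minimal weak forward upper gradient. *)
Definition weak_forward_gradient d m V p f : X -> \bar R :=
  xget (cst +oo) [set G | minimal_weak_forward_upper_gradient d m V p f G].

(** [Ch^+_{w,q}]; [p] is the exponent conjugate to [q]. *)
Definition weak_cheeger d m V p q f : \bar R :=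
  if `[< exists2 G : X -> \bar R, weak_forward_upper_gradient d m V p f G &
           \int[m]_x (G x `^ q) < +oo >]
  then (q^-1)%:E * \int[m]_x (weak_forward_gradient d m V p f x `^ q)
  else +oo.

End cheeger.

(* Main.v *)
Require Import Defs.
From HB Require Import structures.
From mathcomp Require Import all_boot all_order all_algebra.
From mathcomp Require Import all_classical all_reals all_analysis.
From mathcomp Require Import measurable_realfun ring lra.
Import Order.TTheory GRing.Theory Num.Theory.
Import numFieldNormedType.Exports.
Local Open Scope classical_set_scope.
Local Open Scope ring_scope.
Local Open Scope ereal_scope.
Set Implicit Arguments.
Unset Strict Implicit.
Unset Printing Implicit Defensive.

(** Along almost every curve an L^q gradient is integrable against the speed
    (Tonelli, bounded compression and Young's inequality), so weak upper
    gradients survive convex combinations and dominated a.e. limits. By uniform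
    convexity of L^q, near-minimizers of the energy in a decreasing sequence of
    convex classes have a subsequence that is dominated in L^q and converges
    a.e. Applied to the gradients of a fixed function this gives a gradient of
    least energy; it is pointwise minimal because the minimum of two gradients
    is a gradient, as one sees on curves stopped outside dyadic intervals.
    Lower semicontinuity is the same selection argument for the gradients of
    all functions v with inf_{k>=n} f_k <= v <= sup_{k>=n} f_k. *)

(** * Uniform convexity of L^q *)

(** Much of the development is shaped by measurability and default values. An almost-everywhere
    statement asks for a measurable null set, so pushing a test plan forward by [stop a b] is
    carried out with [ac p d] known to be a Borel set; this is why absolute continuity is
    characterised by a countable supremum of dyadic energies. The gradient in [weak_cheeger] is
    picked by [xget], so the energy has its intended meaning only after a minimal gradient is shown
    to exist whenever some gradient has finite energy. The selection [near_minimizers_limit] serves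
    three times: for the speed bound of a curve with bounded dyadic energies, for the minimal
    gradient, and for lower semicontinuity. It yields a.e. convergence with a majorant, rather than
    norm convergence, because these two properties can be transported to almost every curve.
    Compression is controlled only on sublevels of [V]; this suffices because each curve has compact
    image, on which [V] is bounded. *)

Section powR_convexity.
Context {R : realType}.
Implicit Types a b x y q eps : R.

(** The Jensen defect of the q-th power at the midpoint: a small defect will force [a] and [b] to be
    close. *)
Definition midpoint_gap q a b : R := ((a `^ q + b `^ q) / 2 - ((a + b) / 2) `^ q)%R.

Lemma midpoint_gapC q a b : midpoint_gap q a b = midpoint_gap q b a.
Proof. by rewrite /midpoint_gap [(a `^ q + _)%R]addrC [(a + b)%R]addrC. Qed.

Lemma midpoint_gap_ge0 q a b : (1 <= q)%R -> (0 <= a)%R -> (0 <= b)%R ->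
  (0 <= midpoint_gap q a b)%R.
Proof.
move=> q1 a0 b0.
have half0 : (0 <= 2^-1 :> R)%R by lra.
have half1 : (2^-1 <= 1 :> R)%R by lra.
have /= := @convex_powR R q q1 (Itv01 half0 half1) a b.
rewrite !inE /= !in_itv /= !andbT => /(_ a0 b0).
rewrite /conv /= /midpoint_gap.
rewrite subr_ge0 => H; apply: le_trans (le_trans H _); rewrite le_eqVlt; apply/orP; left; apply/eqP.
  by congr (_ `^ _)%R; rewrite /unstable.onem /GRing.scale /=; field.
by rewrite /conv /= /unstable.onem /GRing.scale /=; field.
Qed.

Lemma midpoint_gapZ q c a b : (0 <= c)%R -> (0 <= a)%R -> (0 <= b)%R ->
  midpoint_gap q (c * a) (c * b) = (c `^ q * midpoint_gap q a b)%R.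
Proof.
move=> c0 a0 b0; rewrite /midpoint_gap -mulrDr -[((c * _) / 2)%R]mulrA !powRM ?divr_ge0 ?addr_ge0//.
by ring.
Qed.

(** The derivative at z is (q/2) (z^(q-1) - ((1+z)/2)^(q-1)), negative since z < (1+z)/2 and q > 1.
    The point 0 is excluded because the derivative formula for powers is for positive arguments. *)
Lemma midpoint_gap_decr q x y : (1 < q)%R -> (0 < x)%R -> (x < y)%R -> (y <= 1)%R ->
  (midpoint_gap q 1 y < midpoint_gap q 1 x)%R.
Proof.
move=> q1 x0 xy y1.
have D (z : R) : (0 < z)%R -> is_derive z 1%R (midpoint_gap q 1)
   ((q * z `^ (q - 1)) / 2 - (q * ((1 + z) / 2) `^ (q - 1)) / 2)%R.
  move=> z0; have z2 : (0 < (1 + z) / 2)%R by lra.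
  have D1 := is_derive1_powR q z0.
  have D2 : is_derive z 1%R (fun t : R => ((1 + t) / 2)%R) (2^-1)%R.
    have : is_derive z 1%R (fun t : R => ((1 + t) * 2^-1)%R) ((1 + z) *: 0 + 2^-1 *: (0 + 1))%R.
      exact: is_deriveM.
    by rewrite scaler0 add0r add0r /GRing.scale /= mulr1.
  have D3 := @is_derive1_comp R (fun t : R => (t `^ q)%R) (fun t : R => ((1 + t) / 2)%R) z _ _
    (is_derive1_powR q z2) D2.
  have D4 : is_derive z 1%R (fun t : R => ((1 `^ q + t `^ q) * 2^-1)%R)
      ((1 `^ q + z `^ q) *: 0 + 2^-1 *: (0 + q * z `^ (q - 1)))%R by exact: is_deriveM.
  have := is_deriveB D4 D3.
  set u := (X in is_derive _ _ _ X); set v := (X in _ -> is_derive _ _ _ X).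
  by have -> : u = v by rewrite /u /v /GRing.scale /=; ring.
apply: (@ltr0_derive1_decr R (midpoint_gap q 1) x 1).
- by move=> z; rewrite in_itv /= => /andP[xz _]; have [] := D z (lt_trans x0 xz).
- move=> z; rewrite in_itv /= => /andP[xz z1].
  have z0 := lt_trans x0 xz.
  rewrite derive1E; have /@derive_val -> := D z z0.
  rewrite -mulrBl -mulrBr pmulr_llt0 ?invr_gt0// pmulr_rlt0 ?(lt_trans _ q1)// subr_lt0.
  by apply: gt0_ltr_powR; rewrite ?nnegrE; lra.
- apply: continuous_in_subspaceT => z; rewrite inE /= in_itv /= => /andP[xz _].
  apply: differentiable_continuous; apply/derivable1_diffP.
  by have [] := D z (lt_le_trans x0 xz).
- exact: lexx.
- exact: xy.
- exact: y1.
Qed.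

(** For x > 0 the gap strictly exceeds its value at 1, which is nonnegative. For x = 0 it equals 1/2
    - 2^(-q), positive as q > 1. *)
Lemma midpoint_gap_gt0 q x : (1 < q)%R -> (0 <= x)%R -> (x < 1)%R ->
  (0 < midpoint_gap q 1 x)%R.
Proof.
move=> q1; rewrite le_eqVlt => /predU1P[<- _|x0 x1].
  rewrite /midpoint_gap powR1 powR0 ?gt_eqF ?(lt_trans _ q1)// !addr0 subr_gt0 -[ltRHS]powRr1//.
  by rewrite mul1r /powR gt_eqF ?invr_gt0// ltr_expR ltr_nM2r// ln_lt0//; lra.
apply: le_lt_trans (midpoint_gap_decr q1 x0 x1 (lexx _)).
by rewrite midpoint_gap_ge0// ltW.
Qed.

(* By homogeneity only [a = 1], [b = t <= 1] matters: near [t = 1] the left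
   side is small, away from it the gap is bounded below. *)
Lemma powR_dist_le_gap q eps : (1 < q)%R -> (0 < eps)%R ->
  exists2 C : R, (0 <= C)%R & forall a b, (0 <= a)%R -> (0 <= b)%R ->
    (`|a - b| `^ q <= eps * (a `^ q + b `^ q) + C * midpoint_gap q a b)%R.
Proof.
move=> q1 eps0; have q0 : (0 < q)%R by exact: lt_trans q1.
(* For t >= s one gets (1 - t)^q <= e^q <= e <= eps, where the middle inequality uses e <= 1; the
   cap 1/2 ensures this and keeps [s] in [0,1[. *)
pose e := Num.min eps (2^-1)%R; pose s := (1 - e)%R.
have e0 : (0 < e)%R by rewrite /e lt_min eps0/=; lra.
have eh : (e <= 2^-1)%R by rewrite /e ge_min lexx orbT.
have ee : (e <= eps)%R by rewrite /e ge_min lexx.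
have gs0 : (0 < midpoint_gap q 1 s)%R by apply: midpoint_gap_gt0 => //; rewrite /s; lra.
have g00 : (0 < midpoint_gap q 1 0)%R by apply: midpoint_gap_gt0.
(* The first reciprocal serves 0 < t < s, by monotonicity of the gap; the second serves t = 0, which
   [midpoint_gap_decr] does not cover. *)
pose C := ((midpoint_gap q 1 s)^-1 + (midpoint_gap q 1 0)^-1)%R.
have C0 : (0 <= C)%R by rewrite /C addr_ge0// invr_ge0 ltW.
exists C => //.
have unit (t : R) : (0 <= t)%R -> (t <= 1)%R ->
    (`|1 - t| `^ q <= eps * (1 `^ q + t `^ q) + C * midpoint_gap q 1 t)%R.
  move=> t0 t1; have G0 := midpoint_gap_ge0 (ltW q1) ler01 t0.
  have [st|ts] := leP s t.
    rewrite -[leLHS]addr0 lerD ?mulr_ge0//.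
    rewrite powR1 mulrDr mulr1 -[leLHS]addr0 lerD ?mulr_ge0 ?powR_ge0 ?(ltW eps0)//.
    apply: le_trans ee; rewrite ger0_norm; last by lra.
    have te : (1 - t <= e)%R by move: st; rewrite /s; lra.
    apply: (@le_trans _ _ (e `^ q)%R); first by apply: ge0_ler_powR; rewrite ?nnegrE; lra.
    by apply: ge1r_powR; [apply/andP; split; lra|exact: ltW].
  rewrite -[leLHS]add0r lerD//; first by rewrite mulr_ge0 ?addr_ge0 ?powR_ge0// ltW.
  apply: (@le_trans _ _ 1%R).
    rewrite ger0_norm; last by lra.
    rewrite [leRHS](_ : _ = 1 `^ q)%R; last by rewrite powR1.
    by apply: ge0_ler_powR; rewrite ?nnegrE; lra.
  move: t0; rewrite le_eqVlt => /predU1P[<-|t0].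
    by rewrite /C mulrDl mulVf ?gt_eqF// lerDr mulr_ge0// ?invr_ge0 ltW.
  have lt := midpoint_gap_decr q1 t0 ts (_ : s <= 1)%R.
  rewrite /C mulrDl -[leLHS]addr0 lerD//; last by rewrite mulr_ge0// invr_ge0 ltW.
  by rewrite ler_pdivlMl// mulr1 ltW// lt// /s; lra.
have main (a b : R) : (0 <= a)%R -> (0 <= b)%R -> (b <= a)%R ->
    (`|a - b| `^ q <= eps * (a `^ q + b `^ q) + C * midpoint_gap q a b)%R.
  move=> a0 b0 ba; move: (a0); rewrite le_eqVlt => /predU1P[a0'|a1].
    have -> : b = 0%R by lra.
    rewrite -a0' subrr normr0 powR0 ?gt_eqF// addr0 mulr0 add0r mulr_ge0//.
    by rewrite midpoint_gap_ge0// ltW.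
  have t0 : (0 <= b / a)%R by rewrite divr_ge0.
  have t1 : (b / a <= 1)%R by rewrite ler_pdivrMr// mul1r.
  have := unit _ t0 t1; rewrite -(ler_pM2l (powR_gt0 q a1)).
  rewrite -powRM// => H.
  have E1 : (a * (b / a) = b)%R by rewrite mulrC divfK// gt_eqF.
  have -> : (a - b = a * (1 - b / a))%R by rewrite mulrBr mulr1 E1.
  rewrite normrM (ger0_norm a0).
  apply: le_trans H _; rewrite le_eqVlt; apply/orP; left; apply/eqP.
  rewrite mulrDr mulrCA [(a `^ q * (_ + _))%R]mulrDr -!powRM// !mulr1 E1 mulrCA.
  by rewrite -midpoint_gapZ// mulr1 E1.
move=> a b a0 b0; have [ba|ab] := leP b a; first exact: main.
by rewrite distrC midpoint_gapC [(a `^ q + _)%R]addrC; apply: main => //; exact: ltW.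
Qed.

End powR_convexity.

(** * Fast Cauchy sequences in L^q *)

Section fast_cauchy.
Context {R : realType} d0 {T : measurableType d0} (mu : {measure set T -> \bar R}).
Variable q : R.
Hypothesis q1 : (1 < q)%R.

Let q0 : (0 < q)%R. Proof. exact: lt_trans q1. Qed.

Lemma measurable_powR_EFin d1 (T1 : measurableType d1) (D : set T1) (g : T1 -> R) :
  measurable_fun D g -> measurable_fun D (fun x => (g x `^ q)%:E).
Proof. by move=> mg; apply/measurable_EFinP; exact: (measurableT_comp (measurable_powR q) mg). Qed.

Lemma powRD_le (a b : R) : (0 <= a)%R -> (0 <= b)%R ->
  ((a + b) `^ q <= 2 `^ q * (a `^ q + b `^ q))%R.
Proof.
move=> a0 b0.
have h (u v : R) : (0 <= u)%R -> (u <= v)%R -> ((u + v) `^ q <= 2 `^ q * (u `^ q + v `^ q))%R.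
  move=> u0 uv; have v0 : (0 <= v)%R := le_trans u0 uv.
  apply: (@le_trans _ _ ((2 * v) `^ q)%R).
    by apply: ge0_ler_powR; rewrite ?nnegrE ?addr_ge0 ?mulr_ge0 ?(ltW q0)//; lra.
  by rewrite powRM// ler_wpM2l ?powR_ge0// lerDr powR_ge0.
have [/h|/ltW/h] := leP a b; first exact.
by rewrite [(b + a)%R]addrC [(b `^ q + _)%R]addrC; exact.
Qed.

(** The weighted sum [S] of the q-th powers of the increments has integral at most 1, hence is
    finite a.e. There each increment is at most S^(1/q) 2^(-k), so the sequence converges and stays
    below a_0 + 2 S^(1/q), which is the majorant [L]. *)
Lemma fast_cauchy_dominated (a : nat -> T -> R) :
  (forall n, measurable_fun setT (a n)) -> (forall n x, (0 <= a n x)%R) ->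
  \int[mu]_x (a 0%N x `^ q)%:E < +oo ->
  (forall k, \int[mu]_x ((2 ^+ k * `|a k.+1 x - a k x|) `^ q)%:E <= (1 / 2 ^+ k.+1)%:E) ->
  exists L G : T -> R,
    [/\ [/\ measurable_fun setT L, forall x, (0 <= L x)%R & \int[mu]_x (L x `^ q)%:E < +oo],
        measurable_fun setT G /\ (forall x, (0 <= G x)%R),
        {ae mu, forall x, forall n, (a n x <= L x)%R} &
        {ae mu, forall x, a n x @[n --> \oo] --> G x}].
Proof.
move=> ma a0 Ea0 Eak.
pose D k x := ((2 ^+ k * `|a k.+1 x - a k x|) `^ q)%R.
have mD k : measurable_fun setT (fun x => (D k x)%:E).
  apply: measurable_powR_EFin; apply: measurable_funM => //.
  by apply: measurableT_comp => //; exact: measurable_funB.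
have D0 k x : 0 <= (D k x)%:E by rewrite lee_fin powR_ge0.
pose S x := \sum_(0 <= k <oo) (D k x)%:E.
have S0 x : 0 <= S x by apply: nneseries_ge0.
have mS : measurable_fun setT S by apply: ge0_emeasurable_sum.
have intS : \int[mu]_x S x < +oo.
  rewrite integral_nneseries//; apply: (@le_lt_trans _ _ 1); last exact: ltry.
  apply: (@le_trans _ _ (\sum_(0 <= k <oo) (1 / (2 ^ k.+1)%:R)%:E)).
    apply: lee_nneseries => [k _ _|k _]; first exact: integral_ge0.
    by rewrite natrX; exact: Eak.
  exact: (@epsilon_trick0 R 1%R xpredT).
have aeS : {ae mu, forall x, S x \is a fin_num}.
  have : mu.-integrable setT S.
    by apply/integrableP; split => //; under eq_integral do rewrite gee0_abs//.
  by move=> /(integrable_ae measurableT); apply: filterS => x; apply.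
pose Y x := (fine (S x) `^ q^-1)%R.
have Y0 x : (0 <= Y x)%R by exact: powR_ge0.
have mY : measurable_fun setT Y.
  apply: (measurableT_comp (measurable_powR q^-1)).
  exact: measurableT_comp.
pose L x := (a 0%N x + 2 * Y x)%R.
(* A limsup is measurable and nonnegative everywhere, also on the null set where the sequence
   diverges. *)
pose G x := fine (limn_esup (fun n => (a n x)%:E)).
have step x k : S x \is a fin_num -> (`|a k.+1 x - a k x| <= Y x * (2^-1) ^+ k)%R.
  move=> Sx; rewrite exprVn ler_pdivlMr ?exprn_gt0// mulrC.
  rewrite -[leLHS]powRr1 ?mulr_ge0 ?exprn_ge0// -[X in (_ `^ X)%R](@mulfV _ q) ?gt_eqF// powRrM.
  apply: ge0_ler_powR; rewrite ?nnegrE ?powR_ge0 ?invr_ge0 ?(ltW q0) ?fine_ge0//.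
  rewrite -lee_fin fineK//.
  have := @nneseries_lim_ge R (fun k => (D k x)%:E) xpredT 0 k.+1 (fun n _ _ => D0 n x).
  apply: le_trans; rewrite big_nat_recr//= leeDr//.
  by apply: sume_ge0 => *.
have tel x n : (a n x = a 0%N x + \sum_(0 <= k < n) (a k.+1 x - a k x))%R.
  by rewrite telescope_sumr//; ring.
have geo (n : nat) : (\sum_(0 <= k < n) (2^-1 : R) ^+ k <= 2)%R.
  have -> : (\sum_(0 <= k < n) (2^-1 : R) ^+ k = 2 - 2 * 2^-1 ^+ n)%R.
    elim: n => [|n IH]; first by rewrite big_geq// expr0; lra.
    by rewrite big_nat_recr//= IH exprS; field.
  by rewrite gerBl mulr_ge0// exprn_ge0// invr_ge0.
exists L, G; split.
- split.
  + by apply: measurable_funD => //; exact: measurable_funM.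
  + by move=> x; rewrite addr_ge0// mulr_ge0.
  + have le x : (L x `^ q)%:E <= (2 `^ q)%:E * ((a 0%N x `^ q)%:E + (2 `^ q)%:E * S x).
      have [Sx|] := boolP (S x \is a fin_num); last first.
        rewrite ge0_fin_numE// -leNgt leye_eq => /eqP ->.
        by rewrite gt0_muley ?lte_fin ?powR_gt0// addey// gt0_muley ?lte_fin ?powR_gt0// leey.
      rewrite -(fineK Sx) -EFinM lee_fin.
      apply: le_trans (powRD_le _ _) _ => //; first by rewrite mulr_ge0.
      by rewrite powRM// /Y -powRrM mulVf ?gt_eqF// powRr1// fine_ge0.
    have mR : measurable_fun setT (fun x => (a 0%N x `^ q)%:E + (2 `^ q)%:E * S x).
      apply: emeasurable_funD; first exact: measurable_powR_EFin.
      exact: measurable_funeM.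
    apply: (@le_lt_trans _ _ (\int[mu]_x ((2 `^ q)%:E * ((a 0%N x `^ q)%:E + (2 `^ q)%:E * S x)))).
      apply: ge0_le_integral => //.
      * by move=> x _; rewrite lee_fin powR_ge0.
      * by apply: measurable_powR_EFin; apply: measurable_funD => //; exact: measurable_funM.
      * exact: measurable_funeM.
    * rewrite ge0_integralZl//; last first.
        by move=> x _; rewrite adde_ge0 ?lee_fin ?powR_ge0// mule_ge0// lee_fin powR_ge0.
      rewrite ge0_integralD//; first last.
      - exact: measurable_funeM.
      - by move=> x _; rewrite mule_ge0// lee_fin powR_ge0.
      - exact: measurable_powR_EFin.
      - by move=> x _; rewrite lee_fin powR_ge0.
      rewrite ge0_integralZl// ?lee_fin ?powR_ge0//.
      rewrite lte_mul_pinfty ?lee_fin ?powR_ge0// lte_add_pinfty//.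
      by rewrite lte_mul_pinfty ?lee_fin ?powR_ge0.
- split.
  + apply: measurableT_comp => //; apply: measurable_fun_limn_esup => n.
    exact/measurable_EFinP.
  + move=> x; apply: fine_ge0; rewrite limn_esup_lim.
    apply: lime_ge; first exact: is_cvg_esups.
    apply: nearW => n; apply: (@le_trans _ _ (a n x)%:E); first by rewrite lee_fin.
    by apply: ereal_sup_ubound; exists n => //=.
- apply: filterS aeS => x Sx n; rewrite tel lerD2l.
  apply: le_trans (_ : _ <= Y x * (\sum_(0 <= k < n) (2^-1) ^+ k))%R _; last first.
    by rewrite mulrC ler_wpM2r.
  rewrite mulr_sumr; apply: ler_sum => k _.
  by apply: le_trans (ler_norm _) _; exact: step.
- apply: filterS aeS => x Sx.
  suff cv : cvgn (fun n => a n x).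
    have cvE : (fun n => (a n x)%:E) @ \oo --> (limn (fun n => a n x))%:E.
      by apply: cvg_EFin => //; exact: nearW.
    by rewrite /G (cvg_limn_einf_sup cvE).2.
  have -> : (fun n => a n x) = (fun n => a 0%N x + series (fun k => a k.+1 x - a k x) n)%R.
    by apply/funext => n; rewrite tel.
  apply: is_cvgD; first exact: is_cvg_cst.
  apply: normed_cvg.
  apply: (@series_le_cvg _ _ (geometric (Y x) (2^-1))) => [k|k|k|].
  + by rewrite normr_ge0.
  + by rewrite /= mulr_ge0// exprn_ge0// invr_ge0.
  + exact: step.
  + by apply: is_cvg_geometric_series; rewrite ger0_norm; lra.
Qed.

End fast_cauchy.
Lemma measurable_fun_limn_einf {R : realType} d0 {T : measurableType d0} (D : set T)
    (f : (T -> \bar R)^nat) :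
  (forall n, measurable_fun D (f n)) -> measurable_fun D (fun x => limn_einf (f^~ x)).
Proof.
move=> mf; under eq_fun => x do rewrite -[limn_einf _]oppeK -limn_esupN.
by apply: measurableT_comp => //; apply: measurable_fun_limn_esup => n; exact: measurableT_comp.
Qed.

(** * Near-minimizers of the energy in convex classes *)

Section near_minimizers.
Context {R : realType} d0 {T : measurableType d0} (mu : {measure set T -> \bar R}).
Variable q : R.
Hypothesis q1 : (1 < q)%R.
Local Notation E g := (\int[mu]_x (g x `^ q)%:E).
Local Notation mid g h := (fun x => ((g x + h x) / 2)%R).

Let powE0 d1 (T1 : measurableType d1) (D : set T1) (g : T1 -> R) :
  forall x, D x -> 0 <= (g x `^ q)%:E.
Proof. by move=> x _; rewrite lee_fin powR_ge0. Qed.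

(** This is [powR_dist_le_gap] integrated. The midpoint term is moved to the left so that no
    extended reals are subtracted. *)
Lemma energy_dist_le eps : (0 < eps)%R -> exists2 c : R, (0 <= c)%R &
  forall g h : T -> R, measurable_fun setT g -> measurable_fun setT h ->
    (forall x, (0 <= g x)%R) -> (forall x, (0 <= h x)%R) ->
    E (fun x => `|g x - h x|%R) + c%:E * E (mid g h) <= (eps + c / 2)%:E * (E g + E h).
Proof.
move=> e0; have [c c0 H] := powR_dist_le_gap q1 e0.
exists c => // g h mg mh g0 h0.
have mgh : measurable_fun setT (fun x => `|g x - h x|%R).
  by apply: measurableT_comp => //; exact: measurable_funB.
have mm : measurable_fun setT (mid g h).
  by apply: measurable_funM => //; exact: measurable_funD.
have k0 : (0 <= eps + c / 2)%R by rewrite addr_ge0 ?divr_ge0// ltW.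
have mA := measurable_powR_EFin q mgh; have mB := measurable_powR_EFin q mm.
have mP := measurable_powR_EFin q mg; have mQ := measurable_powR_EFin q mh.
have mPQ := emeasurable_funD mP mQ; have mcB := measurable_funeM c%:E mB.
have PQ0 x : [set: T] x -> 0 <= (g x `^ q)%:E + (h x `^ q)%:E.
  by move=> _; rewrite adde_ge0// lee_fin powR_ge0.
have cB0 x : [set: T] x -> 0 <= c%:E * (((g x + h x) / 2) `^ q)%:E.
  by move=> _; rewrite mule_ge0// lee_fin powR_ge0.
apply: (@le_trans _ _ (\int[mu]_x ((`|g x - h x| `^ q)%:E + c%:E * (((g x + h x) / 2) `^ q)%:E))).
  by rewrite ge0_integralD// ?ge0_integralZl// => x _; rewrite lee_fin powR_ge0.
apply: (@le_trans _ _ (\int[mu]_x ((eps + c / 2)%:E * ((g x `^ q)%:E + (h x `^ q)%:E)))); last first.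
  by rewrite ge0_integralZl// ge0_integralD// => x _; rewrite lee_fin powR_ge0.
apply: ge0_le_integral => //.
- by move=> x Dx; rewrite adde_ge0 ?cB0// lee_fin powR_ge0.
- exact: emeasurable_funD.
- exact: measurable_funeM.
- move=> x _.
  change ((`|g x - h x| `^ q + c * ((g x + h x) / 2) `^ q)%:E <=
          ((eps + c / 2) * (g x `^ q + h x `^ q))%:E).
  by rewrite lee_fin; have := H (g x) (h x) (g0 x) (h0 x); rewrite /midpoint_gap; lra.
Qed.

Variables (C : nat -> set (T -> R)) (K : R).
Hypothesis C_measurable : forall n g, C n g -> measurable_fun setT g.
Hypothesis C_ge0 : forall n g x, C n g -> (0 <= g x)%R.
Hypothesis C_decr : forall n, C n.+1 `<=` C n.
Hypothesis C_mid : forall n g h, C n g -> C n h -> C n (mid g h).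
Hypothesis C_near : forall n e, (0 < e)%R -> exists2 g, C n g & E g <= (K + e)%:E.

Let I n := ereal_inf [set E g | g in C n].

Let I_ge0 n : 0 <= I n.
Proof. by apply/ereal_infP => _ [g _ <-]; apply: integral_ge0; exact: powE0. Qed.

Let I_le n : I n <= K%:E.
Proof.
apply/lee_addgt0Pr => e e0; have [g Cg Eg] := C_near n e0.
by apply: le_trans Eg; apply: ereal_inf_lbound; exists g.
Qed.

Let I_fin n : I n \is a fin_num.
Proof.
rewrite fin_numElt; apply/andP; split; first exact: lt_le_trans (ltNyr _) (I_ge0 n).
exact: le_lt_trans (I_le n) (ltry _).
Qed.

Let C_le n m : (n <= m)%N -> C m `<=` C n.
Proof.
move=> nm; rewrite -(subnKC nm); elim: (m - n)%N => [|k IH]; first by rewrite addn0.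
by rewrite addnS; exact: subset_trans (@C_decr _) IH.
Qed.

Let i n := fine (I n).

Let i_nd : nondecreasing_seq i.
Proof.
move=> n m nm; rewrite -lee_fin !fineK//; apply/ereal_infP => _ [g Cg <-].
by apply: ereal_inf_lbound; exists g => //; exact: C_le Cg.
Qed.

Let i_le n : (i n <= K)%R. Proof. by rewrite -lee_fin fineK. Qed.

Let K0 : (0 <= K)%R. Proof. by rewrite -lee_fin; exact: le_trans (I_ge0 0) (I_le 0). Qed.

(** The infima [i n] increase to a limit [l], since the classes shrink. Each [b n] is within 1/(n+1)
    of [i n], so beyond [N] two energies are at most l + 1/(N+1), while the midpoint lies in [C N]
    and has energy at least [i N]. Midpoint convexity is then nearly an equality, and
    [energy_dist_le] makes the distance small. *)
Lemma near_minimizers_cauchy : exists b : nat -> T -> R,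
  [/\ forall n, C n (b n), forall n, E (b n) <= (K + n.+1%:R^-1)%:E &
    forall delta, (0 < delta)%R -> exists N, forall n m, (N <= n)%N -> (N <= m)%N ->
      E (fun x => `|b n x - b m x|%R) <= delta%:E].
Proof.
have near n : exists g, C n g /\ E g <= (i n + n.+1%:R^-1)%:E.
  have [|_ [g Cg <-] Eg] := @lb_ereal_inf_adherent R [set E g | g in C n] n.+1%:R^-1 _ (I_fin n).
    by rewrite invr_gt0.
  by exists g; split => //; rewrite EFinD fineK//; exact: ltW.
have [b bP] := choice near.
exists b; split => [n|n|delta delta0].
- by have [] := bP n.
- by have [_] := bP n => /le_trans; apply; rewrite lee_fin lerD2r.
have i_cvg : cvgn i.
  apply: nondecreasing_is_cvgn; first exact: i_nd.
  by exists K => _ [n _ <-]; exact: i_le.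
pose l := limn i.
have il n : (i n <= l)%R by exact: nondecreasing_cvgn_le.
have lK : (l <= K)%R by apply: limr_le => //; exact: nearW.
(* The final bound is 2 eps (K + 1) + 2 c eta: the first term is delta/2, the second delta/2 - 2
   eta. As [c] depends on [eps], [eta] is chosen after it. *)
pose eps := (delta / (4 * (K + 1)))%R.
have eps0 : (0 < eps)%R by rewrite divr_gt0// mulr_gt0// ltr_wpDl.
have e1 : (eps * (4 * (K + 1)) = delta)%R by rewrite divfK// gt_eqF// mulr_gt0// ltr_wpDl.
clearbody eps.
have [c c0 H] := energy_dist_le eps0.
pose eta := (delta / (4 * (c + 1)))%R.
have eta0 : (0 < eta)%R by rewrite divr_gt0// mulr_gt0// ltr_wpDl.
have e2 : (eta * (4 * (c + 1)) = delta)%R by rewrite divfK// gt_eqF// mulr_gt0// ltr_wpDl.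
clearbody eta.
have [N [Nl Neta]] : exists N, (l - i N <= eta)%R /\ (N.+1%:R^-1 <= eta)%R.
  have /cvgrPdist_le/(_ _ eta0)[N1 _ HN1] := i_cvg.
  have [N2 _ HN2] := (@near_infty_natSinv_lt R (PosNum eta0)).
  exists (maxn N1 N2); split.
    by apply: le_trans (ler_norm _) _; apply: HN1 => /=; exact: leq_maxl.
  by apply/ltW; apply: HN2 => /=; exact: leq_maxr.
exists N => n m Nn Nm.
have [Cn En] := bP n; have [Cm Em] := bP m.
have Emid : (i N)%:E <= E (mid (b n) (b m)).
  rewrite fineK//; apply: ereal_inf_lbound; exists (mid (b n) (b m)) => //.
  by apply: C_mid; [exact: C_le Cn|exact: C_le Cm].
have inv k : (N <= k)%N -> (k.+1%:R^-1 <= N.+1%:R^-1 :> R)%R.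
  by move=> Nk; rewrite lef_pV2 ?posrE// ler_nat.
have := H (b n) (b m) (C_measurable Cn) (C_measurable Cm) (fun x => C_ge0 x Cn) (fun x => C_ge0 x Cm).
have bnd : (eps + c / 2)%:E * (E (b n) + E (b m)) <=
    ((eps + c / 2) * ((l + N.+1%:R^-1) + (l + N.+1%:R^-1)))%:E.
  rewrite EFinM lee_wpmul2l// ?lee_fin ?addr_ge0 ?divr_ge0 ?(ltW eps0)//.
  by rewrite EFinD leeD// ?(le_trans En) ?(le_trans Em)// lee_fin lerD// inv.
move=> /le_trans/(_ bnd) {}H.
have cmid : (c * i N)%:E <= c%:E * E (mid (b n) (b m)) by rewrite EFinM lee_wpmul2l.
have := le_trans (leeD2l _ cmid) H.
rewrite -leeBrDr// -EFinB => /le_trans; apply; rewrite lee_fin.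
have iN1 : (N.+1%:R^-1 <= 1 :> R)%R by rewrite invf_le1// ler1n.
have h1 : (eps * (l + N.+1%:R^-1) <= eps * (K + 1))%R by rewrite ler_wpM2l ?(ltW eps0)// lerD.
have h2 : (c * (l - i N + N.+1%:R^-1) <= c * (eta + eta))%R by rewrite ler_wpM2l// lerD.
have -> : ((eps + c / 2) * (l + N.+1%:R^-1 + (l + N.+1%:R^-1)) - c * i N =
  2 * (eps * (l + N.+1%:R^-1)) + c * (l - i N + N.+1%:R^-1))%R by field.
have e3 : (2 * (eps * (K + 1)) = delta / 2)%R by rewrite -e1; field.
have e4 : (c * (eta + eta) = delta / 2 - 2 * eta)%R by rewrite -e2; field.
apply: le_trans (lerD (ler_wpM2l (ler0n R 2) h1) h2) _.
by rewrite e3 e4; move: eta0 => /= ?; lra.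
Qed.

(* Mazur-type selection: by uniform convexity of L^q, near-minimizers of the
   energy in decreasing convex classes form a Cauchy sequence. *)
Lemma near_minimizers_limit : exists H : nat -> T -> R, exists L G : T -> R,
  [/\ forall n, C n (H n),
      [/\ measurable_fun setT L, forall x, (0 <= L x)%R & E L < +oo],
      [/\ measurable_fun setT G, forall x, (0 <= G x)%R & E G <= K%:E],
      {ae mu, forall x, forall n, (H n x <= L x)%R} &
      {ae mu, forall x, H n x @[n --> \oo] --> G x}].
Proof.
have q0 : (0 < q)%R by exact: lt_trans q1.
have [b [Cb Eb bcauchy]] := near_minimizers_cauchy.
(* Chosen so that the increments, once multiplied by 2^k, have energy at most 1/2^(k+1), as
   [fast_cauchy_dominated] asks. *)
pose w k : R := (((2 ^+ k) `^ q)^-1 * (1 / 2 ^+ k.+1))%R.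
have w0 k : (0 < w k)%R by rewrite mulr_gt0// ?invr_gt0 ?powR_gt0 ?exprn_gt0// divr_gt0// exprn_gt0.
have [N NP] := choice (fun k => bcauchy _ (w0 k)).
(* The sum makes [n_] nondecreasing and at least [N k]; the summand [k] gives [k <= n_ k], hence
   membership in [C k] and the energy bound with error 1/(k+1). *)
pose n_ k := (\sum_(j < k.+1) N j + k)%N.
have n_S k : (n_ k <= n_ k.+1)%N by rewrite /n_ [in leqRHS]big_ord_recr /= leq_add// leq_addr.
have n_N k : (N k <= n_ k)%N by rewrite /n_ big_ord_recr /= -addnA addnCA leq_addr.
have n_k k : (k <= n_ k)%N by rewrite /n_ leq_addl.
pose a k := b (n_ k).
have ma k : measurable_fun setT (a k) by exact: C_measurable (Cb _).
have a0 k x : (0 <= a k x)%R by exact: C_ge0 (Cb _).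
have Ea k : E (a k) <= (K + k.+1%:R^-1)%:E.
  by apply: le_trans (Eb _) _; rewrite lee_fin lerD2l lef_pV2 ?posrE// ler_nat ltnS.
have [|k|L [G [L_ [mG G0] aL aG]]] := @fast_cauchy_dominated _ _ _ mu q q1 a ma a0.
- by apply: le_lt_trans (Ea 0%N) _; exact: ltry.
- under eq_integral do rewrite powRM ?exprn_ge0// EFinM.
  rewrite ge0_integralZl//; [|apply: measurable_powR_EFin; apply: measurableT_comp => //; exact: measurable_funB].
  have := NP k (n_ k.+1) (n_ k) (leq_trans (n_N k) (n_S k)) (n_N k).
  move=> /(lee_wpmul2l (_ : 0 <= ((2 ^+ k) `^ q)%:E)) => /(_ _)/le_trans; apply.
    by rewrite lee_fin powR_ge0.
  by rewrite -EFinM lee_fin /w mulVKf ?gt_eqF ?powR_gt0 ?exprn_gt0.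
exists a, L, G; split => //.
- by move=> n; apply: C_le (Cb _); exact: n_k.
- split => //.
  (* Only the inequality that Fatou's lemma uses is stated. At v = 0 it is positivity; for v > 0 it
     is continuity of the power. *)
  have cvgpow (u : nat -> R) (v : R) : (forall n, (0 <= u n)%R) -> (0 <= v)%R ->
      u @ \oo --> v -> (v `^ q)%:E <= limn_einf (fun n => (u n `^ q)%:E).
    move=> u0; rewrite le_eqVlt => /predU1P[<- _|v0 uv].
      rewrite powR0 ?gt_eqF// limn_einf_lim; apply: lime_ge; first exact: is_cvg_einfs.
      by apply: nearW => n; apply/ereal_infP => _ [k _ <-]; rewrite lee_fin powR_ge0.
    have : (fun n => (u n `^ q)%:E) @ \oo --> (v `^ q)%:E.
      apply: cvg_EFin; first exact: nearW.
      have cv : {for v, continuous (fun x : R => x `^ q)%R}.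
        apply: differentiable_continuous; apply/derivable1_diffP.
        by have [] := is_derive1_powR q v0.
      exact: (@continuous_cvg nat R R _ _ _ _ _ cv uv).
    by move=> /cvg_limn_einf_sup[-> _].
  apply: (@le_trans _ _ (\int[mu]_x limn_einf (fun n => (a n x `^ q)%:E))).
    apply: ae_ge0_le_integral => //.
    + exact: powE0.
    + exact: measurable_powR_EFin.
    + move=> x _; rewrite limn_einf_lim; apply: lime_ge; first exact: is_cvg_einfs.
      by apply: nearW => n; apply/ereal_infP => _ [k _ <-]; rewrite lee_fin powR_ge0.
    + by apply: measurable_fun_limn_einf => n; exact: measurable_powR_EFin.
    + by apply: filterS aG => x aGx _; exact: cvgpow.
  apply: le_trans (fatou _ _ _ _) _ => //.
  + by move=> n; exact: measurable_powR_EFin.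
  + by move=> n; exact: powE0.
  + have cK : (fun n : nat => (K + n.+1%:R^-1)%:E) @ \oo --> K%:E.
      apply: cvg_EFin; first exact: nearW.
      rewrite -[X in _ --> X]addr0; apply: cvgD; first exact: cvg_cst.
      exact: cvg_harmonic.
    rewrite -(cvg_limn_einf_sup cK).1 !limn_einf_lim.
    apply: lee_lim; [exact: is_cvg_einfs|exact: is_cvg_einfs|].
    apply: nearW => n; apply/ereal_infP => _ [k nk <-].
    by apply: le_trans (Ea k); apply: ereal_inf_lbound; exists k.
Qed.

End near_minimizers.

(** * Dyadic intervals *)

Section dyadic_intervals.
Context {R : realType}.

Definition dyadic_point n j : R := (j%:R / (2 ^ n)%:R)%R.

(** Half-open, so that the intervals of one level partition [0,1[ exactly. *)
Definition dyadic_itv n j : set R := `[dyadic_point n j, dyadic_point n j.+1[%classic.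

Lemma dyadic_point0 n : dyadic_point n 0 = 0%R.
Proof. by rewrite /dyadic_point mul0r. Qed.

Lemma dyadic_pointn n : dyadic_point n (2 ^ n)%N = 1%R.
Proof. by rewrite /dyadic_point divff// pnatr_eq0 expn_eq0. Qed.

Lemma ler_dyadic_point n i j : (dyadic_point n i <= dyadic_point n j)%R = (i <= j)%N.
Proof. by rewrite /dyadic_point ler_pM2r ?ler_nat// invr_gt0 ltr0n expn_gt0. Qed.

Lemma ltr_dyadic_point n i j : (dyadic_point n i < dyadic_point n j)%R = (i < j)%N.
Proof. by rewrite ltNge ler_dyadic_point -ltnNge. Qed.

Lemma dyadic_pointS n j : dyadic_point n.+1 (2 * j) = dyadic_point n j.
Proof.
by rewrite /dyadic_point expnS !natrM invfM mulrACA divff ?mul1r// pnatr_eq0.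
Qed.

Lemma dyadic_itv_inj n i j x : dyadic_itv n i x -> dyadic_itv n j x -> i = j.
Proof.
rewrite /dyadic_itv /= !in_itv /= => /andP[ix xi] /andP[jx xj].
have := le_lt_trans ix xj; have := le_lt_trans jx xi.
rewrite !ltr_dyadic_point !ltnS => ji ij.
by apply/eqP; rewrite eqn_leq ij ji.
Qed.

Lemma dyadic_itvP n x : (0 <= x < 1)%R -> exists2 j, (j < 2 ^ n)%N & dyadic_itv n j x.
Proof.
move=> /andP[x0 x1]; have n0 : (0 < (2 ^ n)%:R :> R)%R by rewrite ltr0n expn_gt0.
have /truncn_itv/andP[h1 h2] : (0 <= x * (2 ^ n)%:R)%R by rewrite mulr_ge0// ltW.
exists (Num.truncn (x * (2 ^ n)%:R)).
  by rewrite -(@ltr_nat R); apply: le_lt_trans h1 _; rewrite gtr_pMl.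
by rewrite /dyadic_itv /= in_itv /= /dyadic_point ler_pdivrMr// ltr_pdivlMr// h1.
Qed.

Lemma dyadic_itv_sub n j : (j < 2 ^ n)%N -> dyadic_itv n j `<=` `[0%R, 1%R[.
Proof.
move=> jn x; rewrite /dyadic_itv /= !in_itv /= => /andP[jx xj].
rewrite (le_trans _ jx) ?(lt_le_trans xj)//.
  by rewrite -(dyadic_pointn n) ler_dyadic_point.
by rewrite -(dyadic_point0 n) ler_dyadic_point.
Qed.

Lemma dyadic_point_ge0 n j : (0 <= dyadic_point n j)%R.
Proof. by rewrite -(dyadic_point0 n) ler_dyadic_point. Qed.

Lemma dyadic_point_le1 n j : (j <= 2 ^ n)%N -> (dyadic_point n j <= 1)%R.
Proof. by move=> jn; rewrite -(dyadic_pointn n) ler_dyadic_point. Qed.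

Lemma dyadic_itv_small n j x y : dyadic_itv n j x -> dyadic_itv n j y ->
  (`|x - y| <= (2 ^ n)%:R^-1)%R.
Proof.
rewrite /dyadic_itv /= !in_itv /= => /andP[x0 x1] /andP[y0 y1].
have E : (dyadic_point n j.+1 = dyadic_point n j + (2 ^ n)%:R^-1)%R.
  by rewrite /dyadic_point -natr1 mulrDl mul1r.
by rewrite ler_norml; apply/andP; split; lra.
Qed.

Lemma ge0_integral_dyadic n (f : R -> \bar R) :
  measurable_fun (`[0%R, 1%R[ : set R) f -> (forall x, (0 <= x < 1)%R -> 0 <= f x) ->
  \int[lebesgue_measure]_(x in `[0%R, 1%R[) f x =
  \sum_(0 <= j < 2 ^ n) \int[lebesgue_measure]_(x in dyadic_itv n j) f x.
Proof.
move=> mf f0.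
suff H k : (k <= 2 ^ n)%N -> \int[lebesgue_measure]_(x in `[0%R, dyadic_point n k[) f x =
    \sum_(0 <= j < k) \int[lebesgue_measure]_(x in dyadic_itv n j) f x.
  by rewrite -(H _ (leqnn _)) dyadic_pointn.
elim: k => [|k IH] kn; first by rewrite dyadic_point0 set_itvco0 integral_set0 big_geq.
have sub : `[0%R, dyadic_point n k.+1[ `<=` (`[0%R, 1%R[ : set R).
  move=> x /=; rewrite !in_itv /= => /andP[-> xk]; rewrite (lt_le_trans xk)//.
  exact: dyadic_point_le1.
have E : `[0%R, dyadic_point n k.+1[%classic = `[0%R, dyadic_point n k[%classic `|` dyadic_itv n k.
  by apply: itv_bndbnd_setU; rewrite bnd_simp ?dyadic_point_ge0// ler_dyadic_point.
rewrite big_nat_recr//= -(IH (ltnW kn)) E ge0_integral_setU//.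
- exact: measurable_itv.
- by rewrite -E; exact: measurable_funS sub mf.
- by move=> x; rewrite -E => xk; have := sub x xk; rewrite /= in_itv /=; exact: f0.
- apply/disj_setPS => x []; rewrite /dyadic_itv /= !in_itv /= => /andP[_ xk].
  by rewrite leNgt xk.
Qed.

End dyadic_intervals.

(** * Switching between two majorants of an increment *)

Section min_of_majorants.
Context {R : realType}.
Local Notation mu := (@lebesgue_measure R).
Local Notation D := (`[0%R, 1%R[%classic : set R).
Variables (h1 h2 : R -> \bar R) (u : R -> R).
Hypothesis mh1 : measurable_fun D h1.
Hypothesis mh2 : measurable_fun D h2.
Hypothesis h10 : forall x, (0 <= x < 1)%R -> 0 <= h1 x.
Hypothesis h20 : forall x, (0 <= x < 1)%R -> 0 <= h2 x.
Hypothesis ih1 : \int[mu]_(x in D) h1 x < +oo.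
Hypothesis ih2 : \int[mu]_(x in D) h2 x < +oo.
Hypothesis uh1 : forall n j, (j < 2 ^ n)%N ->
  (u (dyadic_point n j.+1) - u (dyadic_point n j))%:E <= \int[mu]_(x in dyadic_itv n j) h1 x.
Hypothesis uh2 : forall n j, (j < 2 ^ n)%N ->
  (u (dyadic_point n j.+1) - u (dyadic_point n j))%:E <= \int[mu]_(x in dyadic_itv n j) h2 x.

Let pick (B : set R) x := if x \in B then h1 x else h2 x.

Let mpick B : measurable B -> measurable_fun D (pick B).
Proof.
move=> mB; apply: measurable_fun_if => //.
- apply: (@measurable_fun_bool _ _ _ _ true) => //.
  rewrite (_ : _ @^-1` _ = B); first exact: measurableI.
  by apply/seteqP; split => x /=; rewrite -[_ = true]/(is_true _) inE.
- by apply: measurable_funS mh1.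
- by apply: measurable_funS mh2.
Qed.

Let pick0 B x : (0 <= x < 1)%R -> 0 <= pick B x.
Proof. by move=> x01; rewrite /pick; case: ifP => _; [exact: h10|exact: h20]. Qed.

Let adm B := (u 1 - u 0)%:E <= \int[mu]_(x in D) pick B x.

Let inD x : D x = (0 <= x < 1)%R :> Prop.
Proof. by rewrite /= in_itv. Qed.

(** Dominated convergence with majorant h1 + h2: where membership in [B_ n] is eventually that in
    [B], the switched integrands are eventually constant. *)
Let adm_lim (B_ : nat -> set R) (B : set R) :
  (forall n, measurable (B_ n)) -> measurable B -> (forall n, adm (B_ n)) ->
  {ae mu, forall x, D x -> \forall n \near \oo, (x \in B_ n) = (x \in B)} -> adm B.
Proof.
move=> mB_ mB aB cB.
have ig : mu.-integrable D (fun x => h1 x + h2 x).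
  apply/integrableP; split; first exact: emeasurable_funD.
  rewrite (_ : \int[mu]_(x in D) _ = \int[mu]_(x in D) (h1 x + h2 x)); last first.
    by apply: eq_integral => x; rewrite inE inD => x01; rewrite gee0_abs// adde_ge0 ?h10 ?h20.
  by rewrite ge0_integralD//; exact: lte_add_pinfty.
have [] := @dominated_convergence _ _ _ mu D _ (fun n => pick (B_ n)) (pick B) (fun x => h1 x + h2 x).
- by [].
- by move=> n; exact: mpick.
- exact: mpick.
- apply: (@filterS _ _ (ae_filter_ringOfSetsType mu) _ _ _ cB) => x cx Dx; apply: cvg_near_cst.
  by apply: filterS (cx Dx) => n En; rewrite /pick En.
- exact: ig.
- apply/aeW => x n; rewrite inD => x01; rewrite gee0_abs ?pick0// /pick.
  by case: ifP => _; rewrite ?leeDl ?leeDr ?h10 ?h20.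
move=> _ _ cv; rewrite /adm -(cvg_lim _ cv)//; apply: lime_ge; first by apply/cvg_ex; eexists; exact: cv.
exact: nearW.
Qed.

Let W n (U : set R) : set R :=
  \bigcup_(j in [set j | (j < 2 ^ n)%N /\ dyadic_itv n j `<=` U]) dyadic_itv n j.

Let mW n U : measurable (W n U).
Proof. by apply: bigcup_measurable => j _; exact: measurable_itv. Qed.

(** [W n U] is a union of intervals of level n, so each such interval lies in it or misses it. On
    each one a single majorant is used, and the increments of [u] telescope. *)
Let adm_W n U : adm (W n U).
Proof.
rewrite /adm (ge0_integral_dyadic n (mpick (mW n U)))//; last exact: pick0.
have -> : (u 1 - u 0 = \sum_(0 <= j < 2 ^ n) (u (dyadic_point n j.+1) - u (dyadic_point n j)))%R.
  by rewrite telescope_sumr// dyadic_pointn dyadic_point0.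
rewrite -sumEFin big_seq [leRHS]big_seq; apply: lee_sum => j; rewrite mem_index_iota /= => jn.
have [jU|jU] := pselect (dyadic_itv n j `<=` U).
  apply: (le_trans (uh1 jn)); rewrite le_eqVlt; apply/orP; left; apply/eqP; apply: eq_integral.
  by move=> x; rewrite inE => jx; rewrite /pick ifT// inE; exists j.
apply: (le_trans (uh2 jn)); rewrite le_eqVlt; apply/orP; left; apply/eqP; apply: eq_integral.
move=> x; rewrite inE => jx; rewrite /pick ifF//; apply/negP; rewrite inE => -[k [_ kU] kx].
by apply: jU; rewrite (dyadic_itv_inj jx kx).
Qed.

(** A point of [U] lies in [W n U] as soon as 2^(-n) is below the radius of a ball around it inside
    [U]; a point outside [U] is in none of these sets. *)
Let adm_open U : open U -> adm U.
Proof.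
move=> oU; apply: (adm_lim (B_ := fun n => W n U)) => //; first exact: open_measurable.
apply/aeW => x; rewrite inD => x01.
have [xU|xU] := boolP (x \in U); last first.
  apply: nearW => n; apply/negP; rewrite inE => -[j [_ jU] jx].
  by move/negP: xU; apply; rewrite inE; exact: jU.
move: xU; rewrite inE => xU.
have [e /= e0 eU] : exists2 e : R, (0 < e)%R & ball x e `<=` U.
  by have /nbhs_ballP[e e0 eU] := open_nbhs_nbhs (conj oU xU); exists e.
have [N _ HN] := @near_infty_natSinv_lt R (PosNum e0).
exists N => // n /= Nn; apply/mem_set.
have [j jn jx] := dyadic_itvP n x01.
exists j => //; split => // y jy; apply: eU; rewrite /ball /=.
apply: le_lt_trans (dyadic_itv_small jx jy) _.
apply: le_lt_trans (HN N (leqnn _)); rewrite lef_pV2 ?posrE ?ltr0n ?expn_gt0// ler_nat.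
by apply: leq_ltn_trans Nn _; exact: ltn_expl.
Qed.

(* On an open set U the bound by h1 is used on the dyadic intervals inside U and
   the bound by h2 elsewhere; then U decreases to [set x | h1 x <= h2 x]. *)
Lemma min_of_majorants : (u 1 - u 0)%:E <= \int[mu]_(x in D) mine (h1 x) (h2 x).
Proof.
pose A := D `&` [set x | h1 x <= h2 x].
have mA : measurable A by exact: measurable_lee.
have fA : mu A < +oo.
  apply: (@le_lt_trans _ _ (mu D)).
    by apply: le_measure; rewrite ?inE//; exact: subIsetl.
  by rewrite lebesgue_measure_itv /= lte_fin ltr01 ltry.
(* The excess measures are summable, so by Borel-Cantelli almost every point outside [A] lies in
   finitely many [U k] only, which is the convergence asked by [adm_lim]. *)
have H k : exists U, [/\ open U, A `<=` U & mu (U `\` A) < (1 / (2 ^ k.+1)%:R)%:E].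
  by apply: lebesgue_regularity_outer => //; rewrite divr_gt0// ltr0n expn_gt0.
have [U UP] := choice H.
have mU k : measurable (U k) by have [oU _ _] := UP k; exact: open_measurable.
have mUA k : measurable (U k `\` A) by exact: measurableD.
have : adm A.
  apply: (adm_lim (B_ := U)) => //; first by move=> n; have [oU _ _] := UP n; exact: adm_open.
  have L0 : mu (lim_sup_set (fun k => U k `\` A)) = 0.
    apply: lim_sup_set_cvg0 => //.
    apply: (@le_lt_trans _ _ 1); last exact: ltry.
    apply: (@le_trans _ _ (\sum_(0 <= k <oo) (1 / (2 ^ k.+1)%:R)%:E)).
      by apply: lee_nneseries => // k _; have [_ _ /ltW] := UP k.
    exact: (@epsilon_trick0 R 1%R xpredT).
  exists (lim_sup_set (fun k => U k `\` A)); split => //.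
    by apply: bigcapT_measurable => n; apply: bigcup_measurable => k _; exact: mUA.
  move=> x /=; apply: contra_notP => /= nx Dx.
  have [xA|xA] := boolP (x \in A).
    by apply: nearW => n; rewrite mem_set//; have [_ + _] := UP n; apply; exact: set_mem.
  move: nx; rewrite /lim_sup_set /bigcap /= => /existsNP[N]; rewrite /= => /not_implyP[_ nN].
  exists N => // n /= Nn; apply/negP; rewrite inE => Unx; apply: nN; exists n => //.
  by split => //; move/negP: xA; rewrite inE.
rewrite /adm => /le_trans; apply; rewrite le_eqVlt; apply/orP; left; apply/eqP.
apply: eq_integral => x; rewrite inE => Dx.
rewrite /pick; case: ifPn => [/set_mem[_ h12]|/negP xA]; first by rewrite /= minEle h12.
rewrite minEle ifF//; apply/negP => h12; apply: xA; rewrite inE; split => //.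
Qed.

End min_of_majorants.

(** * The space of curves *)

Section curve_space.
Context {R : realType} {X : ptopologicalType}.
Implicit Types (c : curve R X) (s t : R).

Definition clamp (a b s : R) : R := Num.max a (Num.min b s).

Lemma clamp_continuous a b : continuous (clamp a b).
Proof.
by move=> s; apply: continuous_max; [exact: cvg_cst|apply: continuous_min; [exact: cvg_cst|exact: cvg_id]].
Qed.

Lemma clamp_itv a b s : (a <= b)%R -> (a <= clamp a b s <= b)%R.
Proof. by move=> ab; rewrite /clamp le_max lexx /= ge_max ab ge_min lexx. Qed.

Lemma clamp_id a b s : (a <= s <= b)%R -> clamp a b s = s.
Proof. by move=> /andP[as_ sb]; rewrite /clamp min_r// max_r. Qed.

Lemma clamp_le a b s t : (s <= t)%R -> (clamp a b s <= clamp a b t)%R.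
Proof. by move=> st; rewrite /clamp le_max2 // le_min2. Qed.

Lemma clamp_lower a b s : (s <= a)%R -> (a <= b)%R -> clamp a b s = a.
Proof. by move=> sa ab; rewrite /clamp max_l// ge_min sa orbT. Qed.

Lemma clamp_upper a b s : (b <= s)%R -> (a <= b)%R -> clamp a b s = b.
Proof. by move=> bs ab; rewrite /clamp min_l// max_r. Qed.

Lemma clamp_ge a b s : (s <= b)%R -> (s <= clamp a b s)%R.
Proof. by move=> sb; rewrite /clamp le_max le_min sb lexx orbT. Qed.

Lemma clamp_le_id a b s : (a <= s)%R -> (clamp a b s <= s)%R.
Proof. by move=> as_; rewrite /clamp ge_max as_ ge_min lexx orbT. Qed.

(** [ev] sends times outside [0,1] to time 0 and so may jump at 1. Clamping first gives a path that
    is continuous on the whole real line. *)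
Definition to_unit s : unit_itv R := insubd (unit_itv0 R) (clamp 0 1 s).

Lemma set_val_insubd s : (0 <= s <= 1)%R -> set_val (insubd (unit_itv0 R) s) = s.
Proof. by move=> s01; rewrite set_valE insubdK// inE /= in_itv. Qed.

Lemma set_val_to_unit s : set_val (to_unit s) = clamp 0 1 s.
Proof. by rewrite set_val_insubd// clamp_itv. Qed.

Lemma to_unit_continuous : continuous to_unit.
Proof.
apply/continuousP => U [V oV <-].
rewrite -comp_preimage (_ : _ \o _ = clamp 0 1); last by apply/funext => s; exact: set_val_to_unit.
by move/continuousP : (@clamp_continuous 0 1); exact.
Qed.

Lemma ev_to_unit s c : (0 <= s <= 1)%R -> ev s c = c (to_unit s).
Proof. by move=> s01; rewrite /ev /to_unit clamp_id. Qed.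

Lemma path_continuous c : continuous (fun s => c (to_unit s)).
Proof. by move=> s; apply: continuous_comp; [exact: to_unit_continuous|exact: cts_fun]. Qed.

(** Feeds [A1_bounded]: along a single curve [V] stays below some constant. *)
Lemma curve_compact_image c : compact [set ev s c | s in `[0%R, 1%R]].
Proof.
rewrite (_ : [set _ | _ in _] = (fun s => c (to_unit s)) @` `[0%R, 1%R]).
  apply: continuous_compact; last exact: segment_compact.
  exact/continuous_subspaceT/path_continuous.
by apply/seteqP; split => _ [s s01 <-]; exists s => //; rewrite ev_to_unit//; move: s01; rewrite /= in_itv.
Qed.

Lemma continuous_borel_measurable (S T : ptopologicalType) (f : S -> T) : continuous f ->
  measurable_fun setT (f : borel S -> borel T).
Proof.
move=> /continuousP cf; apply: (@measurability _ _ (borel S) (borel T) setT f (@open T)) => //.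
by move=> _ [B oB <-]; rewrite setTI; apply: sub_sigma_algebra; exact: cf.
Qed.

Lemma ev_continuous s : continuous (fun c : curve R X => ev s c).
Proof.
apply/continuousP => U oU; rewrite /ev.
set x := insubd _ s.
exists [set g : {compact-open, unit_itv R -> X} | [set g y | y in [set x]] `<=` U].
  by apply: compact_open_open => //; exact: compact_set1.
by apply/seteqP; split => c /=; [apply; exists x|move=> Uc _ [_ -> <-]].
Qed.

Lemma measurable_ev s : measurable_fun setT (ev s : borel (curve R X) -> borel X).
Proof. exact: (@continuous_borel_measurable (curve R X) X _ (@ev_continuous s)). Qed.

Lemma stop_subproof (a b : R) c : continuous (fun x : unit_itv R => c (to_unit (clamp a b (set_val x)))).
Proof.
move=> x; apply: (@continuous_comp _ _ _ (fun x : unit_itv R => clamp a b (set_val x)) (fun s => c (to_unit s))).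
  apply: (@continuous_comp _ _ _ (set_val : unit_itv R -> R) (clamp a b)).
    exact: initial_continuous.
  exact: clamp_continuous.
exact: path_continuous.
Qed.

(* The curve stopped outside [a,b]. Unlike an affine restriction of [c] to
   [a,b], it needs no change of variables. *)
Definition stop (a b : R) c : curve R X := mkcts (@stop_subproof a b c).

Lemma ev_stop a b t c : (0 <= a)%R -> (a <= b)%R -> (b <= 1)%R -> (0 <= t <= 1)%R ->
  ev t (stop a b c) = ev (clamp a b t) c.
Proof.
move=> a0 ab b1 t01; have /andP[h1 h2] := clamp_itv t ab.
rewrite [RHS]ev_to_unit ?(le_trans a0)// ?(le_trans h2)//.
rewrite ev_to_unit// -[LHS]/(c (to_unit (clamp a b (set_val (to_unit t))))).
by rewrite set_val_to_unit (clamp_id t01).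
Qed.

(** Stopping is precomposition with a continuous map [phi] of the unit interval, and maps sending
    the compact image phi(K) into an open [O] form an open set. Hence plans can be pushed forward by
    [stop a b]. *)
Lemma stop_continuous a b : continuous (stop a b).
Proof.
apply/continuousP => U [V oV <-].
have cphi : continuous (fun x : unit_itv R => to_unit (clamp a b (set_val x))).
  move=> x; apply: (@continuous_comp _ _ _ (fun x : unit_itv R => clamp a b (set_val x)) to_unit).
    apply: (@continuous_comp _ _ _ (set_val : unit_itv R -> R) (clamp a b)).
      exact: initial_continuous.
    exact: clamp_continuous.
  exact: to_unit_continuous.
set phi := (fun x : unit_itv R => to_unit (clamp a b (set_val x))) in cphi.
pose F : {compact-open, unit_itv R -> X} -> {compact-open, unit_itv R -> X} := fun g => g \o phi.
suff cF : continuous F.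
  exists (F @^-1` V) => //; by move/continuousP : cF; exact.
move=> g; apply: (iffRL (@compact_open_cvgP _ _ (F @ g) (F g) (fmap_filter F (nbhs_filter g)))) => K O cK oO FKO.
have := @compact_open_open _ X (phi @` K) O (continuous_compact (continuous_subspaceT cphi) cK) oO.
rewrite openE => /(_ g); rewrite /interior /=.
have gO : [set g x | x in phi @` K] `<=` O.
  by move=> _ [_ [x Kx <-] <-]; apply: FKO; exists x.
move=> /(_ gO); apply: filterS => h hO _ [x Kx <-]; apply: hO.
by exists (phi x) => //; exists x.
Qed.

Lemma measurable_stop a b : measurable_fun setT (stop a b : borel (curve R X) -> borel (curve R X)).
Proof. exact: (@continuous_borel_measurable (curve R X) (curve R X) _ (@stop_continuous a b)). Qed.

End curve_space.

(** * Joint measurability of evaluation in time and curve *)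

Section joint_measurability.
Context {R : realType} {X : ptopologicalType} (rho : X -> X -> R).
Hypothesis ccm : complete_compatible_metric rho.

Let cvg_rho (u : nat -> X) x : u @ \oo --> x ->
  forall e : R, (0 < e)%R -> \forall n \near \oo, (rho x (u n) < e)%R.
Proof.
move=> ux e e0; apply: (ux [set y | (rho x y < e)%R]).
by rewrite (ccm_nbhs ccm); exists e.
Qed.

Let open_rho (U : set X) x : open U -> U x -> exists2 e : R, (0 < e)%R & forall y, (rho x y < e)%R -> U y.
Proof.
by move=> oU Ux; have := open_nbhs_nbhs (conj oU Ux); rewrite (ccm_nbhs ccm) => -[e e0 eU]; exists e.
Qed.

Let rho_open (P : set X) : (forall x, P x -> exists2 e : R, (0 < e)%R & forall y, (rho x y < e)%R -> P y) -> open P.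
Proof.
move=> H; rewrite openE => x /H[e e0 eP]; rewrite /interior (ccm_nbhs ccm); by exists e.
Qed.

(** An open [U] is the union of the closed sets [F k] of points at distance at least 1/(k+1) from
    its complement. The limit lies in [U] exactly when, for some k, all late approximants lie in
    [F k]; this is a countable set operation. *)
Lemma measurable_fun_cvg_metric d0 (T : measurableType d0) (D : set T)
    (f_ : nat -> T -> X) (f : T -> X) : measurable D ->
  (forall n, measurable_fun D (f_ n : T -> borel X)) ->
  (forall x, D x -> f_ n x @[n --> \oo] --> f x) -> measurable_fun D (f : T -> borel X).
Proof.
move=> mD mf_ cf.
apply: (@measurability _ _ T (borel X) D f (@open X)) => // _ [U oU <-].
pose F k : set (borel X) := [set x | forall y, ~ U y -> (k.+1%:R^-1 <= rho x y)%R].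
have mF k : measurable (F k).
  rewrite -[F k]setCK; apply: measurableC; apply: sub_sigma_algebra.
  apply: rho_open => x /existsNP[y /not_implyP[nUy /negP]]; rewrite -ltNge => xy.
  exists (k.+1%:R^-1 - rho x y)%R; first by rewrite subr_gt0.
  move=> z xz /(_ y nUy); rewrite leNgt => /negP; apply.
  apply: le_lt_trans (ccm_triangle ccm z x y) _.
  by rewrite (ccm_sym ccm z x) -ltrBrDr.
rewrite (_ : _ `&` _ = \bigcup_k \bigcup_N \bigcap_(n in [set n | (N <= n)%N]) (D `&` f_ n @^-1` F k)).
  apply: bigcupT_measurable => k; apply: bigcupT_measurable => N; apply: bigcap_measurable => [|n _].
    by exists N => /=.
  exact: mf_.
apply/seteqP; split => [x [Dx Ufx]|x [k _ [N _ H]]].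
  have [e e0 eU] := open_rho oU Ufx.
  have e20 : (0 < e / 2)%R by rewrite divr_gt0.
  have [k _ Hk] := @near_infty_natSinv_lt R (PosNum e20).
  have [N _ HN] := cvg_rho (cf x Dx) e20.
  exists k => //; exists N => // n /= Nn; split => // y nUy.
  rewrite leNgt; apply/negP => h; apply: nUy; apply: eU.
  apply: le_lt_trans (ccm_triangle ccm _ (f_ n x) _) _.
  rewrite [ltRHS]splitr ltrD//; first exact: HN.
  by apply: lt_trans h _; apply: Hk => /=.
have Dx : D x by have [] := H N (leqnn _).
split => //; apply: contrapT => nU.
have k0 : (0 < k.+1%:R^-1 :> R)%R by rewrite invr_gt0.
have [M _ HM] := cvg_rho (cf x Dx) k0.
have [_ /(_ _ nU)] := H (maxn N M) (leq_maxl _ _).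
by have := HM (maxn N M) (leq_maxr _ _); rewrite /= (ccm_sym ccm) ltNge => /negP.
Qed.

(** Rounding the time down to the dyadic grid makes preimages finite unions of rectangles, hence
    measurable for the product sigma-algebra used by Tonelli's theorem. Continuity of each curve
    gives the pointwise limit. *)
Lemma measurable_ev_joint :
  measurable_fun ((`[0%R, 1%R[%classic : set (measurableTypeR R)) `*` [set: borel (curve R X)])
    ((fun z => ev z.1 z.2) : (measurableTypeR R * borel (curve R X))%type -> borel X).
Proof.
pose D : set (measurableTypeR R * borel (curve R X))%type := `[0%R, 1%R[%classic `*` setT.
have mD : measurable D by apply: measurableX => //; exact: measurable_itv.
pose phi n (s : R) : R := dyadic_point n (Num.truncn (s * (2 ^ n)%:R)).
have phiE n j s : dyadic_itv n j s -> phi n s = dyadic_point n j.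
  rewrite /dyadic_itv /= in_itv /= /phi /dyadic_point => /andP[h1 h2].
  have n0 : (0 < (2 ^ n)%:R :> R)%R by rewrite ltr0n expn_gt0.
  by rewrite (@truncn_def _ _ j)// -ler_pdivrMr// -ltr_pdivlMr// h1.
apply: (@measurable_fun_cvg_metric _ _ D (fun n z => ev (phi n z.1) z.2)) => //.
  move=> n _ B mB.
  rewrite (_ : _ `&` _ = \bigcup_(j in `I_(2 ^ n)) (dyadic_itv n j `*` (ev (dyadic_point n j) @^-1` B))).
    apply: bigcup_measurable => j _; apply: measurableX; first exact: measurable_itv.
    by rewrite -[_ @^-1` _]setTI; exact: measurable_ev.
  apply/seteqP; split => [[s c] [[/= s01 _] Bs]|[s c] [j jn [/= sj Bj]]].
    have [|j jn sj] := @dyadic_itvP _ n s; first by move: s01; rewrite in_itv.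
    by exists j => //; split => //=; rewrite -(phiE n j s sj).
  split; first by split => //=; exact: dyadic_itv_sub jn _ sj.
  by rewrite /preimage /= (phiE n j s sj).
move=> [s c] [/= s01 _]; have s01' : (0 <= s < 1)%R by move: s01; rewrite in_itv.
have phi01 n : (0 <= phi n s <= 1)%R.
  have [j jn sj] := dyadic_itvP n s01'.
  by rewrite (phiE n j s sj) dyadic_point_ge0 dyadic_point_le1// ltnW.
rewrite ev_to_unit; last by case/andP: s01' => -> /ltW ->.
under eq_fun do rewrite ev_to_unit//.
apply: (@continuous_cvg _ _ _ _ _ (fun n => phi n s) (fun s => c (to_unit s))); first exact: path_continuous.
apply/cvgrPdist_lt => e e0.
have [N _ HN] := @near_infty_natSinv_lt R (PosNum e0).
exists N => // n /= Nn; have [j jn sj] := dyadic_itvP n s01'.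
rewrite (phiE n j s sj); apply: le_lt_trans (dyadic_itv_small sj _) _.
  by rewrite /dyadic_itv /= in_itv /= lexx ltr_dyadic_point ltnSn.
apply: le_lt_trans (HN N (leqnn _)); rewrite lef_pV2 ?posrE ?ltr0n ?expn_gt0// ler_nat.
by apply: leq_ltn_trans Nn _; exact: ltn_expl.
Qed.

End joint_measurability.

#[local] Instance lebesgue_ae_filter (R : realType) :
  Filter (nbhs (almost_everywhere (@lebesgue_measure R))).
Proof. exact: ae_filter_ringOfSetsType. Qed.

(** * Forward speed *)

Section limsup_along_rationals.
Context {R : realType}.
Implicit Types (f : R -> \bar R) (l : \bar R).

Lemma ereal_dense (x y : \bar R) : x < y -> exists z, x < z < y.
Proof.
case: x y => [x| |] [y| |] //.
- by rewrite lte_fin => xy; exists ((x + y) / 2)%:E; rewrite !lte_fin; apply/andP; split; lra.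
- by move=> _; exists (x + 1)%:E; rewrite lte_fin ltry ltrDl ltr01.
- by move=> _; exists (y - 1)%:E; rewrite lte_fin ltNyr ltrBlDr ltrDl ltr01.
- by move=> _; exists 0; rewrite ltNyr ltry.
Qed.

Definition rat_seq (k : nat) : R := ratr (odflt 0%Q (unpickle k)).

Lemma rat_seq_dense (x y : R) : (x < y)%R -> exists k, (x < rat_seq k < y)%R.
Proof.
move=> /rat_in_itvoo[r]; rewrite in_itv /= => rxy.
by exists (pickle r); rewrite /rat_seq pickleK.
Qed.

(** Restricting the increments to rationals keeps the supremum countable, hence measurable in
    parameters. The value -oo is neutral for increments outside the window. *)
Definition rat_sup f (n : nat) : \bar R :=
  esups (fun k => if (0 < rat_seq k < n.+1%:R^-1)%R then f (rat_seq k) else -oo) 0%N.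

Definition rat_limsup f : \bar R := einfs (rat_sup f) 0%N.

Definition rat_liminf f : \bar R := - rat_limsup (fun h => - f h).

Let rat_sup_ge f n k : (0 < rat_seq k < n.+1%:R^-1)%R -> f (rat_seq k) <= rat_sup f n.
Proof. by move=> kn; apply: ereal_sup_ubound; exists k => //=; rewrite kn. Qed.

Let rat_sup_le f n l : (forall h, (0 < h < n.+1%:R^-1)%R -> f h <= l) -> rat_sup f n <= l.
Proof.
by move=> H; apply: ge_ereal_sup => _ [k _ <-]; case: ifP => [/H//|_]; rewrite leNye.
Qed.

Let rat_limsup_le f n : rat_limsup f <= rat_sup f n.
Proof. by apply: ereal_inf_lbound; exists n. Qed.

(** Any two windows to the right of 0 share a positive rational. *)
Lemma rat_liminf_le_limsup f : rat_liminf f <= rat_limsup f.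
Proof.
rewrite /rat_liminf leeNl; apply/ereal_infP => _ [n _ <-].
rewrite leeNl; apply/ereal_infP => _ [m _ <-].
pose x : R := Num.min n.+1%:R^-1%R m.+1%:R^-1%R.
have [k /andP[k0]] : exists k, (0 < rat_seq k < x)%R.
  by apply: rat_seq_dense; rewrite /x lt_min !invr_gt0 !ltr0n.
rewrite lt_min => /andP[kn km].
have H1 := @rat_sup_ge f m k; have H2 := @rat_sup_ge (fun h => - f h) n k.
rewrite leeNl; apply: le_trans (H2 _); last by rewrite k0 kn.
by rewrite leeN2; apply: H1; rewrite k0 km.
Qed.

Lemma rat_limsup_le_lim f g l : (\forall h \near 0%R^'+, f h <= g h) ->
  g h @[h --> 0%R^'+] --> l -> rat_limsup f <= l.
Proof.
move=> fg gl; rewrite leNgt; apply/negP => lS.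
have [y /andP[ly yS]] := ereal_dense lS.
have : \forall h \near 0%R^'+, f h < y.
  have gy : \forall h \near 0%R^'+, g h < y by exact: (gl [set z | z < y] (open_ereal_lt' ly)).
  by apply: filterS2 fg gy => h; exact: le_lt_trans.
move=> [e /= e0 He].
have [n _ Hn] := @near_infty_natSinv_lt R (PosNum e0).
have : rat_limsup f <= y.
  apply: le_trans (rat_limsup_le f n) _; apply: rat_sup_le => h /andP[h0 hn].
  apply/ltW/He => //=; rewrite sub0r normrN gtr0_norm//.
  by apply: lt_trans hn _; exact: (Hn n (leqnn _)).
by rewrite leNgt yS.
Qed.

(** If f(h) > y at some small h, continuity propagates the strict inequality to a nearby rational in
    the window, against the bound on the rational supremum. *)
Lemma rat_limsup_near_le f (b : R) (y : \bar R) : (0 < b)%R ->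
  (forall h, (0 < h < b)%R -> {for h, continuous f}) ->
  rat_limsup f < y -> \forall h \near 0%R^'+, f h <= y.
Proof.
move=> b0 cf /ereal_inf_lt[_ [n _ <-] ny].
near=> h; rewrite leNgt; apply/negP => yh.
have h0 : (0 < h)%R by near: h; exact: nbhs_right_gt.
have hn : (h < n.+1%:R^-1)%R by near: h; apply: nbhs_right_lt; rewrite invr_gt0.
have hb : (h < b)%R by near: h; exact: nbhs_right_lt.
have : \forall k \near h, y < f k.
  have hb' : (0 < h < b)%R by rewrite h0 hb.
  exact: (cf h hb' [set z | y < z] (open_ereal_gt' yh)).
move=> [e /= e0 He].
have [k /andP[k1 k2]] : exists k, (h < rat_seq k < Num.min (h + e) n.+1%:R^-1)%R.
  by apply: rat_seq_dense; rewrite lt_min ltrDl e0 hn.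
move: k2; rewrite lt_min => /andP[k2 k3].
have : y < f (rat_seq k).
  by apply: He => /=; rewrite ltr_norml; apply/andP; split; lra.
rewrite ltNge => /negP; apply.
by apply: le_trans (ltW ny); apply: rat_sup_ge; rewrite (lt_trans h0 k1) k3.
Unshelve. all: by end_near. Qed.

Lemma cvge_squeeze_order (T : Type) (F : set_system T) {FF : Filter F} (f : T -> \bar R) l :
  (forall y, l < y -> \forall h \near F, f h <= y) ->
  (forall y, y < l -> \forall h \near F, y <= f h) -> f @ F --> l.
Proof.
move=> up lo; case: l up lo => [r| |] up lo.
- have near_r (e : R) : (0 < e)%R -> \forall h \near F, (r - e)%:E <= f h <= (r + e)%:E.
    move=> e0; have h1 := up (r + e)%:E; have h2 := lo (r - e)%:E.
    rewrite !lte_fin in h1 h2.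
    have {}h1 := h1 (ltac:(lra)); have {}h2 := h2 (ltac:(lra)).
    by apply: filterS2 h1 h2 => h -> ->.
  apply: cvg_EFin.
    apply: filterS (near_r _ ltr01) => h /andP[h1 h2].
    by rewrite fin_numElt (lt_le_trans _ h1) ?ltNyr// (le_lt_trans h2)// ltry.
  apply/cvgrPdist_le => e e0.
  apply: filterS (near_r _ e0) => h /=.
  case: (f h) => [x| |]; rewrite ?leye_eq ?leeNy_eq ?andbF//.
  by rewrite !lee_fin => /andP[h1 h2]; rewrite ler_norml /=; apply/andP; split; lra.
- apply/cvgeyPge => A.
  by apply: lo; rewrite ltry.
- by apply/cvgeNyPle => A; apply: up; rewrite ltNyr.
Qed.

(** [lim] is a total operator with value [point] in the absence of a limit. Reproducing this default
    gives a formula valid at each parameter, and so measurability of the speed itself rather than of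
    an a.e. version. *)
Lemma lim_at_rightE (f : R -> \bar R) (b : R) : (0 < b)%R ->
  (forall h, (0 < h < b)%R -> {for h, continuous f}) ->
  lim (f h @[h --> 0%R^'+]) = if rat_limsup f == rat_liminf f then rat_limsup f else point.
Proof.
move=> b0 cf.
have cfN h : (0 < h < b)%R -> {for h, continuous (fun h => - f h)}.
  by move=> hb; apply: cvgeN; exact: cf.
case: ifPn => [/eqP SI|SI].
  apply: cvg_lim => //; apply: cvge_squeeze_order => y ly.
    exact: (rat_limsup_near_le b0 cf).
  have : rat_limsup (fun h => - f h) < - y by rewrite -lteN2 oppeK; move: ly; rewrite SI.
  move=> /(rat_limsup_near_le b0 cfN); apply: filterS => h.
  by rewrite leeN2.
apply: (@xgetPN _ point) => l fl; move/eqP: SI; apply.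
apply/eqP; rewrite eq_le rat_liminf_le_limsup andbT.
apply: (@le_trans _ _ l); first by apply: (@rat_limsup_le_lim f f) => //; exact: nearW.
rewrite /rat_liminf leeNr; apply: (@rat_limsup_le_lim (fun h => - f h) (fun h => - f h)).
  exact: nearW.
exact: cvgeN.
Qed.

Lemma measurable_rat_limsup d0 (T : measurableType d0) (D : set T) (f : R -> T -> \bar R) :
  (forall h, measurable_fun D (f h)) -> measurable_fun D (fun t => rat_limsup (f^~ t)).
Proof.
move=> mf; rewrite /rat_limsup.
rewrite (_ : (fun t => _) = (fun t => - esups (fun n => - rat_sup (f^~ t) n) 0%N)); last first.
  by apply/funext => t; rewrite (_ : (fun n => - _ n) = -%E \o rat_sup (f^~ t))// esupsN /= oppeK.
apply: measurableT_comp => //; apply: measurable_fun_esups => n; apply: measurableT_comp => //.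
rewrite /rat_sup; apply: measurable_fun_esups => k.
by case: (0 < rat_seq k < n.+1%:R^-1)%R.
Qed.

End limsup_along_rationals.

(** * Speed of absolutely continuous curves *)

Section forward_speed.
Context {R : realType} {X : ptopologicalType} (d : X -> X -> \bar R) (p : R).
Hypothesis dm : asymmetric_extended_metric d.
Hypothesis lscD : lower_semicontinuous (fun z : X * X => d z.1 z.2).
Hypothesis p1 : (1 < p)%R.
Local Notation mu := (@lebesgue_measure R).
Implicit Types (c : curve R X).

Let diff c (h t : R) : \bar R := d (c (to_unit t)) (c (to_unit (t + h)%R)) * (h^-1)%:E.

Let measurable_diff c h : measurable_fun setT (diff c h).
Proof.
apply: emeasurable_funM; last exact: measurable_cst.
apply: lower_semicontinuous_measurable; apply/lower_semicontinuousP => a.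
have /lower_semicontinuousP/(_ a) oA := lscD.
have cf : continuous (fun t : R => (c (to_unit t), c (to_unit (t + h)%R))).
  move=> t; apply: cvg_pair; first exact: path_continuous.
  apply: (@continuous_comp _ _ _ (fun t : R => (t + h)%R) (fun s => c (to_unit s))).
    by apply: cvgD; [exact: cvg_id|exact: cvg_cst].
  exact: path_continuous.
by move/continuousP: cf => /(_ _ oA).
Qed.

(** On the unit interval g is at most 1 + g^p, which is integrable. *)
Lemma nonneg_Lp_integrable (g : R -> R) (a b : R) : (0 <= a)%R -> (b <= 1)%R -> nonneg_Lp p g ->
  mu.-integrable `[a, b] (EFin \o g).
Proof.
move=> a0 b1 [mg g0 ig].
have p0 : (0 < p)%R by exact: lt_trans p1.
have sub : `[a, b] `<=` (`[0%R, 1%R]%classic : set R).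
  by move=> x /=; rewrite !in_itv /= => /andP[h1 h2]; rewrite (le_trans a0)//= (le_trans h2).
apply: (@integrableS _ _ _ mu `[0%R, 1%R]%classic) => //.
have mgE : measurable_fun (`[0%R, 1%R]%classic : set R) (EFin \o g) by exact/measurable_EFinP.
apply/integrableP; split => //.
have mgp : measurable_fun (`[0%R, 1%R]%classic : set R) (fun x => (g x `^ p)%:E) by exact: measurable_powR_EFin.
apply: (@le_lt_trans _ _ (\int[mu]_(x in `[0%R, 1%R]) (1 + (g x `^ p)%:E))).
  apply: ge0_le_integral => //.
  - exact: measurableT_comp.
  - exact: emeasurable_funD.
  - move=> x x01; have gx : (0 <= g x)%R by apply: g0; rewrite inE.
    rewrite gee0_abs ?lee_fin//.
    change ((g x)%:E <= (1 + g x `^ p)%:E); rewrite lee_fin.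
    have [h|h] := leP (g x) 1%R; first by rewrite (le_trans h)// lerDl powR_ge0.
    apply: (@le_trans _ _ (g x `^ p)%R); last by rewrite lerDr.
    by rewrite -[leLHS](powRr1 gx); apply: ler_powR; [exact: ltW|exact: ltW].
rewrite ge0_integralD//; last by move=> x _; rewrite lee_fin powR_ge0.
rewrite lte_add_pinfty// integral_cst// mul1e.
by have := lebesgue_measure_itv `[0%R, 1%R] => /= ->; rewrite lte_fin ltr01 ltry.
Qed.

Let Int (g : R -> R) (t : R) : R := parameterized_integral mu 0%R t g.

Let IntE g s t : nonneg_Lp p g -> (0 <= s)%R -> (s <= t)%R -> (t <= 1)%R ->
  \int[mu]_(r in `[s, t]) (g r)%:E = (Int g t - Int g s)%:E.
Proof.
move=> Lg s0 st t1.
have i0t : mu.-integrable `[0%R, t] (EFin \o g) by exact: nonneg_Lp_integrable.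
have ist : mu.-integrable `[s, t] (EFin \o g) by exact: nonneg_Lp_integrable.
rewrite /Int /parameterized_integral Rintegral_itvB ?bnd_simp//.
rewrite Rintegral_itv_obnd_cbnd; last first.
  apply: integrableS ist => // x /=; rewrite !in_itv /= => /andP[/ltW -> ->] //.
by rewrite /Rintegral fineK//; exact: integrable_fin_num.
Qed.

Let Int_le g s t : nonneg_Lp p g -> (0 <= s)%R -> (s <= t)%R -> (t <= 1)%R -> (Int g s <= Int g t)%R.
Proof.
move=> Lg s0 st t1; rewrite -subr_ge0 -lee_fin -IntE//; apply: integral_ge0 => r /=.
rewrite in_itv /= => /andP[sr rt]; rewrite lee_fin; have [_ g0 _] := Lg; apply: g0.
by rewrite in_itv /= (le_trans s0)//= (le_trans rt).
Qed.

Let Int_continuous g t : nonneg_Lp p g -> (0 < t < 1)%R -> {for t, continuous (Int g)}.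
Proof.
move=> Lg t01.
have i01 : mu.-integrable `[0%R, 1%R] (EFin \o g) by exact: nonneg_Lp_integrable.
have /(continuous_within_itvP _ ltr01)[H _ _] := parameterized_integral_continuous ler01 i01.
by apply: H; rewrite in_itv.
Qed.

Section curve_speed.
Variables (c : curve R X) (gf gb : R -> R).
Hypothesis Lgf : nonneg_Lp p gf.
Hypothesis Lgb : nonneg_Lp p gb.
Hypothesis cgf : forall s t : R, (0 <= s)%R -> (s <= t)%R -> (t <= 1)%R ->
  d (ev s c) (ev t c) <= \int[mu]_(r in `[s, t]) (gf r)%:E.
Hypothesis cgb : forall s t : R, (0 <= s)%R -> (s <= t)%R -> (t <= 1)%R ->
  d (ev t c) (ev s c) <= \int[mu]_(r in `[s, t]) (gb r)%:E.

Let P t := c (to_unit t).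

Let cf s t : (0 <= s)%R -> (s <= t)%R -> (t <= 1)%R -> d (P s) (P t) <= (Int gf t - Int gf s)%:E.
Proof.
move=> s0 st t1; rewrite -IntE// /P -!ev_to_unit ?s0 ?t1 ?(le_trans s0) ?(le_trans st)//.
exact: cgf.
Qed.

Let cb s t : (0 <= s)%R -> (s <= t)%R -> (t <= 1)%R -> d (P t) (P s) <= (Int gb t - Int gb s)%:E.
Proof.
move=> s0 st t1; rewrite -IntE// /P -!ev_to_unit ?s0 ?t1 ?(le_trans s0) ?(le_trans st)//.
exact: cgb.
Qed.

Let d_fin s t : (0 <= s)%R -> (s <= t)%R -> (t <= 1)%R -> d (P s) (P t) = (fine (d (P s) (P t)))%:E.
Proof.
move=> s0 st t1; rewrite fineK// ge0_fin_numE; last exact: aem_ge0 dm _ _.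
by apply: le_lt_trans (cf s0 st t1) _; exact: ltry.
Qed.

Let Phi t := (Int gf t + Int gb t)%R.

Let rho t u := fine (d (P t) (P u)).

(** For an asymmetric distance, the two signs of the difference need the distances from u to u' and
    from u' to u, so forward and backward absolute continuity both enter. This is the source of the
    continuity of the difference quotients in [h], [d] being only lower semicontinuous for the
    topology. *)
Let rho_lip t u u' : (0 <= t)%R -> (t <= u)%R -> (u <= u')%R -> (u' <= 1)%R ->
  (`|rho t u - rho t u'| <= Phi u' - Phi u)%R.
Proof.
move=> t0 tu uu u1; have u0 := le_trans t0 tu; have tu' := le_trans tu uu.
have u'1 := le_trans uu u1.
have h1 := aem_triangle dm (P t) (P u) (P u').
have h2 := aem_triangle dm (P t) (P u') (P u).
have {}h1 : (rho t u' <= rho t u + (Int gf u' - Int gf u))%R.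
  rewrite -lee_fin -d_fin// EFinD -d_fin//.
  by apply: le_trans h1 _; apply: leeD => //; exact: cf.
have {}h2 : (rho t u <= rho t u' + (Int gb u' - Int gb u))%R.
  rewrite -lee_fin -d_fin// EFinD -d_fin//.
  by apply: le_trans h2 _; apply: leeD => //; exact: cb.
have h3 := Int_le Lgf u0 uu u1; have h4 := Int_le Lgb u0 uu u1.
by rewrite /Phi ler_norml; apply/andP; split; lra.
Qed.

Let diff_continuous t h : (0 <= t)%R -> (0 < h < 1 - t)%R -> {for h, continuous (fun h => diff c h t)}.
Proof.
move=> t0 /andP[h0 ht].
have th : (0 < t + h < 1)%R by apply/andP; split; lra.
have cPhi : {for (t + h)%R, continuous Phi}.
  by apply: cvgD; exact: Int_continuous.
have crho : (fun k => rho t (t + k)%R) @ h --> rho t (t + h)%R.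
  apply/cvgrPdist_le => e e0.
  have cP : (fun k => Phi (t + k)%R) @ h --> Phi (t + h)%R.
    apply: (@continuous_cvg _ _ _ _ _ (fun k => (t + k)%R) Phi) => //.
    by apply: cvgD; [exact: cvg_cst|exact: cvg_id].
  have He : \forall k \near h, (`|Phi (t + h) - Phi (t + k)| <= e)%R by move/cvgrPdist_le: cP; exact.
  near=> k.
  have k0 : (0 < k)%R by near: k; exact: lt_nbhsr.
  have k1 : (k < 1 - t)%R by near: k; exact: lt_nbhsl.
  have hP : (`|Phi (t + h) - Phi (t + k)| <= e)%R by near: k.
  have [kh|/ltW hk] := leP k h.
    rewrite distrC; apply: le_trans (rho_lip _ _ _ _) _; try lra.
    by apply: le_trans (ler_norm _) _.
  apply: le_trans (rho_lip _ _ _ _) _; try lra.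
  by apply: le_trans (ler_norm _) _; rewrite distrC.
have cE : (fun k => (rho t (t + k) * k^-1)%:E) @ h --> (rho t (t + h) * h^-1)%:E.
  apply: cvg_EFin; first exact: nearW.
  by apply: cvgM => //; apply: cvgV; [rewrite gt_eqF|exact: cvg_id].
have E : \forall k \near h, (rho t (t + k) * k^-1)%:E = diff c k t.
  near=> k.
  have k0 : (0 < k)%R by near: k; exact: lt_nbhsr.
  have k1 : (k < 1 - t)%R by near: k; exact: lt_nbhsl.
  by rewrite /diff -/(P _) -/(P _) EFinM /rho -d_fin//; lra.
suff : (fun k => diff c k t) @ h --> diff c h t by [].
rewrite -(nbhs_singleton E).
by apply: cvg_trans cE; apply: near_eq_cvg; apply: filterS E => k ->.
Unshelve. all: by end_near. Qed.

Let speedE t : (0 <= t < 1)%R -> forward_speed d c t =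
  if rat_limsup (fun h => diff c h t) == rat_liminf (fun h => diff c h t)
  then rat_limsup (fun h => diff c h t) else point.
Proof.
move=> /andP[t0 t1]; have b0 : (0 < 1 - t)%R by rewrite subr_gt0.
rewrite -(lim_at_rightE b0 (fun h => @diff_continuous t h t0)).
have E : \forall h \near 0%R^'+, d (ev t c) (ev (t + h)%R c) * (h^-1)%:E = diff c h t.
  near=> h.
  have h0 : (0 < h)%R by near: h; exact: nbhs_right_gt.
  have h1 : (h < 1 - t)%R by near: h; exact: nbhs_right_lt.
  by rewrite /diff !ev_to_unit//; apply/andP; split; lra.
rewrite /forward_speed; congr (lim_in _ _); apply/funext => A; apply/propext; split => H.
  by apply: filterS2 E H => h /= ->.
by apply: filterS2 E H => h /= ->.
Unshelve. all: by end_near. Qed.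

Lemma measurable_forward_speed : measurable_fun (`[0%R, 1%R[%classic : set R) (forward_speed d c).
Proof.
have mS : measurable_fun (`[0%R, 1%R[%classic : set R) (fun t => rat_limsup (fun h => diff c h t)).
  by apply: measurable_rat_limsup => h; exact: measurable_funS (measurable_diff c h).
have mI : measurable_fun (`[0%R, 1%R[%classic : set R) (fun t => rat_liminf (fun h => diff c h t)).
  apply: measurableT_comp => //; apply: (@measurable_rat_limsup _ _ _ _ (fun h t => - diff c h t)) => h.
  by apply: measurableT_comp => //; exact: measurable_funS (measurable_diff c h).
pose S t := rat_limsup (fun h => diff c h t); pose I t := rat_liminf (fun h => diff c h t).
apply: (@eq_measurable_fun _ _ _ _ _ (fun t => if S t == I t then S t else point)).
  by move=> t; rewrite inE /= in_itv /= => t01; rewrite speedE.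
apply: measurable_fun_if => //.
- apply: (@measurable_fun_bool _ _ _ _ true).
  rewrite (_ : _ @^-1` _ = [set t | S t = I t]); first exact: measurable_eqe.
  by apply/seteqP; split => t /= /eqP.
- by apply: measurable_funS mS.
Qed.

Lemma forward_speed_ge0 t : 0 <= forward_speed d c t.
Proof.
have [cF|ncF] := pselect (cvg (d (ev t c) (ev (t + h)%R c) * (h^-1)%:E @[h --> 0%R^'+])); last first.
  by rewrite /forward_speed dvgP.
apply: lime_ge => //; near=> h; rewrite mule_ge0//; first exact: aem_ge0 dm _ _.
by rewrite lee_fin invr_ge0 ltW//; near: h; exact: nbhs_right_gt.
Unshelve. all: by end_near. Qed.

(** At almost every time the primitive of [gf] has derivative [gf] and its difference quotients
    dominate those of the curve. Where the limit defining the speed does not exist, the value is the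
    default [point], which is 0 and hence below [gf]. *)
Lemma forward_speed_le : {ae mu, forall t, (0 < t < 1)%R -> forward_speed d c t <= (gf t)%:E}.
Proof.
pose D : set R := `[0%R, 1%R]%classic.
pose g := gf \_ D.
have mD : measurable D by exact: measurable_itv.
have iD : mu.-integrable D (EFin \o gf) by exact: nonneg_Lp_integrable.
have ig : mu.-integrable setT (EFin \o g).
  apply: eq_integrable (iffLR (integrable_mkcond _ _) iD) => // t _ /=.
  by rewrite /g /patch; case: ifP.
have lg : locally_integrable setT g by apply: integrable_locally.
have iy y : mu.-integrable `[0%R, y] (EFin \o g) by apply: integrableS ig.
have := @FTC1 R g (BLeft 0%R) iy lg.
apply: filterS => t H /andP[t0 t1].
case: H; first by rewrite /= lte_fin.
set F := (fun x => _) => dF F'.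
have t01 : (0 <= t < 1)%R by rewrite ltW.
rewrite speedE//.
have gt : g t = gf t by rewrite /g patchE ifT// inE /D /= in_itv /= !ltW.
have cF : (fun h : R => ((F (t + h) - F t) / h)%:E) @ 0%R^'+ --> (gf t)%:E.
  apply: cvg_EFin; first exact: nearW.
  apply: cvg_dnbhs_at_right.
  have : cvg _ := dF; move/cvg_ex => [l Hl].
  have : F^`()%classic t = l by rewrite derive1E; apply: cvg_lim.
  rewrite F' gt => El; rewrite El.
  apply: cvg_trans Hl; apply: near_eq_cvg; apply: nearW => h /=.
  by rewrite /GRing.scale /= mulr1 [in RHS]mulrC [(h + t)%R]addrC.
have FE u : (0 <= u <= 1)%R -> F u = Int gf u.
  move=> /andP[u0 u1]; rewrite /F /Int /parameterized_integral; apply: eq_Rintegral => x.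
  by rewrite inE /= in_itv /= => /andP[x0 xu]; rewrite /g patchE ifT// inE /D /= in_itv /= x0 (le_trans xu).
case: ifPn => [/eqP SI|_]; last first.
  have [_ g0 _] := Lgf; rewrite lee_fin; apply: g0; by rewrite in_itv /= !ltW.
have near_le : \forall h \near 0%R^'+, diff c h t <= ((F (t + h) - F t) / h)%:E.
  near=> h.
  have h0 : (0 < h)%R by near: h; exact: nbhs_right_gt.
  have h1 : (h < 1 - t)%R by near: h; apply: nbhs_right_lt; lra.
  rewrite /diff EFinM lee_wpmul2r ?lee_fin ?invr_ge0 ?(ltW h0)//.
  have th1 : (t + h <= 1)%R by lra.
  have th0 : (t <= t + h)%R by rewrite lerDl ltW.
  rewrite (FE (t + h)%R) ?th1 ?(le_trans (ltW t0) th0)// (FE t) ?(ltW t0) ?(ltW t1)//.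
  exact: cf (ltW t0) th0 th1.
exact: rat_limsup_le_lim near_le cF.
Unshelve. all: by end_near. Qed.

End curve_speed.

Lemma forward_speed_Lp c : ac p d c -> exists g, nonneg_Lp p g /\
  {ae mu, forall t, (0 < t < 1)%R -> forward_speed d c t <= (g t)%:E}.
Proof.
move=> [[gf Lgf cgf] [gb Lgb cgb]]; exists gf; split => //.
exact: forward_speed_le Lgf Lgb cgf cgb.
Qed.

Lemma ac_measurable_forward_speed c : ac p d c ->
  measurable_fun (`[0%R, 1%R[%classic : set R) (forward_speed d c).
Proof.
move=> [[gf Lgf cgf] [gb Lgb cgb]].
exact: measurable_forward_speed Lgf Lgb cgf cgb.
Qed.

End forward_speed.

Lemma ge0_le_poweR {R : realType} (r : R) (x y : \bar R) : (0 <= r)%R ->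
  0 <= x -> x <= y -> x `^ r <= y `^ r.
Proof.
move=> r0 x0 xy; apply: gt0_ler_poweR => //; rewrite in_itv /= leey andbT//.
exact: le_trans x0 xy.
Qed.

(** Jensen's inequality for the mean A/l, obtained by integrating Young's inequality m g <= g^p/p +
    m^q/q. *)
Lemma integral_powR_ge {R : realType} d0 {T : measurableType d0} (mu : {measure set T -> \bar R})
    (p l A : R) (D : set T) (g : T -> R) :
  (1 < p)%R -> measurable D -> mu D = l%:E -> (0 < l)%R -> measurable_fun D g ->
  (forall x, D x -> (0 <= g x)%R) -> \int[mu]_(x in D) (g x)%:E = A%:E ->
  (l * (A / l) `^ p)%:E <= \int[mu]_(x in D) (g x `^ p)%:E.
Proof.
move=> p1 mD mul l0 mg g0 gA; have p0 : (0 < p)%R by exact: lt_trans p1.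
have mgp : measurable_fun D (fun x => (g x `^ p)%:E) by exact: measurable_powR_EFin.
have A0 : (0 <= A)%R by rewrite -lee_fin -gA; apply: integral_ge0 => x Dx; rewrite lee_fin g0.
have I0 : 0 <= \int[mu]_(x in D) (g x `^ p)%:E by apply: integral_ge0 => x _; rewrite lee_fin powR_ge0.
move: A0; rewrite le_eqVlt => /predU1P[<-|A0]; first by rewrite mul0r powR0 ?gt_eqF// mulr0.
have [->|Iy] := eqVneq (\int[mu]_(x in D) (g x `^ p)%:E) +oo; first by rewrite leey.
have Ifin : \int[mu]_(x in D) (g x `^ p)%:E \is a fin_num by rewrite ge0_fin_numE// ltey.
set I := \int[mu]_(x in D) (g x `^ p)%:E in I0 Ifin *.
pose q := (p / (p - 1))%R; have pm1 : (0 < p - 1)%R by rewrite subr_gt0.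
have q0 : (0 < q)%R by rewrite divr_gt0.
have pq : (p^-1 + q^-1 = 1)%R by rewrite /q invf_div; field; rewrite gt_eqF.
pose B := (A / l)%R; have B0 : (0 < B)%R by rewrite divr_gt0.
(* With this slope Young's inequality is an equality at g = B, so nothing is lost at constant
   functions. *)
pose m := (B `^ (p - 1))%R; have m0 : (0 < m)%R by exact: powR_gt0.
have mq : (m `^ q = B `^ p)%R.
  by rewrite /m -powRrM /q; congr (_ `^ _)%R; field; rewrite gt_eqF.
have mB : (m * B = B `^ p)%R.
  have : (B `^ (p - 1 + 1) = m * B)%R by rewrite powRD ?(gt_eqF B0) ?implybT// powRr1// ltW.
  by rewrite subrK.
have H : m%:E * A%:E <= (p^-1)%:E * I + (m `^ q / q)%:E * l%:E.
  have mgE : measurable_fun D (EFin \o g) by exact/measurable_EFinP.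
  have k0 : (0 <= m `^ q / q)%R by rewrite divr_ge0 ?powR_ge0 ?ltW.
  have -> : m%:E * A%:E = \int[mu]_(x in D) (m%:E * (g x)%:E).
    by rewrite ge0_integralZl// ?gA// ?lee_fin ?(ltW m0)// => x Dx; rewrite lee_fin g0.
  have pV0 : (0 <= p^-1)%R by rewrite invr_ge0 ltW.
  have -> : (p^-1)%:E * I + (m `^ q / q)%:E * l%:E =
      \int[mu]_(x in D) ((p^-1)%:E * (g x `^ p)%:E + (m `^ q / q)%:E).
    rewrite ge0_integralD//.
    - rewrite ge0_integralZl//; last by move=> x _; rewrite lee_fin powR_ge0.
      by rewrite integral_cst// -mul.
    - by move=> x _; rewrite mule_ge0// lee_fin powR_ge0.
    - exact: measurable_funeM.
  apply: ge0_le_integral => //.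
  - by move=> x Dx; rewrite mule_ge0// lee_fin ?g0// ltW.
  - by apply: measurable_funeM; exact/measurable_EFinP.
  - by apply: emeasurable_funD => //; exact: measurable_funeM.
  - move=> x Dx; change ((m * g x)%:E <= (p^-1 * g x `^ p + m `^ q / q)%:E).
    rewrite lee_fin mulrC [(p^-1 * _)%R]mulrC.
    exact: conjugate_powR (g0 _ Dx) (ltW m0) p0 q0 pq.
move: H; rewrite -(fineK Ifin) -!EFinM -EFinD !lee_fin mq => H.
have mA : (m * A = l * B `^ p)%R by rewrite -mB /B; field; rewrite gt_eqF.
rewrite -/B -(@ler_pM2l _ (p^-1)%R) ?invr_gt0//.
have -> : (p^-1 * (l * B `^ p) = m * A - B `^ p / q * l)%R.
  have -> : (p^-1 = 1 - q^-1)%R by rewrite -pq addrK.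
  by rewrite mA; ring.
by rewrite lerBlDr.
Qed.

Lemma lower_semicontinuous_borel {R : realType} {X : ptopologicalType} (f : X -> \bar R) :
  lower_semicontinuous f -> measurable_fun setT (f : borel X -> \bar R).
Proof.
move=> scif; apply: (measurability _ (ErealGenOInfty.measurableE R)).
move=> /= _ [_ [a ->]] <-; rewrite setTI; apply: sub_sigma_algebra.
by rewrite preimage_itvoy; move/lower_semicontinuousP : scif; exact.
Qed.

(** * Borel measurability of absolute continuity *)

Section dyadic_energy.
Context {R : realType} {X : ptopologicalType} (p : R).
Hypothesis p1 : (1 < p)%R.
Local Notation mu := (@lebesgue_measure R).
Implicit Types (c : curve R X) (d : X -> X -> \bar R).

Let p0 : (0 < p)%R. Proof. exact: lt_trans p1. Qed.

Definition dyadic_step d n c j : \bar R := d (ev (dyadic_point n j) c) (ev (dyadic_point n j.+1) c).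

(** The integral of the p-th power of the difference quotients of level n. It depends on finitely
    many evaluations, hence is Borel in the curve. *)
Definition dyadic_energy d n c : \bar R :=
  \sum_(0 <= j < 2 ^ n) ((2 ^ n)%:R^-1)%:E * (((2 ^ n)%:R%:E * dyadic_step d n c j) `^ p).

Lemma mu_dyadic_itv n j : mu (dyadic_itv n j) = ((2 ^ n)%:R^-1)%:E.
Proof.
have := lebesgue_measure_itv `[dyadic_point n j, dyadic_point n j.+1[ => /= ->.
rewrite lte_fin ltr_dyadic_point ltnSn -EFinB; congr EFin.
by rewrite /dyadic_point -mulrBl -natr1 addrAC subrr add0r mul1r.
Qed.

Lemma dyadic_energy_le d c (g : R -> R) : asymmetric_extended_metric d -> nonneg_Lp p g ->
  (forall s t : R, (0 <= s)%R -> (s <= t)%R -> (t <= 1)%R ->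
     d (ev s c) (ev t c) <= \int[mu]_(r in `[s, t]) (g r)%:E) ->
  forall n, dyadic_energy d n c <= \int[mu]_(r in `[0%R, 1%R]) (g r `^ p)%:E.
Proof.
move=> dm Lg cg n; have [mg g0 _] := Lg.
have mgp : measurable_fun (`[0%R, 1%R] : set R) (fun r => (g r `^ p)%:E) by exact: measurable_powR_EFin.
have sub01 : `[0%R, 1%R[ `<=` (`[0%R, 1%R]%classic : set R).
  by move=> x /=; rewrite !in_itv /= => /andP[-> /ltW].
rewrite -integral_itv_bndo_bndc; last exact: measurable_funS mgp.
rewrite (ge0_integral_dyadic n); [|exact: measurable_funS mgp|by move=> x _; rewrite lee_fin powR_ge0].
rewrite /dyadic_energy big_seq [leRHS]big_seq; apply: lee_sum => j; rewrite mem_index_iota /= => jn.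
have sub : dyadic_itv n j `<=` (`[0%R, 1%R]%classic : set R).
  exact: subset_trans (dyadic_itv_sub jn) sub01.
have dj : (dyadic_point n j <= dyadic_point n j.+1 :> R)%R by rewrite ler_dyadic_point.
have ig : mu.-integrable `[dyadic_point n j, dyadic_point n j.+1] (EFin \o g).
  by apply: (nonneg_Lp_integrable p1) => //; [exact: dyadic_point_ge0|exact: dyadic_point_le1].
have := cg _ _ (dyadic_point_ge0 n j) dj (dyadic_point_le1 jn).
rewrite -integral_itv_bndo_bndc; last first.
  by apply/measurable_EFinP; exact: measurable_funS mg.
rewrite -/(dyadic_itv n j) -/(dyadic_step d n c j) => step_le.
set A := \int[mu]_(r in dyadic_itv n j) (g r)%:E in step_le.
have A0 : 0 <= A by apply: integral_ge0 => x jx; rewrite lee_fin; apply: g0; have := sub x jx.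
have Afin : A \is a fin_num.
  have sub' : dyadic_itv n j `<=` (`[dyadic_point n j, dyadic_point n j.+1]%classic : set R).
    by move=> x; rewrite /dyadic_itv /= !in_itv /= => /andP[-> /ltW].
  apply: integrable_fin_num; first exact: measurable_itv.
  by apply: integrableS ig => //; exact: measurable_itv.
have s0 : 0 <= dyadic_step d n c j by exact: aem_ge0 dm _ _.
have n0 : (0 < (2 ^ n)%:R :> R)%R by rewrite ltr0n expn_gt0.
have := @integral_powR_ge _ _ _ mu p ((2 ^ n)%:R^-1) (fine A) (dyadic_itv n j) g p1 (measurable_itv _) (mu_dyadic_itv n j).
rewrite invr_gt0 => H; apply: le_trans (H n0 _ _ _).
- rewrite EFinM lee_wpmul2l ?lee_fin ?invr_ge0 ?ltr0n//.
  rewrite invrK -poweR_EFin; apply: ge0_le_poweR; first exact: ltW.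
  - by rewrite mule_ge0// lee_fin ler0n.
  - by rewrite mulrC EFinM fineK// lee_wpmul2l// lee_fin ler0n.
- exact: measurable_funS mg.
- by move=> x jx; apply: g0; have := sub x jx.
- by rewrite fineK.
Qed.



Section energy_bounded.
Variables (d : X -> X -> \bar R) (c : curve R X) (K : R).
Hypothesis dm : asymmetric_extended_metric d.
Hypothesis lscD : lower_semicontinuous (fun z : X * X => d z.1 z.2).
Hypothesis energy_le : forall n, dyadic_energy d n c <= K%:E.

Let step := dyadic_step d.
Let T := measurableTypeR R.

Let C n (g : T -> R) := [/\ measurable_fun setT g, forall x, (0 <= g x)%R &
  forall j, (j < 2 ^ n)%N -> step n c j <= \int[mu]_(x in dyadic_itv n j) (g x)%:E].

Let step_ge0 n j : 0 <= step n c j. Proof. exact: aem_ge0 dm _ _. Qed.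

Let step_fin n j : (j < 2 ^ n)%N -> step n c j \is a fin_num.
Proof.
move=> jn; rewrite ge0_fin_numE//.
have n0 : (0 < (2 ^ n)%:R :> R)%R by rewrite ltr0n expn_gt0.
have term0 k : 0 <= ((2 ^ n)%:R^-1)%:E * (((2 ^ n)%:R%:E * step n c k) `^ p).
  by rewrite mule_ge0 ?poweR_ge0// lee_fin invr_ge0 ltW.
have : ((2 ^ n)%:R^-1)%:E * (((2 ^ n)%:R%:E * step n c j) `^ p) < +oo.
  apply: le_lt_trans (ltry K); apply: le_trans (energy_le n).
  rewrite /dyadic_energy (bigD1_seq j) ?iota_uniq ?mem_index_iota//= leeDl//.
  by apply: sume_ge0 => k _; exact: term0.
case: (step n c j) (step_ge0 n j) => [r||] // _.
  by rewrite !ltry.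
by rewrite gt0_muley ?lte_fin// poweRyr ?gt_eqF// gt0_muley ?lte_fin ?invr_gt0.
Qed.

(** A dyadic increment is at most the sum of its two halves by the triangle inequality, so
    domination on a finer grid is the stronger condition. *)
Let C_decr n : C n.+1 `<=` C n.
Proof.
move=> g [mg g0 gC]; split => // j jn.
have n0 : (0 < 2)%N by [].
have jn1 : ((2 * j).+1 < 2 ^ n.+1)%N by rewrite expnS -[(2 * j).+2]/(2 + 2 * j)%N -mulnS leq_pmul2l.
have pt1 : dyadic_point n j = dyadic_point n.+1 (2 * j) :> R by rewrite dyadic_pointS.
have pt2 : dyadic_point n j.+1 = dyadic_point n.+1 (2 * j).+2 :> R by rewrite -dyadic_pointS mulnS.
have -> : dyadic_itv n j = dyadic_itv n.+1 (2 * j) `|` dyadic_itv n.+1 (2 * j).+1 :> set R.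
  rewrite /dyadic_itv pt1 pt2; apply: itv_bndbnd_setU; rewrite bnd_simp ler_dyadic_point//.
have mgE : measurable_fun setT (EFin \o g) by exact/measurable_EFinP.
rewrite ge0_integral_setU//; first last.
- apply/disj_setPS => x []; rewrite /dyadic_itv /= !in_itv /= => /andP[_ xk].
  by rewrite leNgt xk.
- by move=> x _; rewrite lee_fin.
- exact: measurable_funS mgE.
- exact: measurable_itv.
- exact: measurable_itv.
rewrite /step /dyadic_step pt1 pt2; apply: le_trans (aem_triangle dm _ (ev (dyadic_point n.+1 (2 * j).+1) c) _) _.
by apply: leeD; apply: gC => //; exact: ltnW.
Qed.

Let ge0_half (x : \bar R) : x = (2^-1)%:E * (x + x).
Proof.
case: x => [r| |] /=.
- by rewrite -EFinD -EFinM; congr EFin; field.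
- by rewrite gt0_muley// lte_fin invr_gt0.
- by rewrite gt0_muleNy// lte_fin invr_gt0.
Qed.

Let C_mid n (g h : T -> R) : C n g -> C n h -> C n (fun x => ((g x + h x) / 2)%R).
Proof.
move=> [mg g0 gC] [mh h0 hC]; split.
- by apply: measurable_funM => //; exact: measurable_funD.
- by move=> x; rewrite divr_ge0// addr_ge0.
move=> j jn.
have mgE : measurable_fun (dyadic_itv n j) (EFin \o g) by apply/measurable_EFinP; exact: measurable_funS mg.
have mhE : measurable_fun (dyadic_itv n j) (EFin \o h) by apply/measurable_EFinP; exact: measurable_funS mh.
have -> : \int[mu]_(x in dyadic_itv n j) ((g x + h x) / 2)%:E =
    \int[mu]_(x in dyadic_itv n j) ((2^-1)%:E * ((g x)%:E + (h x)%:E)).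
  by apply: eq_integral => x _; rewrite -EFinD -EFinM mulrC.
rewrite ge0_integralZl//; first last.
- by move=> x _; rewrite adde_ge0// lee_fin.
- exact: emeasurable_funD.
- exact: measurable_itv.
rewrite ge0_integralD//; [|exact: measurable_itv|by move=> x _; rewrite lee_fin|by move=> x _; rewrite lee_fin].
by rewrite {1}(ge0_half (step n c j)) lee_wpmul2l ?lee_fin ?invr_ge0// leeD ?gC ?hC.
Qed.

Let sf n (x : T) : R := (\sum_(j < 2 ^ n) ((2 ^ n)%:R * fine (step n c j)) * \1_(dyadic_itv n j) x)%R.

Let sfE n j x : (j < 2 ^ n)%N -> dyadic_itv n j x -> sf n x = ((2 ^ n)%:R * fine (step n c j))%R.
Proof.
move=> jn jx; rewrite /sf (bigD1 (Ordinal jn))//= big1 ?addr0; last first.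
  move=> i ij; rewrite indicE memNset ?mulr0// => ix.
  by move/eqP: ij; apply; apply: val_inj => /=; exact: dyadic_itv_inj ix jx.
by rewrite indicE mem_set// mulr1.
Qed.

Let sf_out n x : ~ (0 <= x < 1)%R -> sf n x = 0%R.
Proof.
move=> x01; rewrite /sf big1// => i _; rewrite indicE memNset ?mulr0// => ix.
by apply: x01; have := dyadic_itv_sub (ltn_ord i) ix; rewrite /= in_itv.
Qed.

Let C_near n e : (0 < e)%R -> exists2 g, C n g & \int[mu]_x (g x `^ p)%:E <= (K + e)%:E.
Proof.
move=> e0; have n0 : (0 < (2 ^ n)%:R :> R)%R by rewrite ltr0n expn_gt0.
have msf : measurable_fun setT (sf n).
  apply: measurable_sum => j; apply: measurable_funM => //.
  by apply: measurable_indic; exact: measurable_itv.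
have sf0 x : (0 <= sf n x)%R.
  by apply: sumr_ge0 => j _; rewrite mulr_ge0// mulr_ge0 ?fine_ge0// ltW.
have msfp : measurable_fun setT (fun x => (sf n x `^ p)%:E) by exact: measurable_powR_EFin.
exists (sf n).
  split => // j jn.
  rewrite (_ : \int[mu]_(x in _) _ = \int[mu]_(x in dyadic_itv n j) ((2 ^ n)%:R * fine (step n c j))%:E); last first.
    by apply: eq_integral => x; rewrite inE => jx; rewrite (sfE jn jx).
  rewrite integral_cst; last exact: measurable_itv.
  by rewrite [X in _ * X](mu_dyadic_itv n j) -EFinM mulrAC divff ?mul1r ?gt_eqF// fineK ?step_fin.
apply: (@le_trans _ _ K%:E); last by rewrite lee_fin lerDl ltW.
apply: le_trans (energy_le n).
have -> : \int[mu]_x (sf n x `^ p)%:E = \int[mu]_(x in `[0%R, 1%R[) (sf n x `^ p)%:E.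
  rewrite [RHS]integral_mkcond; apply: eq_integral => x _; rewrite patchE; case: ifPn => // /negP x01.
  by rewrite sf_out ?powR0 ?gt_eqF// => h; apply: x01; rewrite inE /= in_itv.
rewrite (ge0_integral_dyadic n); [|exact: measurable_funS msfp|by move=> x _; rewrite lee_fin powR_ge0].
rewrite /dyadic_energy big_seq [leRHS]big_seq; apply: lee_sum => j; rewrite mem_index_iota /= => jn.
rewrite (_ : \int[mu]_(x in _) _ = \int[mu]_(x in dyadic_itv n j) (((2 ^ n)%:R * fine (step n c j)) `^ p)%:E); last first.
  by apply: eq_integral => x; rewrite inE => jx; rewrite (sfE jn jx).
rewrite integral_cst; last exact: measurable_itv.
have -> : ((2 ^ n)%:R%:E * dyadic_step d n c j) `^ p = (((2 ^ n)%:R * fine (step n c j)) `^ p)%:E.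
  by rewrite -poweR_EFin EFinM fineK// step_fin.
by rewrite [X in _ * X](mu_dyadic_itv n j) muleC.
Qed.

Let chain n g i j : C n g -> (i <= j)%N -> (j <= 2 ^ n)%N ->
  d (ev (dyadic_point n i) c) (ev (dyadic_point n j) c) <=
  \int[mu]_(x in `[dyadic_point n i, dyadic_point n j[) (g x)%:E.
Proof.
move=> [mg g0 gC]; elim: j => [|j IH] ij jn.
  move: ij; rewrite leqn0 => /eqP ->; rewrite set_itvco0 integral_set0.
  by rewrite (iffRL (aem_eq0 dm _ _)).
move: ij; rewrite leq_eqVlt => /predU1P[->|].
  by rewrite set_itvco0 integral_set0 (iffRL (aem_eq0 dm _ _)).
rewrite ltnS => ij.
have mgE : measurable_fun setT (EFin \o g) by exact/measurable_EFinP.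
have E : `[dyadic_point n i, dyadic_point n j.+1[%classic =
    `[dyadic_point n i, dyadic_point n j[%classic `|` dyadic_itv n j :> set R.
  by apply: itv_bndbnd_setU; rewrite bnd_simp ler_dyadic_point.
rewrite E ge0_integral_setU//; first last.
- apply/disj_setPS => x []; rewrite /dyadic_itv /= !in_itv /= => /andP[_ xk].
  by rewrite leNgt xk.
- by move=> x _; rewrite lee_fin.
- exact: measurable_funS mgE.
- exact: measurable_itv.
apply: le_trans (aem_triangle dm _ (ev (dyadic_point n j) c) _) _.
by apply: leeD; [apply: IH => //; exact: ltnW|exact: gC].
Qed.

(* The dyadic difference quotients are near-minimizers of the L^p energy among
   the g whose integrals dominate the dyadic increments of c. *)
Lemma energy_bounded_ac : forward_ac p d c.
Proof.
have [|||||H [L [G [CH [mL L0 EL] [mG G0 EG] HL HG]]]] :=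
  @near_minimizers_limit R _ T mu p p1 C K.
- by move=> n g [].
- by move=> n g x [].
- exact: C_decr.
- exact: C_mid.
- exact: C_near.
have Lp_of (g : R -> R) (mg : measurable_fun setT g) (g0 : forall x, (0 <= g x)%R) :
    \int[mu]_x (g x `^ p)%:E < +oo -> nonneg_Lp p g.
  move=> ig; split; [exact: measurable_funS mg|by move=> x _; exact: g0|].
  apply: le_lt_trans ig; apply: ge0_subset_integral => //; first exact: measurable_powR_EFin.
  by move=> x _; rewrite lee_fin powR_ge0.
have LG : nonneg_Lp p G by apply: (Lp_of _ mG G0); exact: le_lt_trans EG (ltry _).
have LL : nonneg_Lp p L by exact: Lp_of.
exists G => //.
have C_le n m : (n <= m)%N -> C m `<=` C n.
  move=> nm; rewrite -(subnKC nm); elim: (m - n)%N => [|k IH]; first by rewrite addn0.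
  by rewrite addnS; exact: subset_trans (@C_decr _) IH.
(* All [H k] with k >= n dominate the increments of level n; dominated convergence with majorant [L]
   passes this to [G]. *)
have grid n i j : (i <= j)%N -> (j <= 2 ^ n)%N ->
    d (ev (dyadic_point n i) c) (ev (dyadic_point n j) c) <=
    \int[mu]_(x in `[dyadic_point n i, dyadic_point n j]) (G x)%:E.
  move=> ij jn; set I : set R := `[dyadic_point n i, dyadic_point n j]%classic.
  have mI : measurable I by exact: measurable_itv.
  have iL : mu.-integrable I (EFin \o L).
    by apply: (nonneg_Lp_integrable p1) => //; [exact: dyadic_point_ge0|exact: dyadic_point_le1].
  have [] := @dominated_convergence _ T R mu I mI (fun k => EFin \o H k) (EFin \o G) (EFin \o L).
  - by move=> k; have [mH _ _] := CH k; apply/measurable_EFinP; exact: measurable_funS mH.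
  - by apply/measurable_EFinP; exact: measurable_funS mG.
  - apply: filterS HG => x Hx _; apply: cvg_EFin => //; exact: nearW.
  - exact: iL.
  - apply: filterS HL => x Hx k _ /=; rewrite lee_fin ger0_norm//.
    by have [_ H0 _] := CH k.
  move=> _ _ cv; rewrite -(cvg_lim _ cv)//; apply: lime_ge; first by apply/cvg_ex; eexists; exact: cv.
  exists n => // k /= nk.
  have CHn : C n (H k) := C_le n k nk _ (CH k).
  apply: le_trans (chain CHn ij jn) _; rewrite integral_itv_bndo_bndc//.
  by have [mH _ _] := CH k; apply/measurable_EFinP; exact: measurable_funS mH.
move=> s t s0 st t1; move: st; rewrite le_eqVlt => /predU1P[<-|st].
  by rewrite (iffRL (aem_eq0 dm _ _))//; apply: integral_ge0 => x _; rewrite lee_fin.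
have iG : mu.-integrable `[s, t] (EFin \o G) by exact: (nonneg_Lp_integrable p1).
set I := \int[mu]_(r in _) _.
have Ifin : I \is a fin_num by exact: integrable_fin_num.
(* From the grid to arbitrary times by contradiction: by lower semicontinuity, if [d] exceeded the
   integral at (s,t), it would exceed it at all nearby grid pairs. *)
rewrite leNgt; apply/negP; rewrite -(fineK Ifin) => Id.
pose jj n (r : R) := Num.truncn (r * (2 ^ n)%:R).
have n0 n : (0 < (2 ^ n)%:R :> R)%R by rewrite ltr0n expn_gt0.
have jjP n (r : R) : (0 <= r)%R -> (dyadic_point n (jj n r) <= r < dyadic_point n (jj n r).+1)%R.
  move=> r0; have /truncn_itv/andP[h1 h2] : (0 <= r * (2 ^ n)%:R)%R by rewrite mulr_ge0// ltW.
  by rewrite /dyadic_point ler_pdivrMr// ltr_pdivlMr// h1 h2.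
have stepE n k : (dyadic_point n k.+1 = dyadic_point n k + (2 ^ n)%:R^-1 :> R)%R.
  by rewrite /dyadic_point -natr1 mulrDl mul1r.
(* [s] is rounded up and [t] down, so that the grid interval lies inside [s,t] and its integral is
   at most that over [s,t]. *)
pose sn n := dyadic_point n (jj n s).+1 : R; pose tn n := dyadic_point n (jj n t) : R.
have cvs : sn @ \oo --> s.
  apply/cvgrPdist_le => e e0; have [N _ HN] := @near_infty_natSinv_lt R (PosNum e0).
  exists N => // n /= Nn; apply: (@le_trans _ _ ((2 ^ n)%:R^-1)%R).
    by have /andP[h1 h2] := jjP n s s0; move: h2; rewrite /sn stepE => h2; rewrite ler_norml; apply/andP; split; lra.
  apply/ltW; apply: le_lt_trans (HN N (leqnn _)); rewrite lef_pV2 ?posrE ?ltr0n ?expn_gt0// ler_nat.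
  by apply: leq_ltn_trans Nn _; exact: ltn_expl.
have t0 : (0 <= t)%R by exact: le_trans s0 (ltW st).
have cvt : tn @ \oo --> t.
  apply/cvgrPdist_le => e e0; have [N _ HN] := @near_infty_natSinv_lt R (PosNum e0).
  exists N => // n /= Nn; apply: (@le_trans _ _ ((2 ^ n)%:R^-1)%R).
    by have /andP[h1 h2] := jjP n t t0; move: h2; rewrite /tn stepE => h2; rewrite ler_norml; apply/andP; split; lra.
  apply/ltW; apply: le_lt_trans (HN N (leqnn _)); rewrite lef_pV2 ?posrE ?ltr0n ?expn_gt0// ler_nat.
  by apply: leq_ltn_trans Nn _; exact: ltn_expl.
have cP (u : nat -> R) (r : R) : u @ \oo --> r -> (fun n => c (to_unit (u n))) @ \oo --> c (to_unit r).
  by move=> ur; apply: (@continuous_cvg _ _ _ _ _ u (fun s => c (to_unit s))) => //; exact: path_continuous.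
have cpair : (fun n => (c (to_unit (sn n)), c (to_unit (tn n)))) @ \oo --> (c (to_unit s), c (to_unit t)).
  by apply: cvg_pair; exact: cP.
have /lower_semicontinuousP/(_ (fine I)) oA := lscD.
have s1 : (s <= 1)%R by rewrite (le_trans (ltW st)).
have nA : nbhs (c (to_unit s), c (to_unit t)) [set z | (fine I)%:E < d z.1 z.2].
  by apply: open_nbhs_nbhs; split => //=; rewrite -!ev_to_unit// ?s0 ?t0.
have [N1 _ H1] := cpair _ nA.
have [N2 _ H2] : \forall n \near \oo, (sn n < tn n)%R.
  pose m := ((s + t) / 2)%R.
  have n1 : \forall n \near \oo, (sn n < m)%R by apply: cvgr_lt cvs _ _; rewrite /m; lra.
  have n2 : \forall n \near \oo, (m < tn n)%R by apply: cvgr_gt cvt _ _; rewrite /m; lra.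
  by apply: filterS2 n1 n2 => n; exact: lt_trans.
pose n := maxn N1 N2.
have {}H1 := H1 n (leq_maxl _ _); have {}H2 := H2 n (leq_maxr _ _); move: H1 H2 => /=.
have /andP[js1 js2] := jjP n s s0; have /andP[jt1 jt2] := jjP n t t0.
move=> H1; rewrite /sn /tn ltr_dyadic_point => H2.
have jtn : (jj n t <= 2 ^ n)%N by rewrite -(@ler_dyadic_point R n) dyadic_pointn (le_trans jt1).
have := grid n _ _ (ltnW H2) jtn.
move: H1; rewrite -!ev_to_unit; last 2 first.
- by rewrite /tn dyadic_point_ge0 dyadic_point_le1.
- by rewrite /sn dyadic_point_ge0 dyadic_point_le1// (leq_trans (ltnW H2)).
rewrite -/(sn n) -/(tn n) => Hc Hd; have := lt_le_trans Hc Hd; rewrite ltNge => /negP; apply.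
rewrite fineK//; apply: ge0_subset_integral => //.
- by apply/measurable_EFinP; exact: measurable_funS mG.
- by move=> x _; rewrite lee_fin.
- move=> x /=; rewrite !in_itv /= => /andP[h1 h2].
  by rewrite (le_trans (ltW js2) h1) (le_trans h2 jt1).
Qed.

End energy_bounded.

Lemma forward_ac_energy d c : asymmetric_extended_metric d ->
  lower_semicontinuous (fun z : X * X => d z.1 z.2) ->
  forward_ac p d c <-> esups (fun n => dyadic_energy d n c) 0%N < +oo.
Proof.
move=> dm lscD; split => [[g Lg cg]|].
  have [_ _ ig] := Lg; apply: le_lt_trans ig; apply: ge_ereal_sup => _ [n _ <-].
  exact: dyadic_energy_le.
set S := esups _ _ => Sfin.
have S0 : 0 <= S.
  apply: (@le_trans _ _ (dyadic_energy d 0 c)); last by apply: ereal_sup_ubound; exists 0%N.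
  by apply: sume_ge0 => j _; rewrite mule_ge0 ?poweR_ge0// lee_fin invr_ge0 ler0n.
apply: (@energy_bounded_ac d c (fine S)) => // n.
rewrite fineK ?ge0_fin_numE//; apply: ereal_sup_ubound; exists n => //.
Qed.

Lemma measurable_forward_ac d : asymmetric_extended_metric d ->
  lower_semicontinuous (fun z : X * X => d z.1 z.2) ->
  measurable ([set c | forward_ac p d c] : set (borel (curve R X))).
Proof.
move=> dm lscD.
rewrite (_ : [set c | _] = setT `&` [set c : borel (curve R X) | esups (fun n => dyadic_energy d n c) 0%N < +oo]); last first.
  by rewrite setTI; apply/seteqP; split => c /=; rewrite forward_ac_energy.
apply: emeasurable_fun_infty_o => //.
apply: (@measurable_fun_esups _ (borel (curve R X)) R setT (fun n c => dyadic_energy d n c)) => n.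
apply: emeasurable_sum => j; apply: measurable_funeM.
apply: (measurableT_comp (measurable_poweR p)); apply: measurable_funeM.
apply: lower_semicontinuous_borel; apply/lower_semicontinuousP => a.
have /lower_semicontinuousP/(_ a) oA := lscD.
have cf : continuous (fun c : curve R X => (ev (dyadic_point n j) c, ev (dyadic_point n j.+1) c)).
  by move=> c; exact: (cvg_pair (@ev_continuous R X (dyadic_point n j) c) (@ev_continuous R X (dyadic_point n j.+1) c)).
by move/continuousP: cf => /(_ _ oA).
Qed.

(** Backward absolute continuity is the forward one for the reversed distance, which is lower
    semicontinuous by exchanging coordinates. *)
Lemma measurable_ac d : asymmetric_extended_metric d ->
  lower_semicontinuous (fun z : X * X => d z.1 z.2) ->
  measurable (ac p d : set (borel (curve R X))).
Proof.
move=> dm lscD; apply: (@measurableI _ (borel (curve R X)) [set c | forward_ac p d c] [set c | backward_ac p d c]).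
  exact: measurable_forward_ac.
pose d' x y := d y x.
have dm' : asymmetric_extended_metric d'.
  split => [x y|x y|x y z]; first exact: aem_ge0 dm _ _.
    by split => [/(aem_eq0 dm)|->]; [exact: esym|exact/(aem_eq0 dm)].
  by rewrite /d' addeC; exact: aem_triangle dm _ _ _.
apply: (@measurable_forward_ac d') => //; apply/lower_semicontinuousP => a.
have /lower_semicontinuousP/(_ a) oA := lscD.
have /continuousP : continuous (fun z : X * X => (z.2, z.1)).
  by move=> z; apply: cvg_pair; [exact: cvg_snd|exact: cvg_fst].
by move=> /(_ _ oA).
Qed.

End dyadic_energy.

#[local] Arguments ev : simpl never.
#[local] Arguments stop : simpl never.

HB.instance Definition _ (R : realType) (X : ptopologicalType) (a b : R) :=
  isMeasurableFun.Build _ _ _ _ (stop a b : borel (curve R X) -> borel (curve R X))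
    (measurable_stop a b).

HB.instance Definition _ (R : realType) (X : ptopologicalType) (s : R) :=
  isMeasurableFun.Build _ _ _ _ (ev s : borel (curve R X) -> borel X) (measurable_ev s).

(** * Stopped curves and test plans *)

Section stopped_curves.
Context {R : realType} {X : ptopologicalType} (d : X -> X -> \bar R) (p a b : R).
Hypothesis dm : asymmetric_extended_metric d.
Hypothesis lscD : lower_semicontinuous (fun z : X * X => d z.1 z.2).
Hypothesis p1 : (1 < p)%R.
Hypothesis a0 : (0 <= a)%R.
Hypothesis ab : (a <= b)%R.
Hypothesis b1 : (b <= 1)%R.
Local Notation mu := (@lebesgue_measure R).
Implicit Types (c : curve R X).

Let d0 x : d x x = 0. Proof. exact: (iffRL (aem_eq0 dm _ _)). Qed.

Let clamp01 t : (0 <= clamp a b t <= 1)%R.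
Proof. by have /andP[h1 h2] := clamp_itv t ab; rewrite (le_trans a0 h1) (le_trans h2 b1). Qed.

(** If [s,t] meets [a,b], clamping shrinks it and the same density works; otherwise both times clamp
    to one point and the distance is 0. A general [D] covers both directions of the metric. *)
Let stop_le (D : X -> X -> \bar R) c (g : R -> R) : (forall x, D x x = 0) -> nonneg_Lp p g ->
  (forall s t : R, (0 <= s)%R -> (s <= t)%R -> (t <= 1)%R ->
     D (ev s c) (ev t c) <= \int[mu]_(r in `[s, t]) (g r)%:E) ->
  forall s t : R, (0 <= s)%R -> (s <= t)%R -> (t <= 1)%R ->
     D (ev s (stop a b c)) (ev t (stop a b c)) <= \int[mu]_(r in `[s, t]) (g r)%:E.
Proof.
move=> D0 [mg g0 _] H s t s0 st t1.
have sub : `[s, t] `<=` (`[0%R, 1%R]%classic : set R).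
  by move=> x /=; rewrite !in_itv /= => /andP[h1 h2]; rewrite (le_trans s0)//= (le_trans h2).
have I0 : 0 <= \int[mu]_(r in `[s, t]) (g r)%:E.
  by apply: integral_ge0 => x xst; rewrite lee_fin; apply: g0; have := sub x xst.
rewrite !ev_stop ?s0 ?t1 ?(le_trans s0 st) ?(le_trans st t1)//.
have [sb|/ltW bs] := leP s b; last first.
  by rewrite !clamp_upper ?D0// (le_trans bs).
have [at_|/ltW ta] := leP a t; last first.
  by rewrite !clamp_lower ?D0// (le_trans st).
have /andP[h1 _] := clamp01 s; have /andP[_ h2] := clamp01 t.
apply: le_trans (H _ _ h1 (clamp_le a b st) h2) _.
apply: ge0_subset_integral; [exact: measurable_itv|exact: measurable_itv| | |].
- apply/measurable_EFinP; exact: measurable_funS mg.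
- by move=> x xst; rewrite lee_fin; apply: g0; have := sub x xst.
- move=> x /=; rewrite !in_itv /= => /andP[h3 h4].
  by rewrite (le_trans _ h3) ?clamp_ge//= (le_trans h4)// clamp_le_id.
Qed.

Lemma ac_stop c : ac p d c -> ac p d (stop a b c).
Proof.
move=> [[gf Lgf cgf] [gb Lgb cgb]]; split.
  by exists gf => //; exact: stop_le.
by exists gb => //; apply: (stop_le (D := fun x y => d y x)).
Qed.

Let near_speed (f g : R -> \bar R) : (\forall h \near 0%R^'+, f h = g h) ->
  lim (f h @[h --> 0%R^'+]) = lim (g h @[h --> 0%R^'+]).
Proof.
move=> E; congr (lim_in _ _); apply/funext => A; apply/propext; split => H.
  by apply: filterS2 E H => h /= ->.
by apply: filterS2 E H => h /= ->.
Qed.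

(** The speed is a right derivative, whence the half-open interval: at [a] the stopped curve already
    moves as [c], at [b] it rests. *)
Lemma forward_speed_stop_in c t : (a <= t < b)%R ->
  forward_speed d (stop a b c) t = forward_speed d c t.
Proof.
move=> /andP[at_ tb]; rewrite /forward_speed; apply: near_speed; near=> h.
have h0 : (0 < h)%R by near: h; exact: nbhs_right_gt.
have h1 : (h < b - t)%R by near: h; apply: nbhs_right_lt; lra.
have t0 : (0 <= t)%R := le_trans a0 at_.
have th : (t + h <= b)%R by lra.
rewrite !ev_stop ?t0 ?addr_ge0 ?(ltW h0) ?(le_trans (ltW tb)) ?(le_trans th)//.
by rewrite !clamp_id// ?at_ ?(ltW tb)// th andbT; lra.
Unshelve. all: by end_near. Qed.

Lemma forward_speed_stop_out c t : (0 <= t < 1)%R -> ~ (a <= t < b)%R ->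
  forward_speed d (stop a b c) t = 0.
Proof.
move=> /andP[t0 t1] tab.
have -> : 0 = lim ((cst 0 : R -> \bar R) h @[h --> 0%R^'+]).
  by apply/esym/cvg_lim => //; exact: cvg_cst.
rewrite /forward_speed; have [ta|at_] := ltP t a.
  apply: near_speed; near=> h.
  have h0 : (0 < h)%R by near: h; exact: nbhs_right_gt.
  have h1 : (h < 1 - t)%R by near: h; apply: nbhs_right_lt; rewrite subr_gt0.
  have ha : (h < a - t)%R by near: h; apply: nbhs_right_lt; rewrite subr_gt0.
  have th : (t + h <= 1)%R by lra.
  rewrite !ev_stop ?t0 ?addr_ge0 ?(ltW h0) ?(ltW t1)//=.
  by rewrite !clamp_lower ?d0 ?mul0e//; lra.
have bt : (b <= t)%R by rewrite leNgt; apply/negP => tb; apply: tab; rewrite at_ tb.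
apply: near_speed; near=> h.
have h0 : (0 < h)%R by near: h; exact: nbhs_right_gt.
have h1 : (h < 1 - t)%R by near: h; apply: nbhs_right_lt; rewrite subr_gt0.
have th : (t + h <= 1)%R by lra.
rewrite !ev_stop ?t0 ?addr_ge0 ?(ltW h0) ?(ltW t1)//=.
by rewrite !clamp_upper ?d0 ?mul0e//; lra.
Unshelve. all: by end_near. Qed.

Lemma measurable_path c : measurable_fun (`[0%R, 1%R[%classic : set R)
  ((fun s => ev s c) : measurableTypeR R -> borel X).
Proof.
apply: (@eq_measurable_fun _ _ (measurableTypeR R) (borel X) _ (fun s => c (to_unit s))).
  by move=> s; rewrite inE /= in_itv /= => /andP[s0 s1]; rewrite ev_to_unit// s0 ltW.
apply: (@measurability _ _ (measurableTypeR R) (borel X) _ _ (@open X)) => // _ [U oU <-].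
apply: measurableI; first exact: measurable_itv.
by apply: open_measurable; have /continuousP := @path_continuous R X c; exact.
Qed.

Lemma measurable_integrand c (G : borel X -> \bar R) : ac p d c -> measurable_fun setT G ->
  measurable_fun (`[0%R, 1%R[%classic : set R) (fun s => G (ev s c) * forward_speed d c s).
Proof.
move=> acc mG; apply: emeasurable_funM; last exact: ac_measurable_forward_speed acc.
exact: measurableT_comp mG (measurable_path c).
Qed.

(** At time 1 the difference quotients evaluate the curve past its end; this single time is removed
    from the integral. *)
Lemma curve_integralE c (G : borel X -> \bar R) : ac p d c -> measurable_fun setT G ->
  curve_integral d G c = \int[mu]_(s in `[0%R, 1%R[) (G (ev s c) * forward_speed d c s).
Proof.
by move=> acc mG; rewrite /curve_integral integral_itv_bndo_bndc//; exact: measurable_integrand.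
Qed.

Lemma curve_integral_stop c (G : borel X -> \bar R) : ac p d c -> measurable_fun setT G ->
  curve_integral d G (stop a b c) = \int[mu]_(s in `[a, b[) (G (ev s c) * forward_speed d c s).
Proof.
move=> acc mG; rewrite (curve_integralE (ac_stop acc) mG).
rewrite integral_mkcond [RHS]integral_mkcond; apply: eq_integral => s _.
rewrite !patchE !mem_setE /=.
rewrite !in_itv /=; have [/andP[s0 s1]|s01] := boolP (0 <= s < 1)%R; last first.
  rewrite ifF//; apply/negbTE; apply: contra s01 => /andP[h1 h2].
  by rewrite (le_trans a0 h1) (lt_le_trans h2 b1).
case: ifPn => sab; last first.
  by rewrite (forward_speed_stop_out c (_ : 0 <= s < 1)%R)// ?s0 ?s1 ?mule0//; exact/negP.
rewrite (forward_speed_stop_in c sab) ev_stop ?s0 ?(ltW s1)// clamp_id//.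
by move/andP : sab => [-> /ltW].
Qed.

End stopped_curves.

Section stopped_plans.
Context {R : realType} {X : ptopologicalType} (d : X -> X -> \bar R)
  (m : {measure set (borel X) -> \bar R}) (V : X -> R) (p a b : R).
Hypothesis dm : asymmetric_extended_metric d.
Hypothesis lscD : lower_semicontinuous (fun z : X * X => d z.1 z.2).
Hypothesis p1 : (1 < p)%R.
Hypothesis a0 : (0 <= a)%R.
Hypothesis ab : (a <= b)%R.
Hypothesis b1 : (b <= 1)%R.

Let stop_plan (eta : probability (borel (curve R X)) R) : probability (borel (curve R X)) R :=
  distribution eta (stop a b : {RV eta >-> (borel (curve R X))}).

(** The law of the stopped curve at time t is the law of the curve at the clamped time, so absolute
    continuity and the compression constants carry over. *)
Lemma Tp_stop eta : Tp d m V p eta -> Tp d m V p (stop_plan eta).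
Proof.
have clamp01 t : (clamp a b t \in `[0%R, 1%R] :> bool).
  by have /andP[h1 h2] := clamp_itv t ab; rewrite in_itv /= (le_trans a0 h1) (le_trans h2 b1).
have evE t B : t \in `[0%R, 1%R] -> ev_pushforward (stop_plan eta) t B = ev_pushforward eta (clamp a b t) B.
  rewrite in_itv /= => t01; rewrite /ev_pushforward /stop_plan /distribution /pushforward; congr (eta _).
  by apply/seteqP; split => c; rewrite /preimage /= ev_stop.
move=> [[[N [mN N0 acN]] dom] bc]; split; first split.
(* A null set [N] containing the bad curves would not do, as its preimage under stopping could be
   larger. The preimage of the exact complement of [ac p d] stays inside that complement by
   [ac_stop]. *)
- exists (~` ac p d); split => //.
    by apply: measurableC; exact: (measurable_ac p1 dm lscD).
  change (eta (stop a b @^-1` (~` ac p d)) = 0).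
  apply/eqP; rewrite eq_le measure_ge0 andbT -N0; apply: le_measure; rewrite ?inE//.
    rewrite -[_ @^-1` _]setTI; apply: (measurable_stop a b) => //.
    by apply: measurableC; exact: (measurable_ac p1 dm lscD).
  by move=> c nac; apply: acN => acc; apply: nac; exact: ac_stop.
- move=> t t01 A mA0 B mB BA; rewrite evE//.
  exact: dom (clamp01 t) A mA0 B mB BA.
- move=> M M0; have [C C0 H] := bc M M0; exists C => // B t mB t01.
  by rewrite evE//; exact: H.
Qed.

Lemma Tp_ae_stop (P : curve R X -> Prop) : Tp_ae d m V p P -> Tp_ae d m V p (fun c => P (stop a b c)).
Proof.
move=> HP eta Teta; have [N [mN N0 PN]] := HP _ (Tp_stop Teta).
exists (stop a b @^-1` N); split.
- by rewrite -[_ @^-1` _]setTI; exact: (measurable_stop a b).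
- exact: N0.
- by move=> c nP; exact: PN.
Qed.

End stopped_plans.

Import HBNNSimple.

(** A nonnegative simple function below [f] vanishes off [S], so its level sets for nonzero values
    lie in [S] and the bound on measures applies to each of them. *)
Lemma ge0_integral_dominated {R : realType} d0 {T : measurableType d0}
    (nu m : {measure set T -> \bar R}) (S : set T) (C : R) (f : T -> \bar R) :
  (0 <= C)%R -> (forall B, measurable B -> nu (B `&` S) <= C%:E * m B) ->
  (forall x, 0 <= f x) -> (forall x, ~ S x -> f x = 0) -> measurable_fun setT f ->
  \int[nu]_x f x <= C%:E * \int[m]_x f x.
Proof.
move=> C0 H f0 fS mf.
have := @ge0_integral_mscale _ _ R m setT measurableT (NngNum C0) f mf (fun x _ => f0 x).
move=> /= <-; rewrite !ge0_integralTE//.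
apply: ge_ereal_sup => _ [h hf <-]; apply: le_ereal_sup_tmp.
exists (sintegral (mscale (NngNum C0) m) h); first by exists h.
rewrite !sintegralE lee_fsum// => r [t _ <-].
have [->|r0] := eqVneq (h t) 0%R; first by rewrite !mul0e.
rewrite lee_wpmul2l ?lee_fin//.
have mh : measurable (h @^-1` [set h t]) by exact: measurable_sfunP.
have hS : h @^-1` [set h t] `&` S = h @^-1` [set h t].
  apply/setIidPl => x /= hx; apply: contrapT => /fS fx0.
  move: (hf x); rewrite fx0 hx lee_fin => r_le0; move/eqP: r0; apply; apply/eqP.
  by rewrite eq_le r_le0 /=.
by have := H _ mh; rewrite hS.
Qed.

(** * Integration along almost every curve of a test plan *)

Section along_curves.
Context {R : realType} {X : ptopologicalType} (d : X -> X -> \bar R)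
  (m : {measure set (borel X) -> \bar R}) (V : X -> R) (p : R)
  (eta : probability (borel (curve R X)) R).
Hypothesis polishX : polish R X.
Hypothesis Teta : Tp d m V p eta.
Local Notation mu := (@lebesgue_measure R).
Local Notation D := (`[0%R, 1%R[%classic : set (measurableTypeR R)).

Let along (G : borel X -> \bar R) (z : measurableTypeR R * borel (curve R X)) : \bar R :=
  ((fun z => G (ev z.1 z.2)) \_ (D `*` setT)) z.

Let mD : measurable (D `*` [set: borel (curve R X)]).
Proof. by apply: measurableX => //; exact: measurable_itv. Qed.

Let measurable_along G : measurable_fun setT G -> measurable_fun setT (along G).
Proof.
move=> mG; apply/(measurable_restrictT _ mD).
have [_ [rho ccm]] := polishX.
exact: measurableT_comp mG (measurable_ev_joint ccm).
Qed.

Let along_ge0 G z : (forall x, 0 <= G x) -> 0 <= along G z.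
Proof. by move=> G0; rewrite /along patchE; case: ifP. Qed.

Let alongE G c : \int[mu]_s along G (s, c) = \int[mu]_(s in `[0%R, 1%R[) G (ev s c).
Proof.
rewrite [RHS]integral_mkcond; apply: eq_integral => s _; rewrite /along !patchE.
by congr (if _ then _ else _); apply/idP/idP; rewrite !inE /=; tauto.
Qed.

Lemma tonelli_along_curves (G : borel X -> \bar R) : measurable_fun setT G -> (forall x, 0 <= G x) ->
  [/\ measurable_fun setT (fun c : borel (curve R X) => \int[mu]_(s in `[0%R, 1%R[) G (ev s c)),
      measurable_fun D (fun s => \int[eta]_c G (ev s c)) &
  \int[eta]_c \int[mu]_(s in `[0%R, 1%R[) G (ev s c) =
  \int[mu]_(s in `[0%R, 1%R[) \int[eta]_c G (ev s c)].
Proof.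
move=> mG G0; have mF := measurable_along mG; have F0 z := along_ge0 z G0.
have E : (fun c : borel (curve R X) => \int[mu]_(s in `[0%R, 1%R[) G (ev s c)) = fubini_G mu (along G).
  by apply/funext => c; rewrite /fubini_G alongE.
split; first by rewrite E; exact: (measurable_fun_fubini_tonelli_G (m1 := mu)).
  apply: (eq_measurable_fun (fubini_F eta (along G))).
    move=> s sD; apply: eq_integral => c _; rewrite /along patchE ifT// inE; split => //; exact: set_mem.
  apply: measurable_funTS; exact: (measurable_fun_fubini_tonelli_F (m2 := eta)).
rewrite (_ : \int[eta]_c _ = \int[eta]_c fubini_G mu (along G) c); last by rewrite E.
rewrite -(@fubini_tonelli _ _ _ _ _ mu eta (along G) mF F0) [RHS]integral_mkcond.
apply: eq_integral => s _; rewrite patchE; case: ifPn => sD.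
  apply: eq_integral => c _; rewrite /along patchE ifT// inE; split => //; exact: set_mem.
rewrite integral0_eq// => c _; rewrite /along patchE ifF//; apply/negP => /set_mem[sD' _].
by move/negP: sD; apply; rewrite inE.
Qed.

(** Tonelli's theorem for the indicator of a null set: every time marginal of the plan charges it
    with mass 0, so almost every curve spends zero time in it. *)
Lemma ae_along_curves (P : X -> Prop) : {ae m, forall x, P x} ->
  {ae eta, forall c, {ae mu, forall s, (0 <= s < 1)%R -> P (ev s c)}}.
Proof.
move=> [N [mN N0 PN]].
pose G (x : borel X) : \bar R := (\1_N x)%:E.
have mG : measurable_fun setT G by apply/measurable_EFinP; exact: measurable_indic.
have G0 x : 0 <= G x by rewrite lee_fin.
have [mI _ EI] := tonelli_along_curves mG G0.
have I0 c : 0 <= \int[mu]_(s in `[0%R, 1%R[) G (ev s c) by exact: integral_ge0.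
have : \int[eta]_c `|\int[mu]_(s in `[0%R, 1%R[) G (ev s c)| = 0.
  under eq_integral do rewrite gee0_abs//.
  rewrite EI; apply: integral0_eq => s; rewrite /= in_itv /= => /andP[s0 s1].
  have [[_ dom] _] := Teta.
  have s01 : s \in `[0%R, 1%R] by rewrite in_itv /= s0 ltW.
  have mNs : measurable (ev s @^-1` N : set (borel (curve R X))).
    by rewrite -[_ @^-1` _]setTI; exact: measurable_ev.
  rewrite (_ : (fun c => _) = (fun c : borel (curve R X) => (\1_(ev s @^-1` N) c)%:E)).
    rewrite integral_indic// setIT.
    apply: (dom s s01 N _ N mN (@subset_refl _ _)).
    move=> A mA AN; apply/eqP; rewrite eq_le measure_ge0 andbT -N0; apply: le_measure; rewrite ?inE//.
  by apply/funext => c; rewrite /G !indicE; congr (_%:R%:E); apply/idP/idP; rewrite !inE.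
move=> /(ae_eq_integral_abs eta measurableT mI); apply: filterS => c /(_ I) /= Ic.
have mGc : measurable_fun (`[0%R, 1%R[%classic : set R) (fun s => G (ev s c)).
  exact: measurableT_comp mG (measurable_path c).
have : \int[mu]_(s in `[0%R, 1%R[) `|G (ev s c)| = 0.
  by rewrite -Ic; apply: eq_integral => s _; rewrite gee0_abs.
move=> /(ae_eq_integral_abs mu (measurable_itv _) mGc); apply: filterS => s H s01.
apply: contrapT => /PN Ns; have := H _; rewrite /= in_itv /= => /(_ s01).
by rewrite /G indicE mem_set// => -[]/eqP; rewrite oner_eq0.
Qed.

Lemma ae_ev (t : R) (P : X -> Prop) : (0 <= t <= 1)%R -> {ae m, forall x, P x} ->
  {ae eta, forall c, P (ev t c)}.
Proof.
move=> t01 [N [mN N0 PN]]; have [[_ dom] _] := Teta.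
exists (ev t @^-1` N); split.
- by rewrite -[_ @^-1` _]setTI; exact: measurable_ev.
- have t01' : t \in `[0%R, 1%R] by rewrite in_itv.
  apply: (dom t t01' N _ N mN (@subset_refl _ _)) => A mA AN.
  by apply/eqP; rewrite eq_le measure_ge0 andbT -N0; apply: le_measure; rewrite ?inE.
- by move=> c nP; exact: PN.
Qed.

(** Bounded compression controls the time marginals only where [V <= M], so L^q is truncated to that
    set and Tonelli's theorem gives a finite integral along almost every curve, for all integers M
    at once. On a given curve [V] is bounded, so for large M the truncation has no effect. *)
Lemma Lq_along_curves (q : R) (L : X -> R) : assumption_A1 d m V ->
  measurable_fun setT (L : borel X -> R) -> (forall x, (0 <= L x)%R) ->
  \int[m]_x (L x `^ q)%:E < +oo ->
  {ae eta, forall c, \int[mu]_(s in `[0%R, 1%R[) (L (ev s c) `^ q)%:E < +oo}.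
Proof.
move=> A1 mL L0 iL.
have mLq : measurable_fun setT (fun x : borel X => (L x `^ q)%:E) by exact: measurable_powR_EFin.
pose S (M : nat) : set (borel X) := [set x | (V x <= M%:R)%R].
have mS M : measurable (S M).
  have := A1_borel A1; rewrite -[S M]setTI => mV.
  have -> : S M = V @^-1` `]-oo, M%:R] by apply/seteqP; split => x; rewrite /S /= in_itv.
  exact: mV.
pose G (M : nat) (x : borel X) := (L x `^ q)%:E * (\1_(S M) x)%:E.
have mG M : measurable_fun setT (G M).
  apply: emeasurable_funM => //; apply/measurable_EFinP; exact: measurable_indic.
have G0 M x : 0 <= G M x by rewrite mule_ge0// lee_fin powR_ge0.
have Gle M x : G M x <= (L x `^ q)%:E.
  rewrite /G indicE; case: (_ \in _); first by rewrite mule1.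
  by rewrite mule0 lee_fin powR_ge0.
have : {ae eta, forall c, forall M, \int[mu]_(s in `[0%R, 1%R[) G M (ev s c) < +oo}.
  apply: ae_foralln => M.
  have [mI mI' EI] := tonelli_along_curves (mG M) (G0 M).
  have I0 c : 0 <= \int[mu]_(s in `[0%R, 1%R[) G M (ev s c) by exact: integral_ge0.
  have ig : eta.-integrable setT (fun c : borel (curve R X) => \int[mu]_(s in `[0%R, 1%R[) G M (ev s c)).
    apply/integrableP; split => //; under eq_integral do rewrite gee0_abs//.
    rewrite EI; have [_ bc] := Teta; have [C C0 HC] := bc M%:R (ler0n _ _).
    have le s : (0 <= s < 1)%R -> \int[eta]_c G M (ev s c) <= C%:E * \int[m]_x (L x `^ q)%:E.
      move=> /andP[s0 s1]; have s01 : s \in `[0%R, 1%R] by rewrite in_itv /= s0 ltW.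
      have := @ge0_integral_distribution _ _ _ _ _ eta (ev s : {RV eta >-> (borel X)}) (G M) (mG M) (G0 M).
      rewrite /= => <-.
      apply: (@le_trans _ _ (C%:E * \int[m]_x G M x)).
        apply: (@ge0_integral_dominated _ _ _ (distribution eta (ev s : {RV eta >-> (borel X)})) m (S M)) => //.
          by move=> B mB; exact: HC.
        by move=> x nS; rewrite /G indicE memNset// mule0.
      by rewrite lee_wpmul2l ?lee_fin//; apply: ge0_le_integral.
    apply: (@le_lt_trans _ _ (\int[mu]_(s in `[0%R, 1%R[) (C%:E * \int[m]_x (L x `^ q)%:E))).
      apply: ge0_le_integral => //.
      by move=> s _; apply: integral_ge0.
    rewrite (integral_cst mu (measurable_itv _) (C%:E * \int[m]_x (L x `^ q)%:E)).
    have mu1 : mu D = 1 by rewrite lebesgue_measure_itv /= lte_fin ltr01 oppr0 adde0.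
    have Lfin : C%:E * \int[m]_x (L x `^ q)%:E < +oo by rewrite lte_mul_pinfty.
    have L_ge0 : 0 <= C%:E * \int[m]_x (L x `^ q)%:E.
      by rewrite mule_ge0 ?lee_fin//; apply: integral_ge0 => x _; rewrite lee_fin powR_ge0.
    by apply: lte_mul_pinfty => //; [rewrite ge0_fin_numE|rewrite [X in X < _]mu1 ltry].
  have := integrable_ae measurableT ig; apply: filterS => c /(_ I).
  by rewrite ge0_fin_numE.
apply: (@filterS _ _ (ae_filter_ringOfSetsType eta)) => c Hc.
have [M0 HM0] := A1_bounded A1 (@curve_compact_image R X c).
pose M := (Num.truncn M0).+1.
have E s : (0 <= s < 1)%R -> G M (ev s c) = (L (ev s c) `^ q)%:E.
  move=> /andP[s0 s1]; rewrite /G indicE mem_set ?mule1// /S /=.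
  apply: le_trans (HM0 _ _) _; first by exists s => //=; rewrite in_itv /= s0 ltW.
  exact: ltW (truncnS_gt _).
have := Hc M.
rewrite (_ : \int[mu]_(s in _) _ = \int[mu]_(s in `[0%R, 1%R[) (L (ev s c) `^ q)%:E)//.
by apply: eq_integral => s; rewrite inE /= in_itv /=; exact: E.
Qed.

End along_curves.

(** Stated for arbitrary functions so as to cover gradients measurable only for the completion of
    [m]: cutting a simple function below [f] to zero on the exceptional null set puts it below [g]
    and keeps its integral. *)
Lemma ge0_ae_le_integral {R : realType} d0 {T : measurableType d0} (mu : {measure set T -> \bar R})
    (D : set T) (f g : T -> \bar R) :
  (forall x, D x -> 0 <= f x) -> (forall x, D x -> 0 <= g x) ->
  {ae mu, forall x, D x -> f x <= g x} -> \int[mu]_(x in D) f x <= \int[mu]_(x in D) g x.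
Proof.
move=> f0 g0 [N [mN N0 fgN]]; rewrite integral_mkcond [leRHS]integral_mkcond.
have gD0 x : 0 <= (g \_ D) x by rewrite patchE; case: ifPn => // /set_mem; exact: g0.
have fD0 x : 0 <= (f \_ D) x by rewrite patchE; case: ifPn => // /set_mem; exact: f0.
rewrite !ge0_integralTE//; apply: ge_ereal_sup => _ [h hf <-].
apply: le_ereal_sup_tmp; exists (sintegral mu (proj_nnsfun h (measurableC mN))).
  exists (proj_nnsfun h (measurableC mN)) => // x; rewrite /= /mindic indicE.
  have [Nx|nNx] := boolP (x \in ~` N); last by rewrite mulr0.
  rewrite mulr1 (le_trans (hf x))// !patchE; case: ifPn => // /set_mem Dx.
  by move/set_mem : Nx => Nx; apply: contrapT => H; apply: Nx; apply: fgN => K; apply: H; exact: K.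
have E (k : {nnsfun T >-> R}) : sintegral mu k = \int[mu]_x (k x)%:E.
  by rewrite integral_nnsfun// patch_setT.
rewrite !E; apply: ae_ge0_le_integral => //.
1,3: by move=> x _; rewrite lee_fin.
1,2: exact/measurable_EFinP.
exists N; split => // x /not_implyP[_ hx]; apply: contrapT => nNx; apply: hx.
rewrite lee_fin /= /mindic indicE mem_set//.
by rewrite mulr1.
Qed.

(** Each rational superlevel set of [G] is a Borel set [A k] up to a negligible set. The supremum of
    the rational levels over the [A k] containing x is Borel, never exceeds [G], and equals it off
    the countable union of these negligible sets. *)
Lemma m_measurable_borel {R : realType} {X : ptopologicalType} (m : {measure set (borel X) -> \bar R})
    (G : X -> \bar R) : m_measurable m G -> (forall x, 0 <= G x) ->
  exists H : borel X -> \bar R, [/\ measurable_fun setT H, forall x, 0 <= H x,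
    forall x, H x <= G x & {ae m, forall x, H x = G x}].
Proof.
move=> mG G0.
have /choice[A HA] (k : nat) : exists A : set (borel X), measurable A /\
    exists2 N, m.-negligible N & [set x | (rat_seq k : R)%:E <= G x] = A `|` N.
  have [A mA [N N0 E]] := mG `[(rat_seq k)%:E, +oo]%classic (emeasurable_itv _).
  exists A; split => //; exists N => //; rewrite E; apply/seteqP; split => x /=.
    by rewrite in_itv /= leey andbT.
  by rewrite in_itv /= leey andbT.
pose h k x : \bar R := if x \in A k then maxe 0 (rat_seq k)%:E else 0.
have hG k x : h k x <= G x.
  rewrite /h; case: ifPn => // /set_mem Ax; rewrite ge_max G0/=.
  have [_ [N _ E]] := HA k.
  have : (A k `|` N) x by left.
  by rewrite -E.
exists (fun x => esups (h^~ x) 0%N); split.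
- apply: measurable_fun_esups => k; apply: measurable_fun_ifT => //.
  by apply: measurable_fun_bool; rewrite setTI (_ : _ @^-1` _ = A k); [case: (HA k)|apply/seteqP; split => x /=; [exact: set_mem|exact: mem_set]].
- move=> x; apply: le_trans (ereal_sup_ubound _); last by exists 0%N.
  by rewrite /h; case: ifPn => // _; rewrite le_max lexx.
- by move=> x; apply: ge_ereal_sup => _ [k _ <-]; exact: hG.
- have : {ae m, forall x, forall k, (rat_seq k : R)%:E <= G x -> A k x}.
    apply: ae_foralln => k; have [_ [N N0 E]] := HA k.
    apply: negligibleS N0 => x /= /not_implyP[Gx nA].
    have : (A k `|` N) x by rewrite -E.
    by case.
  apply: (@filterS _ _ (ae_filter_ringOfSetsType m)) => x Hx; apply/eqP; rewrite eq_le; apply/andP; split.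
    by apply: ge_ereal_sup => _ [k _ <-]; exact: hG.
  rewrite leNgt; apply/negP => lt.
  have [z /andP[lz zG]] := ereal_dense lt; have [z' /andP[zz' z'G]] := ereal_dense zG.
  have zfin : z \is a fin_num.
    by rewrite fin_real//; apply/andP; split; [exact: le_lt_trans (leNye _) lz|exact: lt_le_trans zG (leey _)].
  have z'fin : z' \is a fin_num.
    by rewrite fin_real//; apply/andP; split; [exact: le_lt_trans (leNye _) zz'|exact: lt_le_trans z'G (leey _)].
  have [k /andP[zk kz]] : exists k, (fine z < rat_seq k < fine z')%R.
    by apply: rat_seq_dense; rewrite -lte_fin !fineK.
  have kG : (rat_seq k)%:E <= G x by rewrite (le_trans _ (ltW z'G))// -[z']fineK// lee_fin ltW.
  have : h k x <= esups (h^~ x) 0%N by apply: ereal_sup_ubound; exists k.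
  rewrite /h mem_set; last exact: Hx kG.
  rewrite leNgt => /negP; apply; apply: lt_le_trans lz _.
  by rewrite le_max -(fineK zfin) !lee_fin (ltW zk) orbT.
Qed.

#[local] Instance measure_ae_filter (R : realType) d0 (T : measurableType d0)
  (mu : {measure set T -> \bar R}) : Filter (nbhs (almost_everywhere mu)).
Proof. exact: ae_filter_ringOfSetsType. Qed.

#[local] Instance plan_ae_filter (R : realType) (X : ptopologicalType)
  (eta : probability (borel (curve R X)) R) : Filter (nbhs (almost_everywhere eta)).
Proof. exact: ae_filter_ringOfSetsType. Qed.

(** * Weak upper gradients *)

Section borel_gradients.
Context {R : realType} {X : ptopologicalType} (d : X -> X -> \bar R)
  (m : {measure set (borel X) -> \bar R}) (V : X -> R) (p q : R).
Hypothesis polishX : polish R X.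
Hypothesis dm : asymmetric_extended_metric d.
Hypothesis lscD : lower_semicontinuous (fun z : X * X => d z.1 z.2).
Hypothesis A1 : assumption_A1 d m V.
Hypothesis p1 : (1 < p)%R.
Hypothesis pq : (p^-1 + q^-1 = 1)%R.
Local Notation mu := (@lebesgue_measure R).
Implicit Types (u v : X -> R) (G H : borel X -> \bar R) (c : curve R X)
  (eta : probability (borel (curve R X)) R).

Lemma conjugate_gt1 : (1 < q)%R.
Proof.
have p0 : (0 < p)%R by exact: lt_trans p1.
have qE : (q^-1 = 1 - p^-1)%R by rewrite -pq addrC addKr.
have q0 : (0 < q)%R by rewrite -invr_gt0 qE subr_gt0 invf_lt1.
by rewrite -invf_lt1// qE gtrDl oppr_lt0 invr_gt0.
Qed.

(** A real-valued [u] avoids differences of infinities at the endpoints, and a Borel [G] makes the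
    integrand along a curve measurable. *)
Definition borel_gradient u G : Prop :=
  [/\ measurable_fun setT G, forall x, 0 <= G x &
      Tp_ae d m V p (fun c =>
        (u (ev 1%R c) - u (ev 0%R c))%:E <= curve_integral d G c < +oo)].

Lemma curve_integral_ae_le (G H : X -> \bar R) c : (forall x, 0 <= G x) -> (forall x, 0 <= H x) ->
  {ae mu, forall s, (0 <= s < 1)%R -> G (ev s c) <= H (ev s c)} ->
  curve_integral d G c <= curve_integral d H c.
Proof.
move=> G0 H0 GH; apply: ge0_ae_le_integral.
- by move=> s _; rewrite mule_ge0//; exact: forward_speed_ge0.
- by move=> s _; rewrite mule_ge0//; exact: forward_speed_ge0.
have ne1 : {ae mu, forall s, s != 1%R}.
  exists [set 1%R]; split => //; first exact: lebesgue_measure_set1.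
  by move=> s /= /negP; rewrite negbK => /eqP.
apply: filterS2 GH ne1 => s GH s1; rewrite /= in_itv /= => /andP[s0 s_le1].
by rewrite lee_wpmul2r ?forward_speed_ge0// GH// s0 lt_neqAle s1.
Qed.

Lemma Tp_ae_curve_integral_eq (G H : X -> \bar R) : (forall x, 0 <= G x) -> (forall x, 0 <= H x) ->
  {ae m, forall x, G x = H x} ->
  Tp_ae d m V p (fun c => curve_integral d G c = curve_integral d H c).
Proof.
move=> G0 H0 GH eta Teta; have := ae_along_curves polishX Teta GH.
apply: filterS => c E; apply/eqP; rewrite eq_le; apply/andP; split; apply: curve_integral_ae_le => //.
  by apply: filterS E => s /[apply] ->.
by apply: filterS E => s /[apply] ->.
Qed.

Lemma Tp_ae_endpoints (P : X -> Prop) : {ae m, forall x, P x} ->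
  Tp_ae d m V p (fun c => P (ev 0%R c) /\ P (ev 1%R c)).
Proof.
move=> mP eta Teta.
have P0 := ae_ev Teta (_ : 0 <= 0%R <= 1)%R mP; have P1 := ae_ev Teta (_ : 0 <= 1%R <= 1)%R mP.
by apply: filterS2 (P0 _) (P1 _) => //; rewrite ?lexx ?ler01.
Qed.

Lemma borel_gradient_wfug (f : X -> \bar R) u G : {ae m, forall x, f x = (u x)%:E} ->
  borel_gradient u G -> weak_forward_upper_gradient d m V p f G.
Proof.
move=> fu [mG G0 ineqG]; split => //.
  move=> Y mY; exists (G @^-1` Y); first by rewrite -[_ @^-1` _]setTI; exact: mG.
  by exists set0; [exact: negligible_set0|rewrite setU0].
move=> eta Teta; apply: filterS2 (ineqG _ Teta) (Tp_ae_endpoints fu Teta) => c + [-> ->].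
by rewrite -EFinB.
Qed.

Lemma wfug_borel_gradient (f : X -> \bar R) u (G : X -> \bar R) : {ae m, forall x, f x = (u x)%:E} ->
  weak_forward_upper_gradient d m V p f G ->
  exists H, [/\ borel_gradient u H, forall x, H x <= G x & {ae m, forall x, H x = G x}].
Proof.
move=> fu [G0 mG ineqG]; have [H [mH H0 HG HGae]] := m_measurable_borel mG G0.
exists H; split => //; split => // eta Teta.
have E := Tp_ae_curve_integral_eq H0 G0 HGae Teta.
by apply: filterS3 (ineqG _ Teta) (Tp_ae_endpoints fu Teta) E => c + [f0 f1] ->; rewrite f0 f1 -EFinB.
Qed.

Lemma borel_gradient_ae u v G H : {ae m, forall x, u x = v x} -> {ae m, forall x, G x = H x} ->
  measurable_fun setT H -> (forall x, 0 <= H x) -> borel_gradient u G -> borel_gradient v H.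
Proof.
move=> uv GH mH H0 [mG G0 ineqG]; split => // eta Teta.
have E := Tp_ae_curve_integral_eq G0 H0 GH Teta.
by apply: filterS3 (ineqG _ Teta) (Tp_ae_endpoints uv Teta) E => c + [u0 u1] <-; rewrite u0 u1.
Qed.

Lemma borel_gradient_conic u v G H (a b : R) : (0 <= a)%R -> (0 <= b)%R ->
  borel_gradient u G -> borel_gradient v H ->
  borel_gradient (fun x => a * u x + b * v x)%R (fun x => a%:E * G x + b%:E * H x).
Proof.
move=> a0 b0 [mG G0 iG] [mH H0 iH]; split.
- by apply: emeasurable_funD; exact: measurable_funeM.
- by move=> x; rewrite adde_ge0// mule_ge0.
move=> eta Teta; have [[acN _] _] := Teta.
apply: filterS3 acN (iG _ Teta) (iH _ Teta) => c acc /andP[iGc fGc] /andP[iHc fHc].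
have E : curve_integral d (fun x => a%:E * G x + b%:E * H x) c =
    a%:E * curve_integral d G c + b%:E * curve_integral d H c.
  rewrite !(curve_integralE dm lscD p1 acc)//; last first.
    by apply: emeasurable_funD; exact: measurable_funeM.
  have mi (K : borel X -> \bar R) : measurable_fun setT K -> (forall x, 0 <= K x) ->
      measurable_fun (`[0%R, 1%R[%classic : set R) (fun s => K (ev s c) * forward_speed d c s).
    by move=> mK K0; exact: (measurable_integrand dm lscD p1 acc mK).
  have K0 (K : borel X -> \bar R) s : (forall x, 0 <= K x) -> 0 <= K (ev s c) * forward_speed d c s.
    by move=> K0; rewrite mule_ge0//; exact: forward_speed_ge0.
  have -> : \int[mu]_(s in `[0%R, 1%R[) ((a%:E * G (ev s c) + b%:E * H (ev s c)) * forward_speed d c s) =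
    \int[mu]_(s in `[0%R, 1%R[) (a%:E * (G (ev s c) * forward_speed d c s) + b%:E * (H (ev s c) * forward_speed d c s)).
    by apply: eq_integral => s _; rewrite ge0_muleDl ?mule_ge0 ?muleA.
  rewrite ge0_integralD//.
  - by rewrite !ge0_integralZl_EFin//; [move=> s _; exact: K0|exact: mi|move=> s _; exact: K0|exact: mi].
  - by move=> s _; rewrite mule_ge0 ?K0.
  - by apply: measurable_funeM; exact: mi.
  - by move=> s _; rewrite mule_ge0 ?K0.
  - by apply: measurable_funeM; exact: mi.
rewrite E lte_add_pinfty ?lte_mul_pinfty// andbT.
apply: le_trans (leeD (lee_wpmul2l (_ : 0 <= a%:E) iGc) (lee_wpmul2l (_ : 0 <= b%:E) iHc)); last 2 first.
- by rewrite lee_fin.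
- by rewrite lee_fin.
by rewrite -!EFinM -EFinD lee_fin; lra.
Qed.

(** The gradient inequality for the stopped curve, which almost every curve inherits because stopped
    plans are again in the class. *)
Lemma borel_gradient_subinterval u G (a b : R) : (0 <= a)%R -> (a <= b)%R -> (b <= 1)%R ->
  borel_gradient u G -> Tp_ae d m V p (fun c =>
    (u (ev b c) - u (ev a c))%:E <= \int[mu]_(s in `[a, b[) (G (ev s c) * forward_speed d c s)).
Proof.
move=> a0 ab b1 [mG G0 iG] eta Teta; have [[acN _] _] := Teta.
apply: filterS2 acN (Tp_ae_stop dm lscD p1 a0 ab b1 iG Teta) => c acc /andP[+ _].
have e1 : ev 1%R (stop a b c) = ev b c by rewrite ev_stop ?clamp_upper// ler01 lexx.
have e0 : ev 0%R (stop a b c) = ev a c by rewrite ev_stop ?clamp_lower// ler01 lexx.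
by rewrite e1 e0 (curve_integral_stop dm lscD p1 a0 ab b1 acc mG).
Qed.

(** There are countably many dyadic intervals, so almost every curve satisfies both gradient
    inequalities on all of them, and [min_of_majorants] applies to [u] along that curve. *)
Lemma borel_gradient_min u G H : borel_gradient u G -> borel_gradient u H ->
  borel_gradient u (fun x => mine (G x) (H x)).
Proof.
move=> gG gH; have [mG G0 iG] := gG; have [mH H0 iH] := gH; split.
- exact: measurable_mine.
- by move=> x; rewrite le_min G0 H0.
move=> eta Teta; have [[acN _] _] := Teta.
have stopped K : borel_gradient u K -> {ae eta, forall c, forall n j, (j < 2 ^ n)%N ->
    (u (ev (dyadic_point n j.+1) c) - u (ev (dyadic_point n j) c))%:E <=
    \int[mu]_(s in dyadic_itv n j) (K (ev s c) * forward_speed d c s)}.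
  move=> gK; apply: ae_foralln => n; apply: ae_foralln => j.
  have [jn|jn] := ltnP j (2 ^ n); last by apply: aeW => c.
  have a0 : (0 <= dyadic_point n j :> R)%R by exact: dyadic_point_ge0.
  have ab : (dyadic_point n j <= dyadic_point n j.+1 :> R)%R by rewrite ler_dyadic_point.
  have b1 : (dyadic_point n j.+1 <= 1 :> R)%R by exact: dyadic_point_le1.
  by apply: filterS (borel_gradient_subinterval a0 ab b1 gK Teta).
have v0 c s : 0 <= forward_speed d c s by exact: forward_speed_ge0.
apply: filterS2 (filterI (iG _ Teta) (iH _ Teta)) (filterI acN (filterI (stopped _ gG) (stopped _ gH))).
move=> c [/andP[iGc fGc] /andP[iHc fHc]] [acc [sG sH]].
apply/andP; split; last first.
  apply: le_lt_trans fGc; apply: curve_integral_ae_le => //.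
    by move=> x; rewrite le_min G0 H0.
  by apply: aeW => s _; rewrite ge_min lexx.
rewrite (curve_integralE dm lscD p1 acc); last exact: measurable_mine.
rewrite (_ : \int[mu]_(s in _) _ = \int[mu]_(s in `[0%R, 1%R[)
    mine (G (ev s c) * forward_speed d c s) (H (ev s c) * forward_speed d c s)); last first.
  apply: eq_integral => s _; have [GH|/ltW HG] := leP (G (ev s c)) (H (ev s c)).
    by rewrite min_l// lee_wpmul2r.
  by rewrite min_r// lee_wpmul2r.
apply: (min_of_majorants (u := fun s => u (ev s c))) => //.
- exact: (measurable_integrand dm lscD p1 acc mG).
- exact: (measurable_integrand dm lscD p1 acc mH).
- by move=> s _; rewrite mule_ge0.
- by move=> s _; rewrite mule_ge0.
- by rewrite -(curve_integralE dm lscD p1 acc).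
- by rewrite -(curve_integralE dm lscD p1 acc).
Qed.

(** Along almost every curve the integrands converge a.e. in time under an integrable majorant, so
    the curve integrals converge; the endpoint values converge because the marginals at times 0 and
    1 are absolutely continuous. *)
Lemma borel_gradient_limit (u_ : nat -> X -> R) u (H_ : nat -> X -> R) (L G : X -> R) :
  (forall n, borel_gradient (u_ n) (EFin \o H_ n)) -> {ae m, forall x, u_ n x @[n --> \oo] --> u x} ->
  measurable_fun setT (L : borel X -> R) -> (forall x, (0 <= L x)%R) -> \int[m]_x (L x `^ q)%:E < +oo ->
  {ae m, forall x, forall n, (H_ n x <= L x)%R} ->
  measurable_fun setT (G : borel X -> R) -> (forall x, (0 <= G x)%R) ->
  {ae m, forall x, H_ n x @[n --> \oo] --> G x} -> borel_gradient u (EFin \o G).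
Proof.
move=> gH uu mL L0 iL HL mG G0 HG; split.
- exact/measurable_EFinP.
- by move=> x; rewrite lee_fin.
move=> eta Teta; have [[acN _] _] := Teta.
have p0 : (0 < p)%R by exact: lt_trans p1.
have q1 := conjugate_gt1; have q0 : (0 < q)%R by exact: lt_trans q1.
have Hc : {ae eta, forall c, forall n, (u_ n (ev 1%R c) - u_ n (ev 0%R c))%:E <= curve_integral d (EFin \o H_ n) c}.
  by apply: ae_foralln => n; have [_ _ /(_ _ Teta)] := gH n; apply: filterS => c /andP[].
apply: filterS2 (filterI Hc (filterI (Tp_ae_endpoints uu Teta) (ae_along_curves polishX Teta HL)))
  (filterI acN (filterI (Lq_along_curves polishX Teta A1 mL L0 iL) (ae_along_curves polishX Teta HG))).
move=> c [iH [[u0 u1] HLc]] [acc [iLc HGc]].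
have [g [[mg g0 ig] vg]] := forward_speed_Lp dm p1 acc.
pose D : set (measurableTypeR R) := `[0%R, 1%R[%classic.
have mD : measurable D by exact: measurable_itv.
have DI : D `<=` (`[0%R, 1%R]%classic : set R) by move=> s; rewrite /D /= !in_itv /= => /andP[-> /ltW].
have v0 s : 0 <= forward_speed d c s by exact: forward_speed_ge0.
(* The bound on the speed holds on the open interval, so time 0 is discarded. *)
have n0 : {ae mu, forall s, s != 0%R}.
  exists [set 0%R]; split => //; first exact: lebesgue_measure_set1.
  by move=> s /= /negP; rewrite negbK => /eqP.
(* Young's inequality bounds L g by L^q/q + g^p/p; the factors 1/q and 1/p, at most 1, are
   dropped. *)
pose h s : \bar R := (L (ev s c) `^ q)%:E + (g s `^ p)%:E.
have mLc : measurable_fun D (fun s => L (ev s c)) by exact: measurableT_comp mL (measurable_path c).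
have mgD : measurable_fun D g by exact: measurable_funS mg.
have ih : mu.-integrable D h.
  have ip (f : R -> R) r : measurable_fun D f -> \int[mu]_(s in D) (f s `^ r)%:E < +oo ->
      mu.-integrable D (fun s => (f s `^ r)%:E).
    move=> mf fi; apply/integrableP; split; first exact: measurable_powR_EFin.
    by under eq_integral do rewrite gee0_abs ?lee_fin ?powR_ge0//.
  have igD : \int[mu]_(s in D) (g s `^ p)%:E < +oo.
    apply: le_lt_trans ig; apply: ge0_subset_integral => //.
      exact: measurable_powR_EFin.
    by move=> s _; rewrite lee_fin powR_ge0.
  exact: (integrableD mD (ip _ _ mLc iLc) (ip _ _ mgD igD)).
have mH n : measurable_fun setT (EFin \o H_ n : borel X -> \bar R) by have [] := gH n.
have H0 n x : (0 <= H_ n x)%R by have [_ /(_ x)] := gH n; rewrite lee_fin.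
pose F_ n s := (H_ n (ev s c))%:E * forward_speed d c s.
pose F s := (G (ev s c))%:E * forward_speed d c s.
have mF_ n : measurable_fun D (F_ n) by exact: (measurable_integrand dm lscD p1 acc (mH n)).
have mEG : measurable_fun setT (EFin \o G : borel X -> \bar R) by exact/measurable_EFinP.
have mF : measurable_fun D F by exact: (measurable_integrand dm lscD p1 acc mEG).
have F_F : {ae mu, forall s, D s -> F_ n s @[n --> \oo] --> F s}.
  apply: filterS3 n0 vg HGc => s s0 vgs HGs; rewrite /D /= in_itv /= => /andP[s_ge0 s_lt1].
  have vfin : forward_speed d c s \is a fin_num.
    by rewrite ge0_fin_numE// (le_lt_trans (vgs _))// ?ltry// lt_neqAle eq_sym s0 s_ge0.
  apply: cvgeZr => //; apply: cvg_EFin; first exact: nearW.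
  by apply: HGs; rewrite s_ge0.
have F_h : {ae mu, forall s n, D s -> `|F_ n s| <= h s}.
  apply: filterS3 n0 vg HLc => s s0 vgs HLs n; rewrite /D /= in_itv /= => /andP[s_ge0 s_lt1].
  have s01 : (0 < s < 1)%R by rewrite lt_neqAle eq_sym s0 s_ge0.
  have gs0 : (0 <= g s)%R by apply: g0; rewrite in_itv /= s_ge0 ltW.
  rewrite gee0_abs; last by rewrite mule_ge0// lee_fin.
  apply: (@le_trans _ _ ((L (ev s c))%:E * (g s)%:E)).
    by apply: lee_pmul; rewrite ?lee_fin//; [apply: HLs; rewrite s_ge0|exact: vgs].
  rewrite -EFinM /h -EFinD lee_fin.
  apply: le_trans (conjugate_powR (L0 _) gs0 q0 p0 _) _; first by rewrite addrC.
  by rewrite lerD// ler_piMr ?powR_ge0// invf_le1// ltW.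
have [iG _ cvgG] := @dominated_convergence _ _ R mu D mD F_ F h mF_ mF F_F ih F_h.
rewrite (curve_integralE dm lscD p1 acc); last exact/measurable_EFinP.
apply/andP; split; last first.
  exact: (integrable_lty mD iG).
have cu : (u_ n (ev 1%R c) - u_ n (ev 0%R c))%:E @[n --> \oo] --> (u (ev 1%R c) - u (ev 0%R c))%:E.
  by apply: cvg_EFin; [exact: nearW|exact: cvgB].
apply: (lee_cvg_to cu cvgG); apply: nearW => n; apply: le_trans (iH n) _.
by rewrite (curve_integralE dm lscD p1 acc).
Qed.

End borel_gradients.

Lemma ge0_le_integral_ae_eq {R : realType} d0 {T : measurableType d0} (mu : {measure set T -> \bar R})
    (f g : T -> R) : measurable_fun setT f -> measurable_fun setT g ->
  (forall x, (0 <= f x <= g x)%R) -> \int[mu]_x (g x)%:E <= \int[mu]_x (f x)%:E ->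
  \int[mu]_x (f x)%:E < +oo -> {ae mu, forall x, f x = g x}.
Proof.
move=> mf mg fg gf ff.
have f0 x : (0 <= f x)%R by case/andP: (fg x).
have gf0 x : (0 <= g x - f x)%R by rewrite subr_ge0; case/andP: (fg x).
have mgf : measurable_fun setT (fun x => (g x - f x)%:E).
  by apply/measurable_EFinP; exact: measurable_funB.
have split_g : \int[mu]_x (g x)%:E = \int[mu]_x (f x)%:E + \int[mu]_x (g x - f x)%:E.
  rewrite -ge0_integralD//.
  - by apply: eq_integral => x _; rewrite -EFinD addrC subrK.
  - by move=> x _; rewrite lee_fin.
  - exact/measurable_EFinP.
  - by move=> x _; rewrite lee_fin.
have f_fin : \int[mu]_x (f x)%:E \is a fin_num.
  by rewrite ge0_fin_numE//; apply: integral_ge0 => x _; rewrite lee_fin.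
have D0 : \int[mu]_x `|(g x - f x)%:E| = 0.
  under eq_integral do rewrite gee0_abs ?lee_fin//.
  apply/eqP; rewrite eq_le integral_ge0 ?andbT; last by move=> x _; rewrite lee_fin.
  by move: gf; rewrite split_g -[leRHS]adde0 leeD2lE.
have /(_ D0) := (ae_eq_integral_abs mu measurableT mgf).1.
by apply: filterS => x /(_ I) [] /eqP; rewrite subr_eq0 => /eqP.
Qed.

(** * Existence of the minimal gradient *)

Section minimal_gradient.
Context {R : realType} {X : ptopologicalType} (d : X -> X -> \bar R)
  (m : {measure set (borel X) -> \bar R}) (V : X -> R) (p q : R).
Hypothesis polishX : polish R X.
Hypothesis dm : asymmetric_extended_metric d.
Hypothesis lscD : lower_semicontinuous (fun z : X * X => d z.1 z.2).
Hypothesis A1 : assumption_A1 d m V.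
Hypothesis p1 : (1 < p)%R.
Hypothesis pq : (p^-1 + q^-1 = 1)%R.
Local Notation bgrad := (borel_gradient d m V p).
Local Notation E G := (\int[m]_x (G x `^ q)%:E).

Let q1 : (1 < q)%R. Proof. exact: conjugate_gt1 p1 pq. Qed.
Let q0 : (0 < q)%R. Proof. exact: lt_trans q1. Qed.

Definition real_gradient (u : X -> R) (H : borel X -> R) : Prop :=
  [/\ measurable_fun setT H, forall x, (0 <= H x)%R & bgrad u (EFin \o H)].

(** The selection principle for pairs of a function and a gradient, where functions may vary in
    shrinking convex classes [P n] forcing convergence to [u]. The constant class of [u] alone gives
    the minimal gradient; the classes squeezed by tails give lower semicontinuity. *)
Lemma real_gradient_limit (P : nat -> set (X -> R)) (u : X -> R) (K : R) :
  (forall n, P n.+1 `<=` P n) ->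
  (forall n v w, P n v -> P n w -> P n (fun x => 2^-1 * v x + 2^-1 * w x)%R) ->
  (forall n e, (0 < e)%R -> exists v H, [/\ P n v, real_gradient v H & E H <= (K + e)%:E]) ->
  (forall v : nat -> X -> R, (forall n, P n (v n)) -> {ae m, forall x, v n x @[n --> \oo] --> u x}) ->
  exists2 G, real_gradient u G & E G <= K%:E.
Proof.
move=> Pdecr Pmid Pnear Plim.
pose C n := [set H : borel X -> R | exists2 v, P n v & real_gradient v H].
have [|||||H [L [G [CH [mL L0 iL] [mG G0 iG] HL HG]]]] := @near_minimizers_limit R _ _ m q q1 C K.
- by move=> n g [v _ []].
- by move=> n g x [v _ []].
- by move=> n g [v Pv gv]; exists v => //; exact: Pdecr.
- move=> n g h [v Pv [mg g0 gv]] [w Pw [mh h0 hw]].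
  exists (fun x => 2^-1 * v x + 2^-1 * w x)%R; first exact: Pmid.
  have E2 : (fun x => (2^-1)%:E * (g x)%:E + (2^-1)%:E * (h x)%:E) = EFin \o (fun x => ((g x + h x) / 2)%R).
    by apply/funext => x /=; rewrite -!EFinM -EFinD -mulrDr mulrC.
  split.
  + by apply: measurable_funM => //; exact: measurable_funD.
  + by move=> x; rewrite divr_ge0// addr_ge0.
  + by rewrite -E2; apply: borel_gradient_conic gv hw => //; rewrite invr_ge0.
- by move=> n e e0; have [v [g [Pv gv Eg]]] := Pnear n e e0; exists g => //; exists v.
have [v Hv] := choice (fun n => let: ex_intro2 v Pv gv := CH n in ex_intro (fun v => P n v /\ real_gradient v (H n)) v (conj Pv gv)).
exists G => //; split => //.
apply: (borel_gradient_limit polishX dm lscD A1 p1 pq (u_ := v) (H_ := H) (L := L)) => //.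
- by move=> n; case: (Hv n) => _ [].
- by apply: Plim => n; case: (Hv n).
Qed.

Lemma borel_gradient_real (u : X -> R) (G : borel X -> \bar R) : bgrad u G ->
  \int[m]_x (G x `^ q) < +oo ->
  exists H, [/\ real_gradient u H, {ae m, forall x, (H x)%:E = G x} & E H <= \int[m]_x (G x `^ q)].
Proof.
move=> gG iG; have [mG G0 _] := gG.
have mGq : measurable_fun setT (fun x => G x `^ q) by exact: measurableT_comp (measurable_poweR _) mG.
have Gfin : {ae m, forall x, (fine (G x))%:E = G x}.
  have ig : m.-integrable setT (fun x => G x `^ q).
    by apply/integrableP; split => //; under eq_integral do rewrite gee0_abs ?poweR_ge0//.
  have := integrable_ae measurableT ig; apply: filterS => x /(_ I) Gq; rewrite fineK//.
  by rewrite ge0_fin_numE// ltey; apply: contraTneq Gq => ->; rewrite poweRyr// gt_eqF.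
have H0 x : (0 <= fine (G x))%R by exact: fine_ge0.
have mH : measurable_fun setT (fine \o G) by exact: measurableT_comp.
exists (fine \o G); split => //.
- split => //; apply: borel_gradient_ae gG => //.
  + exact: aeW.
  + by apply: filterS Gfin => x /= ->.
  + exact/measurable_EFinP.
- apply: ge0_ae_le_integral.
  + by move=> x _; rewrite lee_fin powR_ge0.
  + by move=> x _; rewrite poweR_ge0.
  + by apply: filterS Gfin => x /= <- _; rewrite poweR_EFin.
Qed.

(** The competitor [G'] may have infinite values or infinite energy: its minimum with the
    least-energy [G] is real and has energy at most that of [G], hence the same. So the q-th powers
    agree a.e., and the minimum is [G]. *)
Lemma minimal_real_gradient (u : X -> R) (H : borel X -> R) : real_gradient u H -> E H < +oo ->
  exists G, [/\ real_gradient u G, E G < +oo &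
    forall G', bgrad u G' -> {ae m, forall x, (G x)%:E <= G' x}].
Proof.
move=> gH iH.
pose A := [set E K | K in real_gradient u].
have A_ge0 : 0 <= ereal_inf A.
  by apply/ereal_infP => _ [K _ <-]; apply: integral_ge0 => x _; rewrite lee_fin powR_ge0.
have A_fin : ereal_inf A \is a fin_num.
  by rewrite ge0_fin_numE//; apply: le_lt_trans iH; apply: ereal_inf_lbound; exists H.
have [||||G gG EG] := @real_gradient_limit (fun _ => [set u]) u (fine (ereal_inf A)).
- by move=> _ v.
- by move=> _ v w -> ->; apply/funext => x; rewrite -mulrDl -div1r -splitr mul1r.
- move=> _ e e0; have [_ [K gK <-] KE] := lb_ereal_inf_adherent e0 A_fin.
  by exists u, K; split => //; rewrite EFinD fineK// ltW.
- by move=> v vu; apply: aeW => x; rewrite (_ : v^~ x = cst (u x)); [exact: cvg_cst|apply/funext => n; rewrite vu].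
rewrite (fineK A_fin) in EG; exists G; split; first exact: gG.
  by apply: le_lt_trans EG _; rewrite -ge0_fin_numE.
move=> G' gG'; have [mG G0 bG] := gG; have [mG' G'0 _] := gG'.
pose M x := fine (mine (G x)%:E (G' x)).
have ME x : (M x)%:E = mine (G x)%:E (G' x).
  by rewrite fineK// ge0_fin_numE ?le_min ?lee_fin ?G0 ?G'0// gt_min ltry.
have gM : bgrad u (EFin \o M).
  rewrite (_ : EFin \o M = fun x => mine ((EFin \o G) x) (G' x)); last by apply/funext => x /=; rewrite ME.
  exact: borel_gradient_min.
have M0 x : (0 <= M x)%R by rewrite -lee_fin ME le_min lee_fin G0 G'0.
have MG x : (M x <= G x)%R by rewrite -lee_fin ME ge_min lexx.
have mM : measurable_fun setT M by have [/measurable_EFinP] := gM.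
have EM : ereal_inf A <= E M := ereal_inf_lbound (ex_intro2 _ _ (M : borel X -> R) (And3 mM M0 gM) erefl).
have MqG : {ae m, forall x, (M x `^ q = G x `^ q)%R}.
  apply: ge0_le_integral_ae_eq.
  - by apply/measurable_EFinP; exact: measurable_powR_EFin.
  - by apply/measurable_EFinP; exact: measurable_powR_EFin.
  - by move=> x; rewrite powR_ge0 ge0_ler_powR ?nnegrE// ltW.
  - exact: le_trans EG EM.
  - apply: (@le_lt_trans _ _ (E G)).
      apply: ge0_le_integral => //.
      + by move=> x _; rewrite lee_fin powR_ge0.
      + exact: measurable_powR_EFin.
      + exact: measurable_powR_EFin.
      + by move=> x _; rewrite lee_fin ge0_ler_powR ?nnegrE// ltW.
    by apply: le_lt_trans EG _; rewrite -ge0_fin_numE.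
apply: filterS MqG => x Mq; have <- : M x = G x.
  apply/eqP; rewrite eq_le MG leNgt; apply/negP => lt.
  by have := gt0_ltr_powR q0 (M0 x) (G0 x) lt; rewrite Mq ltxx.
by rewrite ME ge_min lexx orbT.
Qed.

End minimal_gradient.

(** * The Cheeger energy *)

Section cheeger_energy.
Context {R : realType} {X : ptopologicalType} (d : X -> X -> \bar R)
  (m : {measure set (borel X) -> \bar R}) (V : X -> R) (p q : R).
Hypothesis polishX : polish R X.
Hypothesis dm : asymmetric_extended_metric d.
Hypothesis lscD : lower_semicontinuous (fun z : X * X => d z.1 z.2).
Hypothesis A1 : assumption_A1 d m V.
Hypothesis p1 : (1 < p)%R.
Hypothesis pq : (p^-1 + q^-1 = 1)%R.
Local Notation rgrad := (real_gradient d m V p).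
Local Notation E G := (\int[m]_x (G x `^ q)%:E).
Local Notation wfug := (weak_forward_upper_gradient d m V p).
Local Notation Ch := (weak_cheeger d m V p q).

Let q1 : (1 < q)%R. Proof. exact: conjugate_gt1 p1 pq. Qed.
Let q0 : (0 < q)%R. Proof. exact: lt_trans q1. Qed.

Let energyE (H : X -> R) : \int[m]_x ((EFin \o H) x `^ q) = E H.
Proof. by apply: eq_integral => x _; rewrite -poweR_EFin. Qed.

Let energy_le (G H : X -> \bar R) : (forall x, 0 <= G x) -> (forall x, 0 <= H x) ->
  {ae m, forall x, G x <= H x} -> \int[m]_x (G x `^ q) <= \int[m]_x (H x `^ q).
Proof.
move=> G0 H0 GH; apply: ge0_ae_le_integral.
- by move=> x _; exact: poweR_ge0.
- by move=> x _; exact: poweR_ge0.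
- apply: (@filterS _ _ (ae_filter_ringOfSetsType m)) GH => x GHx _.
  by rewrite ge0_le_poweR// ltW.
Qed.

Lemma weak_cheeger_ge0 f : 0 <= Ch f.
Proof.
rewrite /weak_cheeger; case: ifP => // _; rewrite mule_ge0//.
  by rewrite lee_fin invr_ge0 ltW.
by apply: integral_ge0 => x _; exact: poweR_ge0.
Qed.

(** Shows that [xget] does not return its default. An arbitrary weak gradient is compared through a
    Borel gradient below it, against which [G] is minimal. *)
Let weak_gradient_minimal (f : X -> \bar R) u H : {ae m, forall x, f x = (u x)%:E} ->
  rgrad u H -> E H < +oo ->
  minimal_weak_forward_upper_gradient d m V p f (weak_forward_gradient d m V p f).
Proof.
move=> fu gH iH; apply: xgetPex.
have [G [[_ _ gG] _ Gmin]] := minimal_real_gradient polishX dm lscD A1 p1 pq gH iH.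
exists (EFin \o G); split; first exact: borel_gradient_wfug fu gG.
move=> G' gG'; have [H' [gH' H'G' _]] := wfug_borel_gradient polishX dm fu gG'.
by apply: filterS (Gmin _ gH') => x GH'; exact: le_trans GH' (H'G' x).
Qed.

(** With [weak_cheeger_attained] this turns the energy into an existence statement: it is at most
    K/q exactly when a real gradient of energy at most K exists. *)
Lemma weak_cheeger_le (f : X -> \bar R) u H (K : R) : {ae m, forall x, f x = (u x)%:E} ->
  rgrad u H -> E H <= K%:E -> Ch f <= (q^-1 * K)%:E.
Proof.
move=> fu gH iK; have [_ H0 bH] := gH.
have iH : E H < +oo by exact: le_lt_trans iK (ltry _).
have wH : wfug f (EFin \o H) by exact: borel_gradient_wfug fu bH.
rewrite /weak_cheeger ifT; last by apply/asboolP; exists (EFin \o H) => //; rewrite energyE.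
have [[W0 _ _] Wmin] := weak_gradient_minimal fu gH iH.
rewrite EFinM lee_wpmul2l//; first by rewrite lee_fin invr_ge0 ltW.
apply: le_trans iK; rewrite -energyE; apply: energy_le; [exact: W0|by move=> x; rewrite lee_fin|exact: Wmin].
Qed.

(** Two passes: a gradient of finite energy first yields a real one, so that the minimal weak
    gradient exists; then a Borel function below the latter is made real in turn. *)
Lemma weak_cheeger_attained (f : X -> \bar R) u : {ae m, forall x, f x = (u x)%:E} -> Ch f < +oo ->
  exists2 H, rgrad u H & E H <= q%:E * Ch f.
Proof.
move=> fu; rewrite /weak_cheeger; case: ifPn => // /asboolP[G wG iG] _.
have iB B : (forall x, B x <= G x) -> borel_gradient d m V p u B -> \int[m]_x (B x `^ q) < +oo.
  move=> BG [_ B0 _]; have [G0 _ _] := wG.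
  by apply: le_lt_trans iG; apply: energy_le => //; exact: aeW.
have [B [gB BG _]] := wfug_borel_gradient polishX dm fu wG.
have [H [gH _ EH]] := borel_gradient_real polishX dm p1 pq gB (iB _ BG gB).
have [wW Wmin] := weak_gradient_minimal fu gH (le_lt_trans EH (iB _ BG gB)).
set W := weak_forward_gradient d m V p f in wW Wmin *.
have [W0 _ _] := wW; have [G0 _ _] := wG.
have iW : \int[m]_x (W x `^ q) < +oo.
  by apply: le_lt_trans iG; apply: energy_le => //; exact: Wmin.
have [B' [gB' B'W _]] := wfug_borel_gradient polishX dm fu wW; have [_ B'0 _] := gB'.
have EB' : \int[m]_x (B' x `^ q) <= \int[m]_x (W x `^ q) by apply: energy_le => //; exact: aeW.
have [H' [gH' _ EH']] := borel_gradient_real polishX dm p1 pq gB' (le_lt_trans EB' iW).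
exists H' => //; rewrite muleA -EFinM mulfV ?gt_eqF// mul1e.
exact: le_trans EH' EB'.
Qed.

End cheeger_energy.

Lemma powR_convex_combination {R : realType} (q a b t : R) : (1 <= q)%R -> (0 <= a)%R -> (0 <= b)%R ->
  (0 <= t <= 1)%R -> (((1 - t) * a + t * b) `^ q <= (1 - t) * a `^ q + t * b `^ q)%R.
Proof.
move=> q1 a0 b0 /andP[t0 t1].
have s0 : (0 <= 1 - t)%R by rewrite subr_ge0.
have s1 : (1 - t <= 1)%R by rewrite gerBl.
have : (((1 - t) * a + (1 - (1 - t)) * b) `^ q <= (1 - t) * a `^ q + (1 - (1 - t)) * b `^ q)%R.
  by apply: (convex_powR q1 (Itv01 s0 s1)); rewrite inE /= in_itv /= ?a0 ?b0.
by rewrite (_ : 1 - (1 - t) = t)%R//; lra.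
Qed.

(** * Convexity and lower semicontinuity *)

Section cheeger_functional.
Context {R : realType} {X : ptopologicalType} (d : X -> X -> \bar R)
  (m : {measure set (borel X) -> \bar R}) (V : X -> R) (p q : R).
Hypothesis polishX : polish R X.
Hypothesis dm : asymmetric_extended_metric d.
Hypothesis lscD : lower_semicontinuous (fun z : X * X => d z.1 z.2).
Hypothesis A1 : assumption_A1 d m V.
Hypothesis p1 : (1 < p)%R.
Hypothesis pq : (p^-1 + q^-1 = 1)%R.
Local Notation E G := (\int[m]_x (G x `^ q)%:E).
Local Notation Ch := (weak_cheeger d m V p q).

Let q1 : (1 < q)%R. Proof. exact: conjugate_gt1 p1 pq. Qed.
Let q0 : (0 < q)%R. Proof. exact: lt_trans q1. Qed.

Let ae_fine (f : X -> \bar R) : {ae m, forall x, f x \is a fin_num} ->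
  {ae m, forall x, f x = (fine (f x))%:E}.
Proof. by apply: (@filterS _ _ (ae_filter_ringOfSetsType m)) => x fx; rewrite fineK. Qed.

Lemma weak_cheeger_convex (f g : X -> \bar R) (t : R) :
  {ae m, forall x, f x \is a fin_num} -> {ae m, forall x, g x \is a fin_num} -> (0 <= t <= 1)%R ->
  Ch (fun x => (1 - t)%:E * f x + t%:E * g x) <= (1 - t)%:E * Ch f + t%:E * Ch g.
Proof.
move=> fF gF /andP[t0 t1].
have Chf0 := @weak_cheeger_ge0 R X d m V p q p1 pq f.
have Chg0 := @weak_cheeger_ge0 R X d m V p q p1 pq g.
(* The ends t = 0 and t = 1 rest on the convention that 0 times +oo is 0. For t strictly between, an
   infinite energy makes the right-hand side infinite. *)
have [->|tN0] := eqVneq t 0%R.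
  rewrite subr0 mul1e mul0e adde0 le_eqVlt; apply/orP; left; apply/eqP; congr (weak_cheeger _ _ _ _ _ _).
  by apply/funext => x; rewrite mul1e mul0e adde0.
have [->|tN1] := eqVneq t 1%R.
  rewrite subrr mul1e mul0e add0e le_eqVlt; apply/orP; left; apply/eqP; congr (weak_cheeger _ _ _ _ _ _).
  by apply/funext => x; rewrite mul1e mul0e add0e.
have t_gt0 : (0 < t)%R by rewrite lt_neqAle eq_sym tN0.
have s_gt0 : (0 < 1 - t)%R by rewrite subr_gt0 lt_neqAle tN1.
have [foo|fF'] := leP +oo (Ch f).
  move: foo; rewrite leye_eq => /eqP ->; rewrite gt0_muley ?lte_fin// addye ?leey//.
  by rewrite gt_eqF// (lt_le_trans ltNy0)// mule_ge0// lee_fin.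
have [goo|gF'] := leP +oo (Ch g).
  move: goo; rewrite leye_eq => /eqP ->; rewrite gt0_muley ?lte_fin// addey ?leey//.
  by rewrite gt_eqF// (lt_le_trans ltNy0)// mule_ge0// lee_fin ltW.
have [H1 [mH1 H10 gH1] EH1] := weak_cheeger_attained polishX dm lscD A1 p1 pq (ae_fine fF) fF'.
have [H2 [mH2 H20 gH2] EH2] := weak_cheeger_attained polishX dm lscD A1 p1 pq (ae_fine gF) gF'.
pose a := fine (Ch f); pose b := fine (Ch g).
have aE : Ch f = a%:E by rewrite fineK// ge0_fin_numE.
have bE : Ch g = b%:E by rewrite fineK// ge0_fin_numE.
rewrite aE bE -!EFinM -EFinD.
have -> : ((1 - t) * a + t * b = q^-1 * ((1 - t) * (q * a) + t * (q * b)))%R.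
  by rewrite mulrDr (mulrCA q^-1%R (1 - t)%R) (mulrCA q^-1%R t) !mulKf ?gt_eqF.
pose u x : R := ((1 - t) * fine (f x) + t * fine (g x))%R.
pose H x : R := ((1 - t) * H1 x + t * H2 x)%R.
have fu : {ae m, forall x, (1 - t)%:E * f x + t%:E * g x = (u x)%:E}.
  by apply: (@filterS2 _ _ (ae_filter_ringOfSetsType m)) (ae_fine fF) (ae_fine gF) => x -> ->.
have gH : real_gradient d m V p u H.
  split.
  - by apply: measurable_funD; exact: measurable_funM.
  - by move=> x; rewrite addr_ge0// mulr_ge0// ltW.
  - by apply: borel_gradient_conic gH1 gH2 => //; exact: ltW.
apply: (weak_cheeger_le polishX dm lscD A1 p1 pq fu gH).
apply: (@le_trans _ _ (\int[m]_x ((1 - t)%:E * (H1 x `^ q)%:E + t%:E * (H2 x `^ q)%:E))).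
  apply: ge0_le_integral => //.
  - by move=> x _; rewrite lee_fin powR_ge0.
  - by apply: measurable_powR_EFin; apply: measurable_funD; exact: measurable_funM.
  - by apply: emeasurable_funD; apply: measurable_funeM; exact: measurable_powR_EFin.
  - move=> x _; rewrite -!EFinM -EFinD lee_fin; apply: powR_convex_combination => //.
      exact: ltW.
    by rewrite t0.
rewrite ge0_integralD//; last 4 first.
- by move=> x _; rewrite mule_ge0// lee_fin ?powR_ge0// ltW.
- by apply: measurable_funeM; exact: measurable_powR_EFin.
- by move=> x _; rewrite mule_ge0// lee_fin ?powR_ge0.
- by apply: measurable_funeM; exact: measurable_powR_EFin.
have pos (K : X -> R) x : setT x -> 0 <= (K x `^ q)%:E by move=> _; rewrite lee_fin powR_ge0.
have s_ge0 : 0 <= (1 - t)%:E by rewrite lee_fin ltW.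
rewrite !ge0_integralZl//; try exact: measurable_powR_EFin; try exact: pos.
by rewrite (EFinD ((1 - t) * (q * a))) !EFinM -aE -bE leeD// lee_wpmul2l// lee_fin.
Qed.

Lemma weak_cheeger_lsc (f_ : nat -> X -> \bar R) (f : X -> \bar R) :
  (forall i, {ae m, forall x, f_ i x \is a fin_num}) -> {ae m, forall x, f x \is a fin_num} ->
  {ae m, forall x, f_ i x @[i --> \oo] --> f x} -> Ch f <= limn_einf (fun i => Ch (f_ i)).
Proof.
move=> f_F fF f_f; set l := limn_einf _.
have [|l_lty] := leP +oo l; first by rewrite leye_eq => /eqP ->; exact: leey.
have inf_l n : einfs (fun i => Ch (f_ i)) n <= l.
  have nd := nondecreasing_einfs (fun i => Ch (f_ i)).
  rewrite /l limn_einf_lim; apply: lime_ge; first exact: is_cvg_einfs.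
  by exists n => // k /= nk; exact: nd.
have l0 : 0 <= l.
  apply: le_trans (inf_l 0%N); apply/ereal_infP => _ [i _ <-]; exact: (weak_cheeger_ge0 d m V p1 pq).
have lfin : l \is a fin_num by rewrite ge0_fin_numE.
have u_u : {ae m, forall x, (fine (f_ i x)) @[i --> \oo] --> fine (f x)}.
  have f_F' : {ae m, forall x i, f_ i x \is a fin_num} by exact: ae_foralln.
  apply: (@filterS3 _ _ (ae_filter_ringOfSetsType m)) f_F' fF f_f => x f_x fx cf.
  by apply: fine_cvg; rewrite fineK.
(* inf_{k >= n} f_k <= v <= sup_{k >= n} f_k, without extended reals. *)
pose P n := [set v : X -> R | {ae m, forall x b,
  ((forall k, (n <= k)%N -> (fine (f_ k x) <= b)%R) -> (v x <= b)%R) /\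
  ((forall k, (n <= k)%N -> (b <= fine (f_ k x))%R) -> (b <= v x)%R)}].
have [||||G gG EG] := real_gradient_limit polishX dm lscD A1 p1 pq (P := P) (u := fine \o f) (K := (q * fine l)%R).
- move=> n v; apply: (@filterS _ _ (ae_filter_ringOfSetsType m)) => x Hx b; have [h1 h2] := Hx b; split => H.
    by apply: h1 => k nk; apply: H; exact: ltnW.
  by apply: h2 => k nk; apply: H; exact: ltnW.
- move=> n v w; apply: (@filterS2 _ _ (ae_filter_ringOfSetsType m)) => x Hv Hw b.
  have [v1 v2] := Hv b; have [w1 w2] := Hw b; split => H.
    by have := v1 H; have := w1 H; lra.
  by have := v2 H; have := w2 H; lra.
- move=> n e e0.
  (* Some tail member f_k with k >= n has energy close to [l], and f_k itself belongs to [P n]. The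
     error e/q becomes e because the integral is q times the energy. *)
  have lt : einfs (fun i => Ch (f_ i)) n < l + (e / q)%:E.
    by apply: le_lt_trans (inf_l n) _; rewrite lteDl// lte_fin divr_gt0.
  have [_ [k /= nk <-] Chk] := ereal_inf_lt lt.
  have Chk_lty : Ch (f_ k) < +oo by apply: lt_trans Chk _; rewrite lte_add_pinfty// ltry.
  have [H gH EH] := weak_cheeger_attained polishX dm lscD A1 p1 pq (ae_fine (f_F k)) Chk_lty.
  exists (fine \o f_ k), H; split => //.
    by apply: aeW => x b; split => /(_ _ nk).
  apply: (le_trans EH); apply: (@le_trans _ _ (q%:E * (l + (e / q)%:E))).
    by rewrite lee_wpmul2l ?lee_fin//; exact: ltW.
  by rewrite -(fineK lfin) -EFinD -EFinM lee_fin mulrDr mulrCA mulfV ?gt_eqF// mulr1.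
(* Taking b = f(x) + e and b = f(x) - e in [P n] squeezes [v n] to within e of f(x) once the whole
   tail is that close. *)
- move=> v Pv.
  have Pv' : {ae m, forall x n b,
    ((forall k, (n <= k)%N -> (fine (f_ k x) <= b)%R) -> (v n x <= b)%R) /\
    ((forall k, (n <= k)%N -> (b <= fine (f_ k x))%R) -> (b <= v n x)%R)} by exact: ae_foralln.
  apply: (@filterS2 _ _ (ae_filter_ringOfSetsType m)) Pv' u_u => x Hv cu.
  apply/cvgrPdist_le => e e0; move/cvgrPdist_le : cu => /(_ _ e0)[N _ HN].
  exists N => // n /= Nn; have [_ lo] := Hv n (fine (f x) - e)%R; have [hi _] := Hv n (fine (f x) + e)%R.
  have h k : (n <= k)%N -> (`|fine (f x) - fine (f_ k x)| <= e)%R.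
    by move=> nk; apply: HN => /=; exact: leq_trans Nn nk.
  rewrite distrC ler_distl lo ?hi// => k /h; rewrite distrC ler_distl => /andP[]//.
have := weak_cheeger_le polishX dm lscD A1 p1 pq (ae_fine fF) gG EG.
by rewrite mulKf ?gt_eqF// fineK.
Qed.

End cheeger_functional.

Unset Implicit Arguments.

Theorem lemma3p31 (R : realType) (X : ptopologicalType) (d : X -> X -> \bar R)
    (m : {measure set (borel X) -> \bar R}) (V : X -> R) (p q : R)
    (hX : forward_extended_polish_mms d m)
    (hA1 : assumption_A1 d m V) (hA2 : assumption_A2 d m)
    (hp : (1 < p)%R) (hpq : (p^-1 + q^-1 = 1)%R) :
  (forall (f g : X -> \bar R) (t : R),
     measurable_ae_finite m f -> measurable_ae_finite m g ->
     (0 <= t <= 1)%R ->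
     weak_cheeger d m V p q (fun x => (1 - t)%:E * f x + t%:E * g x) <=
       (1 - t)%:E * weak_cheeger d m V p q f + t%:E * weak_cheeger d m V p q g)
  /\
  (forall (f_ : nat -> X -> \bar R) (f : X -> \bar R),
     (forall i, measurable_ae_finite m (f_ i)) -> measurable_ae_finite m f ->
     {ae m, forall x, f_ i x @[i --> \oo] --> f x} ->
     weak_cheeger d m V p q f <=
       limn_einf (fun i => weak_cheeger d m V p q (f_ i))).
Proof.
have [[[dm _] _ polishX _ lscD] _] := hX.
split=> [f g t [_ fF] [_ gF] t01|f_ f f_F [_ fF] f_f].
  exact: (weak_cheeger_convex polishX dm lscD hA1 hp hpq).
apply: (weak_cheeger_lsc polishX dm lscD hA1 hp hpq) => // i.
by case: (f_F i).
Qed.
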